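(* Let $d\ge1$ and $1\le e\le d$ be integers, let $I\subset\mathbb{Z}^e$ be a finite index set, and let $\Lambda: I-I:=\{i-j:\ i,j\in I\}\to[0,1]$ satisfy $\Lambda(k)=\Lambda(-k)$ and $\Lambda(0)=1$. Let $$D_I:=\left\{x=(x_i)_{i\in I},\ x_i=(x_i^1,\dots,x_i^d)\in[0,1]^d:\ x_i^k\neq x_j^k \text{ for all } k\in\{1,\dots,d\} \text{ whenever } i\neq j\right\}.$$ For $x\in([0,1]^d)^I$ let $(C_i(x))_{i\in I}$ be the Voronoi partition of $[0,1]^d$ ($C_i(x)$ consists of the $\omega$ with $\Vert x_i-\omega\Vert<\Vert x_k-\omega\Vert$ for all $k\ne i$, ties assigned by lexicographical order), and $\bar C_i(x)$ its closure. Let $P(d\omega)=f(\omega)\,d\omega$ with $f$ continuous on $[0,1]^d$, and let $$V(x)=\frac12\sum_{i,j\in I}\Lambda(i-j)\int_{C_i(x)}\Vert x_j-\omega\Vert^2\,P(d\omega).$$ Then $V$ is continuously differentiable on $D_I$, and for every $i\in I$, $$\frac{\partial V}{\partial x_i}(x)=\sum_{k\in I}\Lambda(i-k)\int_{C_k(x)}(x_i-\omega)\,P(d\omega) +\frac12\sum_{j\in I}\sum_{k\in I,k\neq i}\big(\Lambda(k-j)-\Lambda(i-j)\big)\int_{\bar C_k(x)\cap\bar C_i(x)}\Vert x_j-\omega\Vert^2\left(\frac12\,\vec n^{\,ki}_x+\frac{1}{\Vert x_k-x_i\Vert}\Big(\frac{x_i+x_k}{2}-\omega\Big)\right)f(\omega)\,\lambda^{ki}_x(d\omega),$$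 where $\frac{\partial V}{\partial x_i}(x)$ denotes the column vector $\big(\frac{\partial V}{\partial x_i^1}(x),\dots,\frac{\partial V}{\partial x_i^d}(x)\big)^T$.
   Context: $\Vert\cdot\Vert$ is the Euclidean norm. For $i\neq j$, $\vec n^{\,ij}_x:=\frac{x_j-x_i}{\Vert x_j-x_i\Vert}$ (so $\vec n^{\,ki}_x=\frac{x_i-x_k}{\Vert x_i-x_k\Vert}$). $M^{ij}_x$ denotes the mediator (perpendicular bisector) hyperplane of $x_i$ and $x_j$ in $\mathbb{R}^d$, i.e. $\{u:\langle u-\frac{x_i+x_j}{2},x_i-x_j\rangle=0\}$, and $\lambda^{ij}_x$ is the $(d-1)$-dimensional Lebesgue measure on $M^{ij}_x$; the integrals over $\bar C_k(x)\cap\bar C_i(x)$ (a subset of $M^{ki}_x$) are taken with respect to $\lambda^{ki}_x$. *)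

(* Defs.v *)
From HB Require Import structures.
From mathcomp Require Import all_boot all_order all_algebra.
From mathcomp Require Import all_classical all_reals all_analysis.
Set Implicit Arguments. Unset Strict Implicit. Unset Printing Implicit Defensive.
Import Order.TTheory GRing.Theory Num.Theory.
Import numFieldNormedType.Exports.
Local Open Scope classical_set_scope.
Local Open Scope ring_scope.

Section Defs.
Variable R : realType.

Definition edot (d : nat) (u v : 'rV[R]_d) : R := \sum_(l < d) u 0 l * v 0 l.
Definition enorm (d : nat) (u : 'rV[R]_d) : R := Num.sqrt (edot u u).

Definition coord (d : nat) (u : 'rV[R]_d) (l : nat) : R :=
  if insub l is Some j then u 0 j else 0.

(* Iterated Lebesgue integral over R^n of g, which reads the coordinates
   0..n-1 of its argument (a sequence of reals); coordinates >= n are 0.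
   iint n g = \int dt_{n-1} ... \int dt_0  g(t_0,...,t_{n-1}). *)
Fixpoint iint (n : nat) (g : (nat -> R) -> R) : R :=
  match n with
  | 0 => g (fun _ => 0)
  | m.+1 => Rintegral (@lebesgue_measure R) setT
              (fun t => iint m (fun s => g (fun l => if l == m then t else s l)))
  end.

Definition Rd_int (d : nat) (F : 'rV[R]_d -> R) : R :=
  iint d (fun s => F (\row_(l < d) s (nat_of_ord l))).

Definition cube (d : nat) : set 'rV[R]_d :=
  [set w | forall l : 'I_d, 0 <= w 0 l <= 1].

Definition lexlt (e : nat) (u v : 'rV[int]_e) : Prop :=
  exists l : 'I_e, (forall l' : 'I_e, (l' < l)%N -> u 0 l' = v 0 l') /\ u 0 l < v 0 l.

(* Voronoi cell C_i(x) in [0,1]^d of the generator x_i = row i x, where the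
   index set I = {idx 0, ..., idx (n-1)} (idx injective); ties broken by the
   lexicographic order of the indices in Z^e. *)
Definition vcell (d e n : nat) (idx : 'I_n -> 'rV[int]_e) (x : 'M[R]_(n, d))
    (i : 'I_n) : set 'rV[R]_d :=
  [set w | @cube d w /\
     forall k : 'I_n, k != i ->
       enorm (row i x - w) < enorm (row k x - w) \/
       (enorm (row i x - w) = enorm (row k x - w) /\ lexlt (idx i) (idx k))].

(* Integral w.r.t. the (d-1)-dimensional Lebesgue measure lambda on the
   mediator hyperplane M of a and b, {u | <u - (a+b)/2, a - b> = 0}, computed
   through the parametrization of M as a graph over the first d-1 coordinates
   (area formula: d lambda = |a-b| / |a_{d-1} - b_{d-1}| ds).  This is valid
   whenever the last coordinates of a and b differ (always the case on D_I). *)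
Definition med_int (d : nat) (a b : 'rV[R]_d) (G : 'rV[R]_d -> R) : R :=
  let nv := a - b in
  let c := edot ((2%:R)^-1 *: (a + b)) nv in
  let last := coord nv d.-1 in
  let pt (s : nat -> R) : 'rV[R]_d :=
    \row_(l < d) (if (nat_of_ord l < d.-1)%N then s l
                  else (c - \sum_(l' < d.-1) s l' * coord nv l') / last) in
  iint d.-1 (fun s => G (pt s) * (enorm nv / `|last|)).

Definition DI (d n : nat) : set 'M[R]_(n, d) :=
  [set x | (forall i : 'I_n, @cube d (row i x)) /\
           forall i j : 'I_n, i != j -> forall k : 'I_d, x i k != x j k].

Definition Vpot (d e n : nat) (idx : 'I_n -> 'rV[int]_e) (Lam : 'rV[int]_e -> R)
    (f : 'rV[R]_d -> R) (x : 'M[R]_(n, d)) : R :=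
  (2%:R)^-1 * \sum_(i < n) \sum_(j < n) Lam (idx i - idx j) *
     Rd_int (fun w => \1_(vcell idx x i) w * (enorm (row j x - w) ^+ 2 * f w)).

Definition Vgrad (d e n : nat) (idx : 'I_n -> 'rV[int]_e) (Lam : 'rV[int]_e -> R)
    (f : 'rV[R]_d -> R) (x : 'M[R]_(n, d)) (i : 'I_n) (l : 'I_d) : R :=
  \sum_(k < n) Lam (idx i - idx k) *
     Rd_int (fun w => \1_(vcell idx x k) w * ((x i l - w 0 l) * f w))
  + (2%:R)^-1 * \sum_(j < n) \sum_(k < n | k != i)
      (Lam (idx k - idx j) - Lam (idx i - idx j)) *
      med_int (row k x) (row i x) (fun w =>
        \1_(closure (vcell idx x k) `&` closure (vcell idx x i)) w *
        (enorm (row j x - w) ^+ 2 *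
         ((2%:R)^-1 * ((row i x - row k x) 0 l / enorm (row i x - row k x))
          + (enorm (row k x - row i x))^-1 *
            ((2%:R)^-1 * (x i l + x k l) - w 0 l)) * f w)).

(* continuous differentiability on a set D: differentiable at every point of
   D, and the differential is continuous on D (tested on every direction,
   which is the operator topology in finite dimension) *)
Definition C1_on (n d : nat) (V : 'M[R]_(n, d) -> R) (D : set 'M[R]_(n, d)) :=
  (forall x, D x -> differentiable V x) /\
  (forall v : 'M[R]_(n, d), {within D, continuous (fun x => 'd V x v)}).

End Defs.
Arguments cube {R} d _.
Arguments DI {R} d n _.

(* Main.v *)
(** Write [h_i(x, w) = 1/2 sum_j Lam(i - j) |x_j - w|^2 f(w)], so that
    [V(x) = sum_i int_(C_i(x)) h_i(x, w) dw].  The increment [V(y) - V(x)] splits into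
    [sum_i int_(C_i(y)) (h_i(y) - h_i(x))], whose linear part follows by dominated
    convergence, and the transfer terms
    [1/2 sum_(i <> k) int (1_(C_i(y), C_k(x)) - 1_(C_k(y), C_i(x))) (h_i(x) - h_k(x))].
    By Fubini a transfer term is integrated first along the last coordinate [t], over
    a point [s] of the first [d - 1] coordinates.  Since [|x_k - w|^2 - |x_i - w|^2] is affine
    in [t], the slice is an interval between the two mediator points [tau x s] and
    [tau y s], of length O(|y - x|), and for almost every [s] the mediator point is either
    interior to the cube and strictly closer to [x_i] and [x_k] than to the other
    generators, in which case the slice is exactly that interval, or strictly outside the
    cell, in which case the slice is empty for [y] close to [x].  Dominated convergence in
    [s] gives the Frechet derivative; the same alternative gives its continuity.  Distinct
    coordinates make every exceptional set of [s] the zero set of a nonzero affine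
    function. *)

Require Import Defs.
From HB Require Import structures.
From mathcomp Require Import all_boot all_order all_algebra.
From mathcomp Require Import all_classical all_reals all_analysis.
From mathcomp Require Import measurable_realfun ring lra.
Import Order.TTheory GRing.Theory Num.Theory.
Import numFieldNormedType.Exports.
Local Open Scope classical_set_scope.
Local Open Scope ring_scope.

(** * Iterated Lebesgue integrals *)

Section IteratedIntegral.
Context {R : realType}.
Local Notation mu := (@lebesgue_measure R).
Local Notation "'Rint' phi" := (Rintegral mu setT phi) (at level 10, phi at level 8).

(** The first obstacle is that [iint] is a bare recursion on [Rintegral], with no product measure
    behind it, and [Rintegral] sends infinite values to 0. Linearity, Fubini and dominated
    convergence are therefore obtained by induction on the dimension, for measurable bounded
    functions vanishing off the unit cube. This class is stable under freezing a coordinate; hence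
    the predicates [bsupp], [good] and [goodrow], with an explicit bound, that accompany every
    integrand. Two cancellations make the limit match the stated gradient. In the surface term the
    half normal and the midpoint vector add up to [x_i - w] over the distance of [x_i] and [x_k],
    and this distance cancels against the area factor of the graph parametrization. In the transfer
    terms the displacement of a mediator is the contribution of [x_k] minus that of [x_i];
    exchanging the two indices collects the own contribution of each generator and absorbs the
    factor 1/2. Differentiability is tested against all matrices [y] near [x], and these may leave
    the cube; what is kept of [DI] for them is that the last coordinates stay distinct. *)

Definition bsupp (M : R) (phi : R -> R) :=
  [/\ measurable_fun setT phi, forall t, `|phi t| <= M &
      forall t, ~~ (0 <= t <= 1) -> phi t = 0].

Lemma bsupp_dom M phi t : bsupp M phi -> `|phi t| <= M * \1_(`[0, 1]%classic) t.
Proof.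
move=> [_ b z]; rewrite indicE; have [tin|tin] := boolP (0 <= t <= 1).
  by rewrite mem_set ?mulr1 //= in_itv.
by rewrite z // normr0 memNset ?mulr0 //= in_itv /=; apply/negP.
Qed.

Lemma integrable_itv01 (M a b : R) :
  mu.-integrable setT (EFin \o (fun t => M * \1_(`[a, b]%classic) t)).
Proof.
have -> : EFin \o (fun t : R => M * \1_(`[a, b]%classic) t) =
  (fun t => M%:E * (EFin \o (\1_(`[a, b]%classic) : R -> R)) t)%E.
  by apply/funext => t.
by apply: integrableZl => //; exact: integrable_indic_itv.
Qed.

Lemma le_integrable_itv (M a b : R) (phi : R -> R) : measurable_fun setT phi ->
  (forall t, `|phi t| <= M * \1_(`[a, b]%classic) t) ->
  mu.-integrable setT (EFin \o phi).
Proof.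
move=> mphi H; apply: (le_integrable measurableT _ _ (integrable_itv01 M a b)).
  exact/measurable_EFinP.
move=> t _ /=; rewrite lee_fin (le_trans (H t)) // ler_norm //.
Qed.

Lemma bsupp_integrable M phi : bsupp M phi -> mu.-integrable setT (EFin \o phi).
Proof.
move=> H; apply: (@le_integrable_itv M 0 1); first by case: H.
by move=> t; exact: bsupp_dom.
Qed.

Lemma Rint_itv (M a b : R) : a <= b ->
  Rint (fun t => M * \1_(`[a, b]%classic) t) = M * (b - a).
Proof.
move=> ab; rewrite RintegralZl //; last exact: integrable_indic_itv.
congr (_ * _); rewrite /Rintegral integral_indic // setIT [X in fine X](@lebesgue_measure_itv R) /= lte_fin.
by case: ltgtP ab => //= -> _; rewrite subrr.
Qed.

Lemma le_Rint_itv (M a b : R) (phi : R -> R) : a <= b -> measurable_fun setT phi ->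
  (forall t, `|phi t| <= M * \1_(`[a, b]%classic) t) ->
  `|Rint phi| <= M * (b - a).
Proof.
move=> ab mphi H; have ip := le_integrable_itv _ _ _ _ mphi H.
rewrite -Rint_itv //; apply: (le_trans (le_normr_Rintegral measurableT ip)).
apply: le_Rintegral => //; last exact: integrable_itv01.
exact: (integrable_norm ip).
Qed.

Lemma bsupp_le M phi : bsupp M phi -> `|Rint phi| <= M.
Proof.
move=> H; rewrite -[leRHS]mulr1 -[1 in leRHS]subr0; apply: le_Rint_itv => //.
  by case: H.
by move=> t; exact: bsupp_dom.
Qed.

Lemma Rint_cvg0 M (phi : nat -> R -> R) : (forall k, bsupp M (phi k)) ->
  (forall t, phi ^~ t @ \oo --> 0) -> (fun k => Rint (phi k)) @ \oo --> 0.
Proof.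
move=> H c.
have := @dominated_convergence _ _ R mu setT measurableT
  (fun k t => (phi k t)%:E) (cst 0%E) (EFin \o (fun t => M * \1_(`[0,1]%classic) t)).
case.
- by move=> k; apply/measurable_EFinP; case: (H k).
- exact: measurable_cst.
- by apply: aeW => t _; apply/fine_cvgP; split; [exact: nearW | exact: c].
- exact: integrable_itv01.
- apply: aeW => t k _ /=; rewrite lee_fin; exact: bsupp_dom.
move=> _ _; rewrite integral0 => h.
exact: (fine_cvg h).
Qed.

Lemma measurable_Rint d (T : measurableType d) (k : T * R -> R) :
  measurable_fun setT k -> measurable_fun setT (fun z => Rint (fun t => k (z, t))).
Proof.
move=> mk; apply: (@measurableT_comp _ _ _ _ _ _ (@fine R)) => //.
have mE : measurable_fun setT (EFin \o k) by apply/measurable_EFinP.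
under eq_fun do rewrite integralE.
apply: emeasurable_funB.
- rewrite (_ : (fun x => _) = fubini_F mu ((EFin \o k)^\+)%E); last first.
    by apply/funext => x; apply: eq_integral => y _; rewrite ?funeposE ?funenegE.
  by apply: measurable_fun_fubini_tonelli_F => //; exact: measurable_funepos.
- rewrite (_ : (fun x => _) = fubini_F mu ((EFin \o k)^\-)%E); last first.
    by apply/funext => x; apply: eq_integral => y _; rewrite ?funeposE ?funenegE.
  by apply: measurable_fun_fubini_tonelli_F => //; exact: measurable_funeneg.
Qed.

(** Domination by a multiple of the indicator of the unit square gives integrability for the product
    measure, so Fubini applies. The inner integrals are finite for the same reason, which lets
    [fine] pass through the outer one. *)
Lemma Rint_swap M (k : R * R -> R) : measurable_fun setT k ->
  (forall z, `|k z| <= M * (\1_(`[0,1]%classic) z.1 * \1_(`[0,1]%classic) z.2)) ->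
  Rint (fun a => Rint (fun b => k (a, b))) = Rint (fun b => Rint (fun a => k (a, b))).
Proof.
move=> mk bk.
have M0 : 0 <= M.
  have /= := bk (0, 0); rewrite !indicE !mem_set ?mulr1 /= ?in_itv /= ?lexx ?ler01 //.
  by move=> h; apply: le_trans h.
have mE : measurable_fun setT (EFin \o k) by exact/measurable_EFinP.
have ik : (mu \x mu)%E.-integrable setT (EFin \o k).
  apply/integrable12ltyP => //.
  apply: (@le_lt_trans _ _ (\int[mu]_x (M * \1_(`[0,1]%classic) x)%:E)%E).
    apply: ge0_le_integral => //.
    - by move=> x _; apply: integral_ge0.
    - have := @measurable_fun_fubini_tonelli_F _ _ (measurableTypeR R) (measurableTypeR R) R mu (abse \o (EFin \o k))%E.
      by apply => //=; apply: measurableT_comp.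
    - by apply/measurable_EFinP; apply: measurable_funM => //; apply: measurable_indic.
    move=> x _; apply: (@le_trans _ _ (\int[mu]_y ((M * \1_(`[0,1]%classic) x) * \1_(`[0,1]%classic) y)%:E)%E).
      apply: ge0_le_integral => //.
      - apply: measurableT_comp => //.
        by apply/measurable_EFinP; exact: measurable_fun_pair2.
      - by apply/measurable_EFinP; apply: measurable_funM => //; apply: measurable_indic.
      - by move=> y _; rewrite lee_fin /= (le_trans (bk (x, y))) // mulrA.
    have /fineK <- : (\int[mu]_y (M * \1_(`[0,1]%classic) x * \1_(`[0,1]%classic) y)%:E)%E \is a fin_num.
      by apply: integrable_fin_num => //; exact: integrable_itv01.
    by have /= := @Rint_itv (M * \1_(`[0,1]%classic) x) 0 1 ler01; rewrite /Rintegral => ->; rewrite lee_fin subr0 mulr1.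
  by apply: (integrable_lty measurableT); exact: integrable_itv01.
have F := Fubini ik.
have fin1 x : (\int[mu]_y (k (x, y))%:E = (Rint (fun b => k (x, b)))%:E)%E.
  rewrite /Rintegral fineK //; apply: integrable_fin_num => //.
  apply: (@le_integrable_itv (M * \1_(`[0,1]%classic) x) 0 1).
    exact: measurable_fun_pair2.
  by move=> t; rewrite (le_trans (bk _)) //= mulrA.
have fin2 y : (\int[mu]_x (k (x, y))%:E = (Rint (fun a => k (a, y)))%:E)%E.
  rewrite /Rintegral fineK //; apply: integrable_fin_num => //.
  apply: (@le_integrable_itv (M * \1_(`[0,1]%classic) y) 0 1).
    exact: measurable_fun_pair1.
  by move=> t; rewrite (le_trans (bk _)) //= [\1__ _ * \1__ _]mulrC mulrA.
rewrite [LHS]/Rintegral [RHS]/Rintegral; congr fine.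
under eq_integral do rewrite -fin1.
under [in RHS]eq_integral do rewrite -fin2.
exact: F.
Qed.

Definition upd (m : nat) (t : R) (s : nat -> R) : nat -> R :=
  fun l => if l == m then t else s l.

Lemma iintS m g : iint m.+1 g = Rint (fun t => iint m (fun s => g (upd m t s))).
Proof. by []. Qed.

(* Joint measurability in the parameter and in the coordinates is expressed by
   composition with measurable families, so that no sigma-algebra is needed on
   [nat -> R]. *)
Definition jmeas d (T : measurableType d) (g : T -> (nat -> R) -> R) :=
  forall d' (S : measurableType d') (p : S -> T) (s : S -> nat -> R),
    measurable_fun setT p -> (forall l, measurable_fun setT (s ^~ l)) ->
    measurable_fun setT (fun z => g (p z) (s z)).

Definition cmeas (g : (nat -> R) -> R) :=
  forall d' (S : measurableType d') (s : S -> nat -> R),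
    (forall l, measurable_fun setT (s ^~ l)) ->
    measurable_fun setT (fun z => g (s z)).

Lemma measurable_upd d' (S : measurableType d') m (t : S -> R) (s : S -> nat -> R) l :
  measurable_fun setT t -> (forall l, measurable_fun setT (s ^~ l)) ->
  measurable_fun setT (fun z => upd m (t z) (s z) l).
Proof. by move=> mt ms; rewrite /upd; case: eqP. Qed.

Lemma jmeas_iint m d (T : measurableType d) (g : T -> (nat -> R) -> R) :
  jmeas d T g -> measurable_fun setT (fun z => iint m (g z)).
Proof.
elim: m d T g => [|m IH] d T g mg; first by apply: mg.
apply: (@measurable_Rint _ _ (fun zt => iint m (fun s => g zt.1 (upd m zt.2 s)))).
apply: IH => d' S p s mp ms; apply: (mg _ _ (fst \o p) (fun z => upd m (p z).2 (s z))).
  exact: measurableT_comp.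
by move=> l; apply: measurable_upd => //; exact: measurableT_comp.
Qed.

Lemma cmeas_jmeas_upd m g : cmeas g -> jmeas _ R (fun t s => g (upd m t s)).
Proof. by move=> mg d' S p s mp ms; apply: mg => l; exact: measurable_upd. Qed.

Lemma cmeas_upd m g t : cmeas g -> cmeas (fun s => g (upd m t s)).
Proof. by move=> mg d' S s ms; apply: mg => l; exact: measurable_upd. Qed.

Definition box (m : nat) (s : nat -> R) := forall l, (l < m)%N -> 0 <= s l <= 1.

Definition good (m : nat) (M : R) (g : (nat -> R) -> R) :=
  [/\ cmeas g, forall s, `|g s| <= M & forall s, ~ box m s -> g s = 0].

Lemma good_upd m M g t : good m.+1 M g -> good m M (fun s => g (upd m t s)).
Proof.
move=> [mg bg zg]; split; [exact: cmeas_upd|by []|].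
move=> s ns; apply: zg => bs; apply: ns => l lm.
by have := bs l (ltnW lm); rewrite /upd ltn_eqF.
Qed.

Lemma good_upd0 m M g t s : good m.+1 M g -> ~~ (0 <= t <= 1) -> g (upd m t s) = 0.
Proof.
move=> [_ _ zg] /negP nt; apply: zg => /(_ m (ltnSn m)); by rewrite /upd eqxx.
Qed.

Lemma good_ge0 m M g : good m M g -> 0 <= M.
Proof. by case=> _ /(_ (fun=> 0)) h _; apply: le_trans h. Qed.

Lemma iint0 m : iint m (fun=> 0 : R) = 0.
Proof.
elim: m => // m IH; rewrite iintS; under eq_Rintegral do rewrite IH.
by rewrite /Rintegral integral0.
Qed.

(** The two claims are proved together, since the bound on the slices at one level is the bound on
    the integral at the level below. *)
Lemma iint_bsupp m M g : good m.+1 M g ->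
  bsupp M (fun t => iint m (fun s => g (upd m t s))) /\ `|iint m.+1 g| <= M.
Proof.
elim: m g => [|m IH] g Hg.
  suff H : bsupp M (fun t => iint 0 (fun s => g (upd 0 t s))).
    by split => //; exact: bsupp_le.
  split.
  - apply: jmeas_iint; apply: cmeas_jmeas_upd; by case: Hg.
  - by move=> t /=; case: Hg.
  - move=> t nt /=; exact: (good_upd0 _ _ _ _ _ Hg nt).
suff H : bsupp M (fun t => iint m.+1 (fun s => g (upd m.+1 t s))).
  by split => //; exact: bsupp_le.
split.
- apply: jmeas_iint; apply: cmeas_jmeas_upd; by case: Hg.
- by move=> t; apply: (IH _ _).2; exact: good_upd.
- move=> t nt; rewrite -[RHS](iint0 m.+1); congr iint; apply/funext => s.
  exact: (good_upd0 _ _ _ _ _ Hg nt).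
Qed.

Lemma iint_le m M g : good m M g -> `|iint m g| <= M.
Proof. by case: m => [[_ + _]|m /iint_bsupp []//]; exact. Qed.

Lemma iint_slice m M g : good m.+1 M g ->
  bsupp M (fun t => iint m (fun s => g (upd m t s))).
Proof. by move=> /iint_bsupp []. Qed.

Lemma goodD m M1 M2 g1 g2 : good m M1 g1 -> good m M2 g2 ->
  good m (M1 + M2) (fun s => g1 s + g2 s).
Proof.
move=> [m1 b1 z1] [m2 b2 z2]; split.
- by move=> d S s ms; apply: measurable_funD; [exact: m1|exact: m2].
- by move=> t; rewrite (le_trans (ler_normD _ _)) // lerD.
- by move=> t ht; rewrite z1 // z2 // addr0.
Qed.

Lemma goodZ m M g c : good m M g -> good m (`|c| * M) (fun s => c * g s).
Proof.
move=> [m1 b1 z1]; split.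
- by move=> d S s ms; apply: measurable_funM => //; exact: m1.
- by move=> t; rewrite normrM ler_wpM2l.
- by move=> t ht; rewrite z1 // mulr0.
Qed.

Lemma good_le m M M' g : M <= M' -> good m M g -> good m M' g.
Proof. by move=> MM [? b ?]; split => // s; rewrite (le_trans (b s)). Qed.

Lemma good0 m : good m 0 (fun=> 0).
Proof. by split => [d S s ms|s|s _] //; rewrite normr0. Qed.

Lemma good_sum m (I : Type) (r : seq I) (P : pred I) (M : I -> R) (g : I -> (nat -> R) -> R) :
  (forall i, good m (M i) (g i)) ->
  good m (\sum_(i <- r | P i) M i) (fun s => \sum_(i <- r | P i) g i s).
Proof.
move=> H; elim: r => [|i r IH].
  rewrite big_nil; have -> : (fun s => \sum_(j <- [::] | P j) g j s) = fun=> 0 by apply/funext => s; rewrite big_nil.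
  exact: good0.
have -> : (fun s => \sum_(j <- i :: r | P j) g j s) =
  (fun s => if P i then g i s + \sum_(j <- r | P j) g j s else \sum_(j <- r | P j) g j s).
  by apply/funext => s; rewrite big_cons.
rewrite big_cons.
by case: (P i) => //; exact: goodD.
Qed.

Lemma iintD m M1 M2 g1 g2 : good m M1 g1 -> good m M2 g2 ->
  iint m (fun s => g1 s + g2 s) = iint m g1 + iint m g2.
Proof.
elim: m g1 g2 => // m IH g1 g2 H1 H2; rewrite !iintS.
under eq_Rintegral do rewrite (IH _ _ (good_upd _ _ _ _ H1) (good_upd _ _ _ _ H2)).
by rewrite RintegralD //; [apply: (bsupp_integrable M1)|apply: (bsupp_integrable M2)]; apply: iint_slice.
Qed.

Lemma iintZ m M g c : good m M g -> iint m (fun s => c * g s) = c * iint m g.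
Proof.
elim: m g => // m IH g H; rewrite !iintS.
under eq_Rintegral do rewrite (IH _ (good_upd _ _ _ _ H)).
by rewrite RintegralZl //; apply: (bsupp_integrable M); apply: iint_slice.
Qed.

Lemma iintB m M1 M2 g1 g2 : good m M1 g1 -> good m M2 g2 ->
  iint m (fun s => g1 s - g2 s) = iint m g1 - iint m g2.
Proof.
move=> H1 H2; rewrite -mulN1r -(iintZ _ _ _ _ H2) -(iintD _ _ _ _ _ H1 (goodZ _ _ _ _ H2)).
by congr iint; apply/funext => s; rewrite mulN1r.
Qed.

Lemma iint_sum m (I : Type) (r : seq I) (P : pred I) (M : I -> R) (g : I -> (nat -> R) -> R) :
  (forall i, good m (M i) (g i)) ->
  iint m (fun s => \sum_(i <- r | P i) g i s) = \sum_(i <- r | P i) iint m (g i).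
Proof.
move=> H; elim: r => [|i r IH].
  by rewrite big_nil -[RHS](iint0 m); congr iint; apply/funext => s; rewrite big_nil.
have -> : (fun s => \sum_(j <- i :: r | P j) g j s) =
  (fun s => if P i then g i s + \sum_(j <- r | P j) g j s else \sum_(j <- r | P j) g j s).
  by apply/funext => s; rewrite big_cons.
rewrite big_cons.
case: (P i) => //; rewrite (iintD _ _ _ _ _ (H i) (good_sum _ _ r P _ _ H)) IH //.
Qed.

Lemma iint_ge0 m (g : (nat -> R) -> R) : (forall s, 0 <= g s) -> 0 <= iint m g.
Proof.
by elim: m g => [|m IH] g H; [exact: H|rewrite iintS]; apply: Rintegral_ge0 => t _; exact: IH.
Qed.

Lemma le_iint m M1 M2 g1 g2 : good m M1 g1 -> good m M2 g2 ->
  (forall s, g1 s <= g2 s) -> iint m g1 <= iint m g2.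
Proof.
move=> H1 H2 H; rewrite -subr_ge0 -(iintB _ _ _ _ _ H2 H1).
by apply: iint_ge0 => s; rewrite subr_ge0.
Qed.

Lemma good_norm m M g : good m M g -> good m M (fun s => `|g s|).
Proof.
move=> [m1 b1 z1]; split.
- by move=> d S s ms; apply: measurableT_comp => //; exact: m1.
- by move=> t; rewrite normr_id.
- by move=> t ht; rewrite z1 // normr0.
Qed.

Lemma iint_norm m M g : good m M g -> `|iint m g| <= iint m (fun s => `|g s|).
Proof.
move=> H; rewrite ler_norml -[- _]mulN1r -(iintZ _ _ _ _ (good_norm _ _ _ H)).
apply/andP; split.
  apply: (le_iint _ _ _ _ _ (goodZ _ _ _ _ (good_norm _ _ _ H)) H) => s.
  by rewrite mulN1r lerNl -normrN ler_norm.
by apply: (le_iint _ _ _ _ _ H (good_norm _ _ _ H)) => s; rewrite ler_norm.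
Qed.

Lemma iint_cvg0 m M (g : nat -> (nat -> R) -> R) : (forall k, good m M (g k)) ->
  (forall s, g ^~ s @ \oo --> 0) -> (fun k => iint m (g k)) @ \oo --> 0.
Proof.
elim: m g => [|m IH] g H c; first exact: c.
apply: (@Rint_cvg0 M (fun k t => iint m (fun s => g k (upd m t s)))).
  by move=> k; exact: iint_slice.
by move=> t; apply: IH => // k; exact: good_upd.
Qed.

Lemma good_Rint m M g : good m.+1 M g -> good m M (fun s => Rint (fun t => g (upd m t s))).
Proof.
move=> [mg bg zg]; split.
- move=> d S s ms; apply: (@measurable_Rint _ _ (fun zt => g (upd m zt.2 (s zt.1)))).
  by apply: mg => l; apply: measurable_upd => // l'; apply: (measurableT_comp (ms l')).
- move=> s; apply: bsupp_le; split => //.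
    by apply: mg => l; apply: measurable_upd.
  by move=> t; exact: (@good_upd0 m M).
- move=> s ns; rewrite /Rintegral; under eq_integral.
    move=> t _; rewrite zg; first over.
    by move=> bs; apply: ns => l lm; have := bs l (ltnW lm); rewrite /upd ltn_eqF.
  by rewrite integral0.
Qed.

(** The outer variable is moved inwards past one coordinate at a time, each move being a
    two-dimensional swap by [Rint_swap]. *)
Lemma Rint_iint_swap m M (k : R -> (nat -> R) -> R) :
  (forall t, good m M (k t)) -> (forall t s, ~~ (0 <= t <= 1) -> k t s = 0) ->
  jmeas _ R k ->
  Rint (fun t => iint m (k t)) = iint m (fun s => Rint (fun t => k t s)).
Proof.
move=> Hg Hz; elim: m k Hg Hz => // m IH k Hg Hz jk.
rewrite iintS; under [RHS]eq_Rintegral => u _.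
  rewrite -(IH (fun t s => k t (upd m u s))).
  - over.
  - by move=> t; exact: good_upd.
  - by move=> t s; exact: Hz.
  - move=> d S q s mq ms; apply: (jk _ _ q (fun z => upd m u (s z))) => // l.
    exact: measurable_upd.
rewrite -(@Rint_swap M (fun z => iint m (fun s => k z.1 (upd m z.2 s)))) //=.
  apply: (@jmeas_iint _ _ (R * R)%type (fun z s => k z.1 (upd m z.2 s))).
  move=> d S q s mq ms; apply: (jk _ _ (fst \o q) (fun z => upd m (q z).2 (s z))).
    exact: measurableT_comp.
  by move=> l; apply: measurable_upd => //; exact: measurableT_comp.
move=> [t u] /=; rewrite !indicE.
have [t01|nt] := boolP (0 <= t <= 1); last first.
  rewrite [X in iint m X](_ : _ = fun=> 0); last by apply/funext => s; exact: Hz.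
  by rewrite iint0 normr0 mulr_ge0 // (good_ge0 _ _ _ (Hg 0)).
have [u01|nu] := boolP (0 <= u <= 1); last first.
  rewrite [X in iint m X](_ : _ = fun=> 0); last first.
    by apply/funext => s; exact: (good_upd0 _ _ _ _ _ (Hg t)).
  by rewrite iint0 normr0 mulr_ge0 // (good_ge0 _ _ _ (Hg 0)).
rewrite !mem_set //= !mulr1; apply: iint_le; exact: good_upd.
Qed.

(** The recursion defining [iint] puts the last coordinate outermost, whereas the analysis of slices
    needs it innermost. *)
Lemma iint_last m M g : good m.+1 M g ->
  iint m.+1 g = iint m (fun s => Rint (fun t => g (upd m t s))).
Proof.
move=> Hg; rewrite iintS; apply: (@Rint_iint_swap m M) => //.
- by move=> t; exact: good_upd.
- by move=> t s; exact: (good_upd0 _ _ _ _ _ Hg).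
- by apply: cmeas_jmeas_upd; case: Hg.
Qed.

End IteratedIntegral.

(** * Null sets of the iterated integral *)

Section AlmostEverywhere.
Context {R : realType}.
Local Notation mu := (@lebesgue_measure R).
Local Notation "'Rint' phi" := (Rintegral mu setT phi) (at level 10, phi at level 8).

(* Almost everywhere on the unit cube of R^m: the exceptional set is dominated by a
   nonnegative function of vanishing iterated integral. *)
Definition ae (m : nat) (P : (nat -> R) -> Prop) :=
  exists M g, [/\ good m M g, forall s, 0 <= g s, iint m g = 0 &
    forall s, box m s -> ~ P s -> 1 <= g s].

Lemma aeT m (P : (nat -> R) -> Prop) : (forall s, box m s -> P s) -> ae m P.
Proof.
move=> H; exists 0, (fun=> 0); split => //; [exact: good0|exact: iint0|].
by move=> s bs /(_ (H s bs)).
Qed.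

Lemma ae_mono m (P Q : (nat -> R) -> Prop) :
  (forall s, box m s -> P s -> Q s) -> ae m P -> ae m Q.
Proof.
move=> PQ [M [g [? ? ? H]]]; exists M, g; split => // s bs nQ.
by apply: H => // Ps; apply: nQ; exact: PQ.
Qed.

Lemma ae_and m (P Q : (nat -> R) -> Prop) : ae m P -> ae m Q ->
  ae m (fun s => P s /\ Q s).
Proof.
move=> [M [g [gg g0 ig Hg]]] [N [h [gh h0 ih Hh]]].
exists (M + N), (fun s => g s + h s); split.
- exact: goodD.
- by move=> s; rewrite addr_ge0.
- by rewrite (iintD _ _ _ _ _ gg gh) ig ih addr0.
- move=> s bs; have [Ps|nPs] := pselect (P s).
    move=> nPQ; have nQ : ~ Q s by move=> Qs; apply: nPQ.
    by rewrite -[1]add0r lerD // Hh.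
  by move=> _; rewrite -[1]addr0 lerD // Hg.
Qed.

Lemma ae_forall m (I : finType) (P : I -> (nat -> R) -> Prop) :
  (forall i, ae m (P i)) -> ae m (fun s => forall i, P i s).
Proof.
move=> H; suff : ae m (fun s => forall i, i \in enum I -> P i s).
  by apply: ae_mono => s _ + i; apply; rewrite mem_enum.
elim: (enum I) => [|a r IH]; first exact: aeT.
apply: ae_mono (ae_and _ _ _ (H a) IH) => s _ [Pa Pr] i.
by rewrite inE => /orP[/eqP ->|/Pr].
Qed.

Lemma ae_imp m (Q : Prop) (P : (nat -> R) -> Prop) :
  (Q -> ae m P) -> ae m (fun s => Q -> P s).
Proof.
move=> H; have [q|nq] := pselect Q; last by apply: aeT => s _ /nq.
by apply: ae_mono (H q).
Qed.

Lemma good_sub m M g (A : set (nat -> R)) :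
  (forall d' (S : measurableType d') (s : S -> nat -> R),
    (forall l, measurable_fun setT (s ^~ l)) -> measurable (s @^-1` A)) ->
  good m M g -> good m M (fun s => \1_A s * g s).
Proof.
move=> mA [mg bg zg]; split.
- move=> d S s ms; apply: measurable_funM; last exact: mg.
  rewrite (_ : (fun z => _) = (\1_(s @^-1` A) : _ -> R)); last by apply/funext => z; rewrite !indicE.
  by apply: measurable_indic; exact: mA.
- move=> s; rewrite normrM -[leRHS]mul1r ler_pM // indicE.
  by case: (_ \in _); rewrite ?normr1 ?normr0.
- by move=> s /zg ->; rewrite mulr0.
Qed.

(** Let [h] be the function dominating the exceptional set. On [h < 1] convergence holds everywhere,
    so dominated convergence applies to the integrand cut to that set; elsewhere the integrand is at
    most [M * h], whose integral vanishes. *)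
Lemma iint_ae_cvg0 m M (g : nat -> (nat -> R) -> R) : (forall k, good m M (g k)) ->
  ae m (fun s => g ^~ s @ \oo --> 0) -> (fun k => iint m (g k)) @ \oo --> 0.
Proof.
move=> Hg [N [h [gh h0 ih Hh]]].
pose A : set (nat -> R) := [set s | h s < 1].
have mA : forall d' (S : measurableType d') (s : S -> nat -> R),
    (forall l, measurable_fun setT (s ^~ l)) -> measurable (s @^-1` A).
  move=> d' S s ms; have mh : measurable_fun setT (fun z => h (s z)) by case: gh => + _ _; exact.
  have := mh measurableT `]-oo, 1[%classic (measurable_itv _).
  by rewrite setTI; congr measurable; apply/seteqP; split => z /=; rewrite in_itv.
have gA k := good_sub _ _ _ _ mA (good_norm _ _ _ (Hg k)).
have c : (fun k => iint m (fun s => \1_A s * `|g k s|)) @ \oo --> 0.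
  apply: (@iint_cvg0 _ m M) => // s.
  have [bs|nbs] := pselect (box m s); last first.
    rewrite (_ : (fun k => _) = fun=> 0); first exact: cvg_cst.
    by apply/funext => k; case: (Hg k) => _ _ -> //; rewrite normr0 mulr0.
  rewrite indicE; have [sA|sA] := boolP (s \in A); last first.
    by under eq_fun do rewrite mul0r; exact: cvg_cst.
  under eq_fun do rewrite mul1r; rewrite -(normr0 R); apply: cvg_norm.
  apply: contrapT => nP; move: sA; rewrite inE /A /= => hs.
  by have := Hh s bs nP; rewrite leNgt hs.
apply/cvgr0Pnorm_lt => e e0; move/cvgr0Pnorm_lt : c => /(_ e e0).
apply: filterS => k; apply: le_lt_trans.
apply: (le_trans (iint_norm _ _ _ (Hg k))); apply: le_trans (ler_norm _).
have M0 := good_ge0 _ _ _ (Hg 0).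
have -> : iint m (fun s => \1_A s * `|g k s|) = iint m (fun s => M * h s + \1_A s * `|g k s|).
  by rewrite (iintD _ _ _ _ _ (goodZ _ _ _ _ gh) (gA k)) (iintZ _ _ _ _ gh) ih mulr0 add0r.
apply: (le_iint _ _ _ _ _ (good_norm _ _ _ (Hg k)) (goodD _ _ _ _ _ (goodZ _ _ _ M gh) (gA k))) => s.
rewrite indicE; have [_|nA] := boolP (s \in A).
  by rewrite mul1r lerDr mulr_ge0.
rewrite mul0r addr0; case: (Hg k) => _ /(_ s) b _; apply: (le_trans b).
rewrite -[leLHS]mulr1 ler_wpM2l // leNgt; apply: contra nA => h1; by rewrite inE.
Qed.

Lemma iint_ae0 m M g : good m M g -> ae m (fun s => g s = 0) -> iint m g = 0.
Proof.
move=> Hg Ha; have := @iint_ae_cvg0 m M (fun=> g) (fun=> Hg).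
move=> /(_ _)/cvg_lim <- //; first by apply/esym; exact: lim_cst.
by apply: ae_mono Ha => s _ ->; exact: cvg_cst.
Qed.

Lemma eq_ae_iint m M1 M2 g1 g2 : good m M1 g1 -> good m M2 g2 ->
  ae m (fun s => g1 s = g2 s) -> iint m g1 = iint m g2.
Proof.
move=> H1 H2 H; apply/eqP; rewrite -subr_eq0 -(iintB _ _ _ _ _ H1 H2); apply/eqP.
apply: (@iint_ae0 _ (M1 + `|-1| * M2)).
  have := goodD _ _ _ _ _ H1 (goodZ _ _ _ (-1) H2).
  by congr good; apply/funext => s; rewrite mulN1r.
by apply: ae_mono H => s _ ->; rewrite subrr.
Qed.

(** Dominated convergence speaks of sequences, differentiability of a limit at a point; balls of
    radius [1/(k+1)] around [x] bridge the two. *)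
Lemma cvg_at_seq (V : normedModType R) (x : V) (phi : V -> R) (l : R) :
  (forall u : nat -> V, u @ \oo --> x -> (phi \o u) @ \oo --> l) -> phi @ x --> l.
Proof.
move=> H; apply/cvgrPdist_lt => e e0; apply: contrapT => nH.
have ex k : exists y, `|x - y| < k.+1%:R^-1 /\ e <= `|l - phi y|.
  apply: contrapT => nex; apply: nH.
  have k0 : 0 < k.+1%:R^-1 :> R by rewrite invr_gt0.
  have : \forall y \near x, `|x - y| < k.+1%:R^-1 by apply: cvgr_dist_lt => //; exact: cvg_id.
  by apply: filterS => y xy; rewrite ltNge; apply/negP => le; apply: nex; exists y.
have [u Hu] := choice ex.
have cu : u @ \oo --> x.
  apply/cvgrPdist_lt => d d0; near=> k; apply: lt_trans (Hu k).1 _.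
  by near: k; exact: near_infty_natSinv_lt (PosNum d0).
have /cvgrPdist_lt /(_ e e0) [N _ HN] := H u cu.
by have := HN N (leqnn N); rewrite ltNge (Hu N).2.
Unshelve. all: by end_near. Qed.

Lemma iint_cvg_at (V : normedModType R) (x : V) m M (g : V -> (nat -> R) -> R) :
  (\forall y \near x, good m M (g y)) ->
  ae m (fun s => g y s @[y --> x] --> 0) -> iint m (g y) @[y --> x] --> 0.
Proof.
move=> Hg Ha.
have M0 : 0 <= M by have /nbhs_singleton/good_ge0 := Hg.
(* The bound is only known near [x], while a sequence tending to [x] may start far away; replacing
   the bad functions by 0 makes every term [good] without changing the limit. *)
pose g' y := if `[< good m M (g y) >] then g y else fun=> 0.
have gg' : \forall y \near x, g y = g' y.
  by apply: filterS Hg => y Hy; rewrite /g' asboolT.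
suff : iint m (g' y) @[y --> x] --> 0.
  apply: cvg_trans; apply: near_eq_cvg; apply: filterS gg' => y -> //.
apply: cvg_at_seq => u cu; apply: (@iint_ae_cvg0 m M (g' \o u)).
  move=> k; rewrite /g' /=; case: asboolP => //; move=> _.
  exact: good_le (good0 m).
apply: ae_mono Ha => s _ c.
have c' : g' y s @[y --> x] --> 0.
  by apply: cvg_trans c; apply: near_eq_cvg; apply: filterS gg' => y ->.
exact: (cvg_comp _ _ cu c').
Qed.

Definition aff (m : nat) (al : R) (be : nat -> R) (s : nat -> R) :=
  al + \sum_(l < m) be l * s l.

(** The hyperplane is cut down to the box so that its indicator is [good]. *)
Definition zaff m al be : set (nat -> R) := [set s | box m s /\ aff m al be s = 0].

Lemma good_zaff m al be : good m 1 (\1_(zaff m al be)).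
Proof.
split.
- move=> d S s ms.
  rewrite (_ : (fun z => _) = (\1_((fun z => aff m al be (s z)) @^-1` [set 0] `&`
     \bigcap_(l in `I_m) ((s ^~ l) @^-1` `[0, 1])) : _ -> R)).
    apply: measurable_indic; apply: measurableI.
      have maff : measurable_fun setT (fun z => aff m al be (s z)).
        apply: measurable_funD => //; apply: measurable_sum => l.
        by apply: measurable_funM.
      by rewrite -[X in measurable X]setTI; exact: (maff measurableT _ (measurable_set1 0)).
    apply: fin_bigcap_measurable => // l _.
    by rewrite -[X in measurable X]setTI; exact: (ms l measurableT _ (measurable_itv _)).
  apply/funext => z; rewrite !indicE; congr (_ : bool)%:R.
  apply/idP/idP; rewrite !inE /zaff /=.
    by move=> [bs ->]; split => // l /= lm; rewrite in_itv /=; exact: bs.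
  by move=> [-> H]; split => // l lm; have := H l lm; rewrite /= in_itv.
- by move=> s; rewrite indicE; case: (_ \in _); rewrite ?normr1 ?normr0.
- by move=> s nb; rewrite indicE memNset // => -[].
Qed.

(** Freezing the last coordinate at [t] leaves an affine function of the others with constant term
    [al + be m * t]. It is again nonzero except for at most one [t], and one point does not
    contribute to the outer integral. *)
Lemma iint_zaff m al be : (al != 0 \/ exists l, (l < m)%N /\ be l != 0) ->
  iint m (\1_(zaff m al be)) = 0.
Proof.
elim: m al => [|m IH] al nz.
  rewrite /= indicE memNset // /zaff /aff /= big_ord0 addr0 => -[_].
  by case: nz => [/eqP//|[l []]].
rewrite iintS.
(* The exceptional value is [- al / be m] when [be m] is the only nonzero linear coefficient; in the
   other cases every [t] works and 0 is a dummy. *)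
have [t0 Ht0] : exists t0, forall t, t != t0 ->
   al + be m * t != 0 \/ exists l, (l < m)%N /\ be l != 0.
  have [[l H]|nex] := pselect (exists l, (l < m)%N /\ be l != 0).
    by exists 0 => t _; right; exists l.
  have [b0|b0] := eqVneq (be m) 0.
    exists 0 => t _; left; rewrite b0 mul0r addr0; case: nz => // -[l [lm bl]].
    move: lm; rewrite ltnS leq_eqVlt => /orP[/eqP lm|lm]; first by rewrite lm b0 eqxx in bl.
    by case: nex; exists l.
  exists (- al / be m) => t; left; apply: contra_neq H => ab.
  by rewrite (_ : al = - (be m * t)) ?opprK; [field|apply/eqP; rewrite -addr_eq0 ab].
(* The slices are dominated by the indicator of the degenerate interval from [t0] to [t0], so that
   [le_Rint_itv] bounds the integral by [t0 - t0]. *)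
have b t : `|iint m (fun s => \1_(zaff m.+1 al be) (upd m t s) : R)| <=
    1 * \1_(`[t0, t0]%classic) t.
  have gt := good_upd _ _ _ t (good_zaff m.+1 al be).
  rewrite indicE; have [->|tt0] := eqVneq t t0.
    rewrite mem_set /= ?in_itv /= ?lexx // mulr1; exact: iint_le (good_upd _ _ _ t0 (good_zaff m.+1 al be)).
  rewrite memNset /= ?mulr0; last first.
    by rewrite in_itv /= => /andP[t1 t2]; move: tt0; rewrite eq_le t1 t2.
  rewrite normr_le0; apply/eqP/le_anti; rewrite iint_ge0 ?andbT; last by move=> s; rewrite indicE.
  rewrite -(IH _ (Ht0 t tt0)).
  apply: (le_iint _ _ _ _ _ gt (good_zaff m _ _)) => s.
  rewrite !indicE; have [H|_] := boolP (_ \in _); last by case: (_ \in _).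
  rewrite mem_set //; move: H; rewrite inE /zaff /= /aff big_ord_recr /= (_ : upd m t s m = t); last by rewrite /upd eqxx.
  move=> [bs a0]; split.
    by move=> l lm; have := bs l (ltnW lm); rewrite /upd ltn_eqF.
  have E : \sum_(l < m) be l * upd m t s l = \sum_(l < m) be l * s l.
    by apply: eq_bigr => l _; rewrite /upd ltn_eqF.
  by move: a0; rewrite E; lra.
apply/eqP; rewrite -normr_le0.
rewrite -[leRHS](mulr0 1) -(subrr t0).
apply: le_Rint_itv => //; case: (iint_slice _ _ _ (good_zaff m.+1 al be)) => //.
Qed.

Lemma ae_aff m al be : (al != 0 \/ exists l, (l < m)%N /\ be l != 0) ->
  ae m (fun s => aff m al be s != 0).
Proof.
move=> nz; exists 1, (\1_(zaff m al be)); split.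
- exact: good_zaff.
- by move=> s; rewrite indicE.
- exact: iint_zaff.
- move=> s bs /negP; rewrite negbK => /eqP a0; rewrite indicE mem_set //.
Qed.

End AlmostEverywhere.

(** * Measurability on row vectors *)

Section RowMeasurable.
Context {R : realType} {d : nat}.

(** The same device as [jmeas]: measurability is tested along all coordinatewise measurable
    families, which replaces a sigma-algebra on row vectors. *)
Definition msrow (A : set 'rV[R]_d) :=
  forall d' (S : measurableType d') (p : S -> 'rV[R]_d),
    (forall l, measurable_fun setT (fun z => p z 0 l)) -> measurable (p @^-1` A).

Definition mrow (F : 'rV[R]_d -> R) :=
  forall d' (S : measurableType d') (p : S -> 'rV[R]_d),
    (forall l, measurable_fun setT (fun z => p z 0 l)) ->
    measurable_fun setT (F \o p).

Lemma msrowC A : msrow A -> msrow (~` A).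
Proof. by move=> mA d' S p mp; rewrite preimage_setC; apply: measurableC; exact: mA. Qed.

Lemma msrowI A B : msrow A -> msrow B -> msrow (A `&` B).
Proof.
by move=> mA mB d' S p mp; rewrite preimage_setI; apply: measurableI; [exact: mA|exact: mB].
Qed.

Lemma msrowU A B : msrow A -> msrow B -> msrow (A `|` B).
Proof.
by move=> mA mB d' S p mp; rewrite preimage_setU; apply: measurableU; [exact: mA|exact: mB].
Qed.

Lemma msrow_all (I : finType) (F : I -> set 'rV[R]_d) :
  (forall i, msrow (F i)) -> msrow [set w | forall i, F i w].
Proof.
move=> mF d' S p mp.
rewrite (_ : _ @^-1` _ = \bigcap_(i in [set: I]) (p @^-1` F i)).
  by apply: fin_bigcap_measurable => [|i _]; [exact: finite_finset|exact: mF].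
by apply/seteqP; split => z /= H i; [move=> _|]; apply: H.
Qed.

Lemma msrow_cst (P : Prop) : msrow [set w | P].
Proof.
move=> d' S p mp; have [HP|nP] := pselect P.
  by rewrite (_ : _ @^-1` _ = setT) //; apply/seteqP; split.
by rewrite (_ : _ @^-1` _ = set0) //; apply/seteqP; split.
Qed.

(** An open set is the union of the countably many boxes with rational centre and radius [1/(k+1)]
    that it contains, and the preimage of a box is a finite intersection of conditions on
    coordinates. *)
Lemma msrow_open A : open A -> msrow A.
Proof.
move=> oA d' S p mp.
pose B (qk : 'rV[rat]_d * nat) : set 'rV[R]_d :=
  [set w | forall l, `|w 0 l - ratr (qk.1 0 l)| < qk.2.+1%:R^-1].
pose F qk := if `[< B qk `<=` A >] then p @^-1` (B qk) else set0.
have -> : p @^-1` A = \bigcup_qk F qk.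
  apply/seteqP; split => z; last first.
    by move=> [qk _]; rewrite /F; case: asboolP => // H /H.
  move=> /= Az.
  have /nbhs_ballP[e e0 He] : nbhs (p z) A by apply: open_nbhs_nbhs.
  (* Half the radius suffices: a point of the box and [p z] are both within [e / 2] of its
     centre. *)
  have e2 : 0 < e / 2 by rewrite divr_gt0.
  have [N _ /(_ N (leqnn N)) HN] := near_infty_natSinv_lt (PosNum e2).
  have /choice[q Hq] : forall l : 'I_d, exists r : rat, `|p z 0 l - ratr r| < N.+1%:R^-1.
    move=> l; have N0 : 0 < N.+1%:R^-1 :> R by rewrite invr_gt0.
    have /rat_in_itvoo[r] : p z 0 l - N.+1%:R^-1 < p z 0 l + N.+1%:R^-1 
      by rewrite ltrBlDr -addrA ltrDl addr_gt0.
    by rewrite in_itv /= => H; exists r; rewrite distrC ltr_distl.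
  have qz : B (\row_l q l, N) (p z) by move=> l; rewrite /= mxE.
  exists (\row_l q l, N) => //; rewrite /F asboolT // => w Bw; apply: He.
  split => // i l; rewrite ord1 /ball /=.
  have := qz l; have := Bw l; rewrite /= mxE; move: HN => /=.
  move: (N.+1%:R^-1) => e1.
  rewrite !ltr_norml; lra.
apply: countable_bigcupT_measurable => [|qk]; first exact: countableP.
rewrite /F; case: asboolP => // _.
have -> : p @^-1` B qk = \bigcap_(l in [set: 'I_d])
   ((fun z => p z 0 l) @^-1` (ball (ratr (qk.1 0 l) : R) (qk.2.+1%:R^-1))).
  apply/seteqP; split => z /= H l; first by move=> _; rewrite /ball /= distrC; exact: H.
  by have := H l I; rewrite /ball /= distrC.
apply: fin_bigcap_measurable => [|l _]; first exact: finite_finset.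
by rewrite -[X in measurable X]setTI; apply: mp => //; exact: measurable_ball.
Qed.

Lemma msrow_closed A : closed A -> msrow A.
Proof. by move=> cA; rewrite -(setCK A); apply: msrowC; apply: msrow_open; exact: closed_openC. Qed.

Lemma mrow_continuous F : continuous F -> mrow F.
Proof.
move=> cF d' S p mp; apply: (measurability _ (RGenOInfty.measurableE R)) => //.
move=> _ [_ [a ->] <-]; rewrite setTI comp_preimage.
by apply: (msrow_open (F @^-1` `]a, +oo[)) => //; apply: open_comp => // w _; exact: cF.
Qed.

Lemma mrow_indic A : msrow A -> mrow (\1_A : _ -> R).
Proof.
move=> mA d' S p mp.
rewrite (_ : _ \o _ = (\1_(p @^-1` A) : _ -> R)); last by apply/funext => z; rewrite /= !indicE.
by apply: measurable_indic; exact: mA.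
Qed.

Lemma mrowM F G : mrow F -> mrow G -> mrow (fun w => F w * G w).
Proof. by move=> mF mG d' S p mp; apply: measurable_funM; [exact: mF|exact: mG]. Qed.

Definition goodrow (M : R) (F : 'rV[R]_d -> R) :=
  [/\ mrow F, forall w, `|F w| <= M & forall w, ~ cube d w -> F w = 0].

Lemma good_goodrow M F : goodrow M F -> good d M (fun s => F (\row_(l < d) s l)).
Proof.
move=> [mF bF zF]; split.
- move=> d' S s ms; apply: (mF _ _ (fun z => \row_(l < d) s z l)) => l.
  by rewrite (_ : (fun z => _) = s ^~ l) //; apply/funext => z; rewrite mxE.
- by [].
- move=> s nb; apply: zF => c; apply: nb => l lm; by have := c (Ordinal lm); rewrite mxE.
Qed.

End RowMeasurable.

(** * Points on a mediator *)

Section Geometry.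
Context {R : realType} {m n e : nat} (idx : 'I_n -> 'rV[int]_e).
Implicit Types (x y : 'M[R]_(n, m.+1)) (w : 'rV[R]_m.+1) (s : nat -> R).

(** Squared distances keep all comparisons polynomial and make differences of two of them affine in
    [w]. *)
Definition sqd y (i : 'I_n) w : R := \sum_l (y i l - w 0 l) ^+ 2.

Lemma sqd_ge0 y i w : 0 <= sqd y i w.
Proof. by apply: sumr_ge0 => l _; exact: sqr_ge0. Qed.

Lemma edot_sqd y i w : edot (row i y - w) (row i y - w) = sqd y i w.
Proof. by apply: eq_bigr => l _; rewrite !mxE -expr2. Qed.

Lemma enorm_sqd y i w : enorm (row i y - w) ^+ 2 = sqd y i w.
Proof. by rewrite /enorm edot_sqd sqr_sqrtr // sqd_ge0. Qed.

Lemma enorm_lt y i k w :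
  (enorm (row i y - w) < enorm (row k y - w)) = (sqd y i w < sqd y k w).
Proof. by rewrite -!enorm_sqd ltr_pXn2r // nnegrE sqrtr_ge0. Qed.

Lemma enorm_eq y i k w :
  enorm (row i y - w) = enorm (row k y - w) -> sqd y i w = sqd y k w.
Proof. by rewrite -!enorm_sqd => ->. Qed.

Lemma vcell_cube y i w : vcell idx y i w -> cube m.+1 w.
Proof. by case. Qed.

Lemma vcell_le y i w k : vcell idx y i w -> sqd y i w <= sqd y k w.
Proof.
move=> [_ H]; have [->//|ki] := eqVneq k i.
by case: (H k ki) => [|[/enorm_eq -> _]//]; rewrite enorm_lt => /ltW.
Qed.

Lemma vcell_lt y i w : cube m.+1 w -> (forall k, k != i -> sqd y i w < sqd y k w) ->
  vcell idx y i w.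
Proof. by move=> cw H; split => // k ki; left; rewrite enorm_lt H. Qed.

Definition rw s : 'rV[R]_m.+1 := \row_(l < m.+1) s l.

Lemma rw_upd_lt t s (l : 'I_m) : rw (upd m t s) 0 (widen_ord (leqnSn m) l) = s l.
Proof. by rewrite mxE /upd /= ltn_eqF. Qed.

Lemma rw_upd_max t s : rw (upd m t s) 0 ord_max = t.
Proof. by rewrite mxE /upd /= eqxx. Qed.

Definition lastd y k i : R := y k ord_max - y i ord_max.

(** This is the inner product of the midpoint of [y_k] and [y_i] with [y_k - y_i], the constant in
    the equation of the mediator. *)
Definition csq y k i : R := \sum_l (y k l ^+ 2 - y i l ^+ 2) / 2.

(* The last coordinate of the point of the mediator of [y_k] and [y_i] lying over
   the first [m] coordinates [s]. *)
Definition tau y k i s : R :=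
  (csq y k i - \sum_(l < m) s l * (y k (widen_ord (leqnSn m) l) - y i (widen_ord (leqnSn m) l)))
  / lastd y k i.

(** The squares of the coordinates of [w] cancel. The sign of [lastd] thus decides on which side of
    [tau] each generator is the closer one. *)
Lemma sqd_diff y k i s t : lastd y k i != 0 ->
  sqd y k (rw (upd m t s)) - sqd y i (rw (upd m t s)) = 2 * lastd y k i * (tau y k i s - t).
Proof.
move=> a0; have -> : 2 * lastd y k i * (tau y k i s - t) =
   2 * (csq y k i - \sum_(l < m) s l * (y k (widen_ord (leqnSn m) l) - y i (widen_ord (leqnSn m) l))
     - lastd y k i * t) by rewrite /tau; field.
rewrite /sqd /csq -sumrB !big_ord_recr /= !rw_upd_max.
under eq_bigr do rewrite rw_upd_lt.
set S1 := \sum_(_ < _) _; set S2 := \sum_(_ < _) _; set S3 := \sum_(_ < _) _.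
suff -> : S1 = 2 * (S2 - S3) by rewrite /lastd; field.
by rewrite /S1 /S2 /S3 -sumrB mulr_sumr; apply: eq_bigr => l _; field.
Qed.

Lemma coord_lt (u : 'rV[R]_m.+1) (l : 'I_m) : Defs.coord u l = u 0 (widen_ord (leqnSn m) l).
Proof.
rewrite /Defs.coord; case: insubP => /= [j _ jl|]; last by rewrite ltnW // ltnS.
by congr (u _ _); apply: val_inj.
Qed.

Lemma coord_max (u : 'rV[R]_m.+1) : Defs.coord u m = u 0 ord_max.
Proof.
rewrite /Defs.coord; case: insubP => /= [j _ jl|]; last by rewrite ltnSn.
by congr (u _ _); apply: val_inj.
Qed.

Lemma med_intE y k i G : med_int (row k y) (row i y) G =
  iint m (fun s => G (rw (upd m (tau y k i s) s)) *
    (enorm (row k y - row i y) / `|lastd y k i|)).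
Proof.
rewrite /med_int /= coord_max !mxE -/(lastd y k i); congr iint; apply/funext => s.
congr (G _ * _); apply/rowP => l; rewrite !mxE /upd.
have [lm|] := ltnP l m; first by rewrite ltn_eqF.
move=> ml; have -> : l = m :> nat by apply/eqP; rewrite eqn_leq ml -ltnS ltn_ord.
rewrite eqxx /tau; congr ((_ - _) / _).
  by apply: eq_bigr => j _; rewrite !mxE; field.
by apply: eq_bigr => j _; rewrite coord_lt !mxE.
Qed.

Section Limits.
Context {T : Type} {F : set_system T} {FF : Filter F}.

Lemma cvg_coord p q (u : T -> 'M[R]_(p, q)) (x : 'M[R]_(p, q)) i l :
  u @ F --> x -> u t i l @[t --> F] --> x i l.
Proof. move=> cu; apply: (@continuous_cvg _ _ _ F FF u (fun M => M i l) x) => //.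
exact: coord_continuous. Qed.

Lemma cvg_sumr (I : Type) (r : seq I) (P : pred I) (f : I -> T -> R) (a : I -> R) :
  (forall i, P i -> f i @ F --> a i) ->
  (\sum_(i <- r | P i) f i t) @[t --> F] --> \sum_(i <- r | P i) a i.
Proof.
move=> H; elim: r => [|i r IH].
  rewrite big_nil; under eq_fun do rewrite big_nil; exact: cvg_cst.
rewrite big_cons; under eq_fun do rewrite big_cons.
by case: ifPn => // Pi; apply: cvgD => //; exact: H.
Qed.

Lemma cvg_sqd (u : T -> 'M[R]_(n, m.+1)) (v : T -> 'rV[R]_m.+1) x w i :
  u @ F --> x -> v @ F --> w -> sqd (u t) i (v t) @[t --> F] --> sqd x i w.
Proof.
move=> cu cv; apply: cvg_sumr => l _; rewrite expr2; under eq_fun do rewrite expr2.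
by apply: cvgM; apply: cvgB; exact: cvg_coord.
Qed.

Lemma cvg_tau (u : T -> 'M[R]_(n, m.+1)) x k i s : lastd x k i != 0 ->
  u @ F --> x -> tau (u t) k i s @[t --> F] --> tau x k i s.
Proof.
move=> a0 cu; apply: cvgM.
  apply: cvgB; apply: cvg_sumr => l _.
    by apply: cvgMl; apply: cvgB; rewrite !expr2; apply: cvgM; exact: cvg_coord.
  by apply: cvgMr; apply: cvgB; exact: cvg_coord.
by apply: cvgV => //; apply: cvgB; exact: cvg_coord.
Qed.

Lemma cvg_rw (u : T -> R) s a :
  u @ F --> a -> rw (upd m (u t) s) @[t --> F] --> rw (upd m a s).
Proof.
move=> cu; apply/cvgrPdist_lt => eps eps0.
move/cvgrPdist_lt : cu => /(_ eps eps0); apply: filterS => t ht.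
rewrite [X in X < _](_ : _ = mx_norm (rw (upd m a s) - rw (upd m (u t) s))) //.
rewrite mx_normrE; apply/bigmax_ltP; split => // -[i l] _ /=; rewrite !mxE /upd.
by case: eqP => // _; rewrite subrr normr0.
Qed.

End Limits.

(** Only third generators are compared here, since on the mediator [i] and [k] tie. Like [outside],
    the condition consists of finitely many strict inequalities, so it persists when [y] and [w]
    move slightly. *)
Definition inside y i k w :=
  (forall l, 0 < w 0 l < 1) /\
  forall j, j != i -> j != k -> sqd y i w < sqd y j w /\ sqd y k w < sqd y j w.

Definition outside y i w :=
  (exists l, w 0 l < 0 \/ 1 < w 0 l) \/ exists j, sqd y j w < sqd y i w.

Lemma near_inside {T : Type} {F : set_system T} {FF : Filter F}
  (u : T -> 'M[R]_(n, m.+1)) (v : T -> 'rV[R]_m.+1) x w i k :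
  u @ F --> x -> v @ F --> w -> inside x i k w -> \forall t \near F, inside (u t) i k (v t).
Proof.
move=> cu cv [w01 H].
have A : \forall t \near F, forall l, 0 < v t 0 l < 1.
  apply: filter_forall => l; have /andP[w0 w1] := w01 l.
  have cl : v t 0 l @[t --> F] --> w 0 l by exact: cvg_coord.
  near=> t; apply/andP; split; near: t; [exact: cvgr_gt cl _ w0|exact: cvgr_lt cl _ w1].
have B : \forall t \near F, forall j, j != i -> j != k ->
    sqd (u t) i (v t) < sqd (u t) j (v t) /\ sqd (u t) k (v t) < sqd (u t) j (v t).
  apply: filter_forall => j.
  have [ji|ji] := eqVneq j i; first by near=> t.
  have [jk|jk] := eqVneq j k; first by near=> t.
  have [h1 h2] := H j ji jk.
  near=> t => _ _; split; rewrite -subr_gt0; near: t.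
    apply: cvgr_gt (_ : 0 < sqd x j w - sqd x i w); last by rewrite subr_gt0.
    by apply: cvgB; exact: cvg_sqd.
  apply: cvgr_gt (_ : 0 < sqd x j w - sqd x k w); last by rewrite subr_gt0.
  by apply: cvgB; exact: cvg_sqd.
by apply: filterS2 A B => t At Bt; split.
Unshelve. all: by end_near. Qed.

Lemma near_outside {T : Type} {F : set_system T} {FF : Filter F}
  (u : T -> 'M[R]_(n, m.+1)) (v : T -> 'rV[R]_m.+1) x w i :
  u @ F --> x -> v @ F --> w -> outside x i w -> \forall t \near F, outside (u t) i (v t).
Proof.
move=> cu cv [[l [w0|w1]]|[j wj]].
- near=> t; left; exists l; left; near: t.
  by apply: cvgr_lt w0; exact: cvg_coord.
- near=> t; left; exists l; right; near: t.
  by apply: cvgr_gt w1; exact: cvg_coord.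
- near=> t; right; exists j; rewrite -subr_gt0; near: t.
  apply: cvgr_gt (_ : 0 < sqd x i w - sqd x j w); last by rewrite subr_gt0.
  by apply: cvgB; exact: cvg_sqd.
Unshelve. all: by end_near. Qed.

Lemma outside_vcell y i w : outside y i w -> ~ vcell idx y i w.
Proof.
move=> [[l wl]|[j wj]] vw.
  by have /andP[w0 w1] := vcell_cube _ _ _ vw l; case: wl; rewrite ltNge ?w0 ?w1.
by move: wj; rewrite ltNge (vcell_le _ _ _ j vw).
Qed.

Lemma outside_closure y i w : outside y i w -> ~ closure (vcell idx y i) w.
Proof.
move=> ow cl.
have : \forall v \near w, outside y i v.
  by apply: (@near_outside _ (nbhs w) _ (fun=> y) id y w i _ _ ow); [exact: cvg_cst|exact: cvg_id].
by move=> /cl [v [vv /outside_vcell]].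
Qed.

Lemma inside_vcell y i k w : inside y i k w -> sqd y i w < sqd y k w -> vcell idx y i w.
Proof.
move=> [w01 H] ik; apply: vcell_lt => [l|j ji].
  by have /andP[/ltW -> /ltW ->] := w01 l.
by have [->//|jk] := eqVneq j k; case: (H j ji jk).
Qed.

Lemma insideC y i k w : inside y i k w -> inside y k i w.
Proof. by move=> [w01 H]; split => // j jk ji; case: (H j ji jk). Qed.

Lemma lastdC y i k : lastd y i k = - lastd y k i.
Proof. by rewrite /lastd opprB. Qed.

Lemma tauC y i k s : tau y i k s = tau y k i s.
Proof.
have c : csq y i k = - csq y k i.
  by rewrite /csq -sumrN; apply: eq_bigr => l _; field.
rewrite /tau c lastdC invrN mulrN -mulNr; congr (_ / _).
rewrite opprD !opprK; congr (_ + _); rewrite -sumrN.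
by apply: eq_bigr => l _; ring.
Qed.

Lemma inside_closure y i k s : lastd y k i != 0 ->
  inside y i k (rw (upd m (tau y k i s) s)) ->
  closure (vcell idx y i) (rw (upd m (tau y k i s) s)).
Proof.
set a := lastd y k i; set t0 := tau y k i s => a0 Hin B nB.
have c : rw (upd m t s) @[t --> t0] --> rw (upd m t0 s) by apply: cvg_rw; exact: cvg_id.
have n1 : \forall t \near t0, inside y i k (rw (upd m t s)).
  by apply: (@near_inside _ (nbhs t0) _ (fun=> y) (fun t => rw (upd m t s)) y _ i k _ c Hin); exact: cvg_cst.
have /nbhs_ballP[dl dl0 Hd] : nbhs t0 [set t | inside y i k (rw (upd m t s)) /\ B (rw (upd m t s))].
  exact: filterI n1 (c _ nB).
have [t [tb tg]] : exists t, ball t0 dl t /\ 0 < a * (t0 - t).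
  (* The mediator point is pushed towards the side of [i]: with the sign of [a] in the shift,
     [a * (t0 - t)] is half of [dl] times the absolute value of [a], whichever way the mediator
     leans. *)
  exists (t0 - Num.sg a * (dl / 2)); rewrite /ball /= opprB addrCA subrr addr0.
  have dlp : 0 < dl by exact: dl0.
  have d2 : `|dl / 2| < dl by rewrite ger0_norm; lra.
  rewrite normrM normr_sg a0 mul1r d2; split => //.
  by rewrite mulrA [a * _]mulrC -normrEsg mulr_gt0 // ?normr_gt0 // divr_gt0.
have [H1 H2] := Hd t tb; exists (rw (upd m t s)); split => //.
apply: inside_vcell H1 _; rewrite -subr_gt0 sqd_diff // -mulrA mulr_gt0 //.
Qed.

End Geometry.

(** * Generic position and one-dimensional slices *)

Section Generic.
Context {R : realType} {m n : nat}.
Implicit Types (x y : 'M[R]_(n, m.+1)) (w : 'rV[R]_m.+1) (s : nat -> R).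

Lemma DI_lastd x k i : DI m.+1 n x -> k != i -> lastd x k i != 0.
Proof. by move=> [_ H] ki; rewrite subr_eq0 H. Qed.

Lemma widen_inord (l : 'I_m) : widen_ord (leqnSn m) l = inord l.
Proof. by apply: val_inj; rewrite /= inordK // ltnW // ltnS. Qed.

Lemma tau_aff x k i s : tau x k i s =
  aff m (csq x k i / lastd x k i)
    (fun l => - (x k (inord l) - x i (inord l)) / lastd x k i) s.
Proof.
rewrite /tau /aff mulrBl; congr (_ + _); rewrite -mulNr -sumrN mulr_suml.
by apply: eq_bigr => l _; rewrite widen_inord; ring.
Qed.

Lemma ae_coord_ne (l0 : 'I_m) (c : R) : ae m (fun s : nat -> R => s l0 != c).
Proof.
have : ae m (fun s => aff m (- c) (fun l => (l == l0)%:R) s != 0).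
  by apply: ae_aff; right; exists l0; rewrite eqxx oner_neq0.
apply: ae_mono => s _; rewrite /aff (bigD1 l0) //= eqxx mul1r big1 ?addr0.
  by apply: contra => /eqP ->; rewrite addNr.
move=> l ll0; suff -> : (l == l0 :> nat) = false by rewrite mul0r.
exact: negbTE.
Qed.

Lemma ae_tau_ne x k i c : DI m.+1 n x -> k != i -> (c = 0 \/ c = 1) ->
  ae m (fun s => tau x k i s != c).
Proof.
move=> Dx ki c01; have a0 := DI_lastd _ _ _ Dx ki.
have : ae m (fun s => aff m (csq x k i / lastd x k i - c)
    (fun l => - (x k (inord l) - x i (inord l)) / lastd x k i) s != 0).
  (* In dimension one there is no coordinate [s] left and the constant itself must be nonzero: the
     mediator is the midpoint of two distinct points of the unit interval, hence neither 0 nor 1.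
     Otherwise the coefficient of the first coordinate is nonzero. *)
  apply: ae_aff; have [m0|m0] := posnP m.
    left; have [Hc Hd] := Dx.
    have := Hc k ord_max; have := Hc i ord_max; rewrite !mxE => h1 h2.
    have -> : csq x k i / lastd x k i = (x k ord_max + x i ord_max) / 2.
      rewrite /csq big_ord_recr /= big1 ?add0r; first by move: a0; rewrite /lastd => a0; field.
      by move=> l; move: (ltn_ord l); rewrite {2}m0.
    have := Hd k i ki ord_max => /eqP hne; apply/eqP => h.
    by apply: hne; case: c01 => c0; rewrite c0 in h; lra.
  right; exists 0; split => //; rewrite mulf_neq0 // ?invr_eq0 // oppr_eq0 subr_eq0.
  by case: Dx => _; exact.
apply: ae_mono => s _; apply: contra => /eqP <-; rewrite tau_aff /aff.
by apply/eqP; ring.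
Qed.

(** Were the two affine functions identical, the mediators of [i] with [j] and with [k] would
    coincide. Equal linear parts make [x_j - x_i] a multiple [la] of [x_k - x_i], and equal
    constants force [la = 1], that is [x_j = x_k]. *)
Lemma ae_tau_pair x i j k : DI m.+1 n x -> k != i -> j != i -> j != k ->
  ae m (fun s => tau x j i s != tau x k i s).
Proof.
move=> Dx ki ji jk.
set p := fun l => x k l - x i l; set q := fun l => x j l - x i l.
have p0 : p ord_max != 0 by exact: DI_lastd.
have q0 : q ord_max != 0 by exact: DI_lastd.
set al := csq x j i / q ord_max - csq x k i / p ord_max.
set be := fun l : nat => - (q (inord l) / q ord_max - p (inord l) / p ord_max).
have : ae m (fun s => aff m al be s != 0).
  apply: ae_aff; have [al0|] := eqVneq al 0; [right|by left].
  apply: contrapT => nex.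
  have be0 (l : 'I_m) : q (inord l) / q ord_max = p (inord l) / p ord_max.
    have [|b] := eqVneq (be l) 0; last by case: nex; exists l.
    by rewrite /be => /eqP; rewrite oppr_eq0 subr_eq0 => /eqP.
  set la := q ord_max / p ord_max.
  have qp l : q l = la * p l.
    have [lm|] := ltnP l m.
      have := be0 (Ordinal lm); rewrite (_ : inord _ = l); last by apply: val_inj; rewrite /= inordK // ltnW.
      move=> h; rewrite -[LHS](divfK q0) h /la; field; exact: p0.
    move=> ml; have -> : l = ord_max by apply: val_inj; apply/eqP; rewrite eqn_leq ml -ltnS ltn_ord.
    by rewrite /la divfK.
  have la0 : la != 0 by rewrite mulf_neq0 // invr_eq0.
  pose xp := \sum_l x i l * p l; pose pp := \sum_l p l ^+ 2.
  have cp : csq x k i = xp + pp / 2.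
    rewrite /csq /xp /pp mulr_suml -big_split; apply: eq_bigr => l _ /=.
    by rewrite /p; field.
  have cq : csq x j i = la * xp + la ^+ 2 * pp / 2.
    rewrite /csq /xp /pp mulr_sumr -mulrA mulr_suml mulr_sumr -big_split; apply: eq_bigr => l _ /=.
    have -> : x j l = x i l + la * p l by rewrite -qp /q; ring.
    by field.
  have pp0 : 0 < pp.
    rewrite lt_def sumr_ge0 ?andbT; last by move=> l _; exact: sqr_ge0.
    rewrite psumr_eq0; last by move=> l _; exact: sqr_ge0.
    apply/negP => /allP /(_ ord_max); rewrite mem_index_enum => /(_ isT) /=.
    by rewrite sqrf_eq0 (negbTE p0).
  (* Here [pp] is the squared distance of [x_k] and [x_i]. The constants are those of two parallel
     hyperplanes at the midpoints, and their difference is proportional to [la * pp - pp]. *)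
  have : la * pp = pp.
    move: al0; rewrite /al cp cq (qp ord_max) => al0.
    have : la * p ord_max * ((la * xp + la ^+ 2 * pp / 2) / (la * p ord_max) - (xp + pp / 2) / p ord_max) = 0 by rewrite al0 mulr0.
    rewrite (_ : _ * _ = la * ((la * pp - pp) / 2)); last by field; exact/andP.
    by move/eqP; rewrite mulf_eq0 (negbTE la0) /= mulf_eq0 invr_eq0 pnatr_eq0 orbF subr_eq0 => /eqP.
  move=> lapp; have la1 : la = 1 by apply: (mulIf (lt0r_neq0 pp0)); rewrite lapp mul1r.
  have := qp ord_max; rewrite la1 mul1r /q /p => /addIr h.
  by case: Dx => _ /(_ j k jk ord_max); rewrite h eqxx.
apply: ae_mono => s _; apply: contra => /eqP tt.
apply/eqP; rewrite (_ : aff _ _ _ _ = tau x j i s - tau x k i s); first by rewrite tt subrr.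
rewrite !tau_aff /aff /al opprD [RHS]addrACA -sumrB; congr (_ + _).
by apply: eq_bigr => l _; rewrite /be /q /p /lastd; ring.
Qed.

Lemma sqd_tau x k i s : lastd x k i != 0 ->
  sqd x k (rw (upd m (tau x k i s) s)) = sqd x i (rw (upd m (tau x k i s) s)).
Proof. by move=> a0; apply/eqP; rewrite -subr_eq0 sqd_diff // subrr mulr0. Qed.

Definition dichotomy x i k w :=
  inside x i k w \/ (outside x i w /\ outside x k w).

(* Off the zero sets of finitely many affine functions of [s], no coordinate of the
   mediator point is 0 or 1 and no third generator is equidistant from it. *)
Lemma ae_dichotomy x i k : DI m.+1 n x -> k != i ->
  ae m (fun s => dichotomy x i k (rw (upd m (tau x k i s) s))).
Proof.
move=> Dx ki; have a0 := DI_lastd _ _ _ Dx ki.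
have A1 : ae m (fun s => forall l : 'I_m, s l != 0 /\ s l != 1).
  by apply: ae_forall => l; apply: ae_and; exact: ae_coord_ne.
have A2 : ae m (fun s => tau x k i s != 0 /\ tau x k i s != 1).
  by apply: ae_and; apply: ae_tau_ne => //; [left|right].
have A3 : ae m (fun s => forall j, (j != i /\ j != k) -> tau x j i s != tau x k i s).
  by apply: ae_forall => j; apply: ae_imp => -[ji jk]; exact: ae_tau_pair.
apply: ae_mono (ae_and _ _ _ A1 (ae_and _ _ _ A2 A3)) => s _ [s01 [[t0 t1] tj]].
set w := rw _.
have eki : sqd x k w = sqd x i w by exact: sqd_tau.
have w01 l : w 0 l != 0 /\ w 0 l != 1.
  rewrite /w mxE /upd; case: ifPn => [//|lm].
  have lm' : (l < m)%N by rewrite ltn_neqAle lm -ltnS ltn_ord.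
  exact: (s01 (Ordinal lm')).
have [[l wl]|nw] := pselect (exists l, w 0 l < 0 \/ 1 < w 0 l).
  by right; split; left; exists l.
have [[j wj]|nj] := pselect (exists j, sqd x j w < sqd x i w).
  by right; split; right; exists j; rewrite ?eki.
left; split => [l|j ji jk].
  have [h0 h1] := w01 l; rewrite !lt_def h0 [1 == _]eq_sym h1 /=.
  rewrite !leNgt; apply/andP; split; apply/negP => h; apply: nw; exists l; by [left|right].
have le1 : sqd x i w <= sqd x j w by rewrite leNgt; apply/negP => h; apply: nj; exists j.
have ne : sqd x j w != sqd x i w.
  rewrite -subr_eq0 sqd_diff; last exact: DI_lastd.
  rewrite mulf_neq0 ?mulf_neq0 ?pnatr_eq0 //; first exact: DI_lastd.
  by rewrite subr_eq0 tj.
by rewrite eki lt_def ne le1.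
Qed.

End Generic.

(** * Integrals over short intervals and difference quotients *)

Section Slices.
Context {R : realType}.
Local Notation mu := (@lebesgue_measure R).
Local Notation "'Rint' phi" := (Rintegral mu setT phi) (at level 10, phi at level 8).

(** Nothing but the bound [M] is assumed at [p] and [q]: there two generators tie, and the value
    depends on the tie-breaking rule. *)
Lemma Rint_between_le (K : R -> R) (p q M g0 ep : R) : p <= q ->
  measurable_fun setT K -> (forall t, `|K t| <= M) ->
  (forall t, ~~ (p <= t <= q) -> K t = 0) ->
  (forall t, p < t < q -> `|K t - g0| <= ep) -> 0 <= ep ->
  `|Rint K - (q - p) * g0| <= ep * (q - p).
Proof.
move=> pq mK bK zK eK ep0.
have M0 : 0 <= M by apply: le_trans (bK 0).
have IK : mu.-integrable setT (EFin \o K).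
  apply: (@le_integrable_itv _ M p q) => // t; rewrite indicE.
  have [h|h] := boolP (p <= t <= q); first by rewrite mem_set ?mulr1 //= in_itv.
  by rewrite zK // normr0 mulr_ge0.
have I1 : mu.-integrable setT (EFin \o (fun t => g0 * \1_(`[p, q]%classic) t)).
  exact: integrable_itv01.
have ID : mu.-integrable setT (EFin \o (fun t => K t - g0 * \1_(`[p, q]%classic) t)).
  by have := integrableB measurableT IK I1.
have -> : Rint K - (q - p) * g0 = Rint (fun t => K t - g0 * \1_(`[p, q]%classic) t).
  by rewrite RintegralB // Rint_itv // mulrC.
apply: (le_trans (le_normr_Rintegral measurableT ID)).
(* The majorant has two spikes of height [M + |g0|] at the endpoints, which do not change its
   integral. *)
pose U t := ep * \1_(`[p, q]%classic) t + ((M + `|g0|) * \1_(`[p, p]%classic) t + (M + `|g0|) * \1_(`[q, q]%classic) t).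
have I2 := @integrable_itv01 R ep p q.
have I3 := @integrable_itv01 R (M + `|g0|) p p.
have I4 := @integrable_itv01 R (M + `|g0|) q q.
have I34 : mu.-integrable setT (EFin \o (fun t => (M + `|g0|) * \1_(`[p, p]%classic) t + (M + `|g0|) * \1_(`[q, q]%classic) t)).
  by have := integrableD measurableT I3 I4.
have IU : mu.-integrable setT (EFin \o U) by have := integrableD measurableT I2 I34.
have -> : ep * (q - p) = Rint U.
  by rewrite /U RintegralD // RintegralD // !Rint_itv // !subrr !mulr0 !addr0.
apply: le_Rintegral => //; first exact: (integrable_norm ID).
move=> t _; rewrite /U !indicE.
have ind (a b : R) : (t \in `[a, b]%classic) = (a <= t <= b).
  by apply/idP/idP; rewrite inE /= in_itv.
rewrite !ind.
have g00 := normr_ge0 g0.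
have [h|h] := boolP (p <= t <= q); last first.
  by rewrite zK // !mulr0 subrr normr0 add0r addr_ge0 // mulr_ge0 // addr_ge0.
have b2 : `|K t - g0| <= M + `|g0| by rewrite (le_trans (ler_normB _ _)) // lerD2r.
rewrite !mulr1; have [tp|tp] := eqVneq t p.
  rewrite tp !lexx !mulr1 -tp (le_trans b2) // addrCA lerDl addr_ge0 // mulr_ge0 // addr_ge0 //.
have [tq|tq] := eqVneq t q.
  rewrite tq !lexx !mulr1 -tq (le_trans b2) // addrA lerDr addr_ge0 // mulr_ge0 // addr_ge0 //.
apply: (@le_trans _ _ ep); last by rewrite lerDl addr_ge0 // mulr_ge0 // addr_ge0.
by apply: eK; move: h => /andP[h1 h2]; rewrite !lt_neqAle h1 h2 eq_sym tp tq.
Qed.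

(** The mediator may move either way. The sign in [K] makes the integral close to the signed length
    [q - p] times [g0] in both cases. *)
Lemma Rint_between (K G : R -> R) (p q M g0 ep : R) :
  measurable_fun setT K -> (forall t, `|K t| <= M) ->
  (forall t, t != p -> t != q ->
     K t = ((p < t < q)%R%:R - (q < t < p)%R%:R) * G t) ->
  (forall t, (p < t < q) || (q < t < p) -> `|G t - g0| <= ep) -> 0 <= ep ->
  (forall t, ~~ (p <= t <= q) -> ~~ (q <= t <= p) -> K t = 0) ->
  `|Rint K - (q - p) * g0| <= ep * `|q - p|.
Proof.
move=> mK bK eK eG ep0 zK; have [pq|qp] := leP p q.
  rewrite (ger0_norm (_ : 0 <= q - p)) ?subr_ge0 //.
  apply: (@Rint_between_le _ _ _ M) => //.
    move=> t h; apply: zK => //; apply: contra h => /andP[h1 h2].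
    by apply/andP; split; lra.
  move=> t h; rewrite eK; [|by apply/eqP; lra|by apply/eqP; lra].
  rewrite h (_ : (q < t < p) = false) ?subr0 ?mul1r; first by apply: eG; rewrite h.
  by apply/negP => /andP[]; lra.
rewrite (ltr0_norm (_ : q - p < 0)) ?subr_lt0 // opprB.
have IK : mu.-integrable setT (EFin \o K).
  apply: (@le_integrable_itv _ M q p) => // t; rewrite indicE.
  have [h|h] := boolP (q <= t <= p); first by rewrite mem_set ?mulr1 //= in_itv.
  rewrite zK // ?normr0 ?mulr_ge0 //; first by apply: le_trans (bK 0).
  by apply/negP => /andP[]; lra.
have -> : `|Rint K - (q - p) * g0| = `|Rint (fun t => -1 * K t) - (p - q) * g0|.
  by rewrite RintegralZl // -normrN; congr `| _ |; ring.
apply: (@Rint_between_le _ _ _ M) => //; first exact: ltW.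
- exact: measurable_funM.
- by move=> t; rewrite mulN1r normrN.
- move=> t h; rewrite zK ?mulr0 //; by apply/negP => /andP[]; lra.
move=> t h; rewrite eK; [|by apply/eqP; lra|by apply/eqP; lra].
rewrite h (_ : (p < t < q) = false) ?sub0r; first by rewrite !mulN1r opprK; apply: eG; rewrite h orbT.
by apply/negP => /andP[]; lra.
Qed.

(** The neighbourhoods need not be punctured: at [y = x] the quotient is 0, because the inverse of 0
    is 0. *)
Lemma quot_cvg0 (V : normedModType R) (x : V) (phi : V -> R) :
  (forall ep, 0 < ep -> \forall y \near x, `|phi y| <= ep * `|y - x|) ->
  phi y / `|y - x| @[y --> x] --> 0.
Proof.
move=> H; apply/cvgr0Pnorm_le => ep ep0; apply: filterS (H ep ep0) => y hy.
rewrite normrM normfV normr_id.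
have [->|h] := eqVneq `|y - x| 0; first by rewrite invr0 mulr0 ltW.
by rewrite ler_pdivrMr // lt_def h normr_ge0.
Qed.

Lemma near_cvgD (V : normedModType R) (x : V) (f D : V -> R) (l : R) :
  D y @[y --> x] --> 0 -> (\forall y \near x, f y = D y + l) -> f y @[y --> x] --> l.
Proof.
move=> cD fD; have : D y + l @[y --> x] --> 0 + l by apply: cvgD => //; exact: cvg_cst.
rewrite add0r; apply: cvg_trans; apply: near_eq_cvg.
by apply: filterS fD => y ->.
Qed.

Lemma near_cvg_cst (V : normedModType R) (x : V) (f : V -> R) (l : R) :
  (\forall y \near x, f y = l) -> f y @[y --> x] --> l.
Proof.
move=> fl; apply: (@near_cvgD _ _ _ (fun=> 0)); first exact: cvg_cst.
by apply: filterS fl => y ->; rewrite add0r.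
Qed.

Lemma near_gt0 (V : normedModType R) (x : V) (f : V -> R) (l : R) :
  f y @[y --> x] --> l -> 0 < l -> \forall y \near x, 0 < f y.
Proof. by move=> cf l0; exact: cvgr_gt cf _ l0. Qed.

End Slices.

(** * Voronoi cells *)

Section Cells.
Context {R : realType} {m n e : nat} (idx : 'I_n -> 'rV[int]_e).
Implicit Types (x y : 'M[R]_(n, m.+1)) (w : 'rV[R]_m.+1) (s : nat -> R).

(** The norm on matrices is the maximum norm; sums over coordinates therefore cost the factors
    [m.+1] seen below. *)
Lemma entry_le p q (v : 'M[R]_(p, q)) i l : `|v i l| <= `|v|.
Proof.
rewrite [X in _ <= X](_ : _ = mx_norm v) // mx_normrE.
exact: (le_bigmax _ (fun ij => `|v ij.1 ij.2|) (i, l)).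
Qed.

Lemma sum_le_cst d (F : 'I_d -> R) c : (forall l, F l <= c) -> \sum_l F l <= d%:R * c.
Proof.
move=> H; apply: (@le_trans _ _ (\sum_(l < d) c)); first exact: ler_sum.
by rewrite sumr_const card_ord mulr_natl.
Qed.

Lemma continuous_sqd y i : continuous (sqd y i).
Proof. by move=> w; apply: (@cvg_sqd _ _ _ _ (nbhs w) _ (fun=> y) id); [exact: cvg_cst|exact: cvg_id]. Qed.

Lemma msrow_cube d : msrow (cube d : set 'rV[R]_d).
Proof.
apply: (@msrow_all _ _ 'I_d (fun l => [set w : 'rV[R]_d | 0 <= w 0 l <= 1])) => l d' S p mp.
have := mp l measurableT _ (measurable_itv `[0, 1]); by rewrite setTI; congr measurable.
Qed.

Lemma msrow_lt (F G : 'rV[R]_m.+1 -> R) : continuous F -> continuous G ->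
  msrow [set w | F w < G w].
Proof.
move=> cF cG d' S p mp.
have mh : mrow (fun w => G w - F w).
  by apply: mrow_continuous => w; exact: (continuousB (cG w) (cF w)).
have := mh _ _ p mp measurableT _ (measurable_itv `]0, +oo[); rewrite setTI; congr measurable.
by apply/seteqP; split => z /=; rewrite in_itv /= andbT subr_gt0.
Qed.

Lemma msrow_vcell y i : msrow (vcell idx y i).
Proof.
pose A k := [set w | sqd y i w < sqd y k w].
pose B k := [set w | sqd y k w < sqd y i w].
(* A tie is written as the failure of both strict comparisons, so that only strict inequalities
   between continuous functions have to be measurable. *)
have -> : vcell idx y i = cube m.+1 `&` [set w | forall k,
    ((~` [set w | k != i]) `|` (A k `|` ((~` A k `&` ~` B k) `&` [set w | lexlt (idx i) (idx k)]))) w].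
  apply/seteqP; split => w [cw H]; split => // k.
    have [ki|ki] := boolP (k != i); last by left; exact/negP.
    right; case: (H k ki) => [h|[/enorm_eq h1 h2]]; first by left; rewrite /A /= -enorm_lt.
    by right; split => //; rewrite /A /B /= h1 ltxx; split.
  move=> ki; case: (H k) => [/(_ ki)//|[h|[[h1 h2] h3]]]; first by left; rewrite enorm_lt.
  right; split => //; rewrite /enorm !edot_sqd; congr Num.sqrt; apply/eqP.
  by rewrite eq_le !leNgt; apply/andP; split; apply/negP.
apply: msrowI; first exact: msrow_cube.
apply: msrow_all => k; apply: msrowU; first by apply: msrowC; exact: msrow_cst.
have mA : msrow (A k) by apply: msrow_lt; exact: continuous_sqd.
have mB : msrow (B k) by apply: msrow_lt; exact: continuous_sqd.
apply: msrowU => //; apply: msrowI; last exact: msrow_cst.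
by apply: msrowI; exact: msrowC.
Qed.

(* Signed transfer between the cells of [i] and [k] when [x] moves to [y]. *)
Definition swap x y i k w : R :=
  \1_(vcell idx y i) w * \1_(vcell idx x k) w - \1_(vcell idx y k) w * \1_(vcell idx x i) w.

Lemma indic01 (T : Type) (A : set T) z : \1_A z = 0 :> R \/ \1_A z = 1 :> R.
Proof. by rewrite indicE; case: (_ \in _); [right|left]. Qed.

Lemma indic_true (T : Type) (A : set T) z : A z -> \1_A z = 1 :> R.
Proof. by move=> Az; rewrite indicE mem_set. Qed.

Lemma indic_false (T : Type) (A : set T) z : ~ A z -> \1_A z = 0 :> R.
Proof. by move=> Az; rewrite indicE memNset. Qed.

Lemma swap_le1 x y i k w : `|swap x y i k w| <= 1.
Proof.
rewrite /swap; have [-> | ->] := indic01 _ (vcell idx y i) w;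
have [-> | ->] := indic01 _ (vcell idx x k) w;
have [-> | ->] := indic01 _ (vcell idx y k) w;
have [-> | ->] := indic01 _ (vcell idx x i) w;
by rewrite ?(mul0r, mulr0, mul1r, mulr1, subr0, sub0r, subrr, normrN, normr0, normr1).
Qed.

Lemma swap_neq0 x y i k w : swap x y i k w != 0 ->
  (vcell idx y i w /\ vcell idx x k w) \/ (vcell idx y k w /\ vcell idx x i w).
Proof.
apply: contraNP => /not_orP[/not_andP h1 /not_andP h2]; apply/eqP; rewrite /swap.
have -> : \1_(vcell idx y i) w * \1_(vcell idx x k) w = 0 :> R.
  by case: h1 => h; rewrite (indic_false _ _ _ h) ?(mul0r, mulr0).
have -> : \1_(vcell idx y k) w * \1_(vcell idx x i) w = 0 :> R.
  by case: h2 => h; rewrite (indic_false _ _ _ h) ?(mul0r, mulr0).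
exact: subrr.
Qed.

Lemma swap_cube x y i k w : ~ cube m.+1 w -> swap x y i k w = 0.
Proof.
move=> nc; apply/eqP; apply: contra_notT nc => /swap_neq0 [] [/vcell_cube]//.
Qed.

Lemma mrow_swap x y i k : mrow (swap x y i k).
Proof.
move=> d' S p mp; apply: measurable_funB; apply: measurable_funM;
  by apply: mrow_indic => //; exact: msrow_vcell.
Qed.

Lemma sqd_lip x y j w : cube m.+1 (row j x) -> cube m.+1 w -> `|y - x| <= 1 ->
  `|sqd y j w - sqd x j w| <= 3 * m.+1%:R * `|y - x|.
Proof.
move=> cx cw y1; rewrite /sqd -sumrB; apply: (le_trans (ler_norm_sum _ _ _)).
(* Each coordinate changes by a product of [v], at most [|y - x|], and [v + 2 * (x - w)], at most
   [1 + 2] because [x] and [w] lie in the cube. *)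
rewrite (_ : 3 * _ * _ = m.+1%:R * (3 * `|y - x|)); last by ring.
apply: sum_le_cst => l.
have -> : (y j l - w 0 l) ^+ 2 - (x j l - w 0 l) ^+ 2 =
   (y - x) j l * ((y - x) j l + 2 * (x j l - w 0 l)) by rewrite !mxE; ring.
have := cx l; have := cw l; rewrite mxE => /andP[w0 w1] /andP[x0 x1].
have := entry_le _ _ (y - x) j l; set v := (y - x) j l => vy.
rewrite normrM mulrC ler_pM //; apply: (le_trans (ler_normD _ _)).
rewrite normrM ger0_norm // (_ : 3 = 1 + 2 * 1); last by ring.
rewrite lerD //; first exact: le_trans y1.
by rewrite ler_wpM2l // ler_norml; lra.
Qed.

(** A transferred point is closer to one generator for [x] and to the other for [y]. The difference
    of squared distances thus changes sign between [x] and [y], and it moves by at most twice the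
    bound of [sqd_lip]. *)
Lemma swap_supp x y i k w : cube m.+1 (row i x) -> cube m.+1 (row k x) ->
  `|y - x| <= 1 -> swap x y i k w != 0 ->
  cube m.+1 w /\ `|sqd x k w - sqd x i w| <= 6 * m.+1%:R * `|y - x|.
Proof.
move=> ci ck y1 /swap_neq0 H.
have cw : cube m.+1 w by case: H => -[/vcell_cube].
split => //; have := sqd_lip _ _ _ _ ci cw y1; have := sqd_lip _ _ _ _ ck cw y1.
set h := _ * `|y - x|; rewrite (_ : 6 * _ * _ = h + h); last by rewrite /h; ring.
rewrite !ler_norml; case: H => -[a b]; have := vcell_le _ _ _ _ i a;
have := vcell_le _ _ _ _ k a; have := vcell_le _ _ _ _ i b; have := vcell_le _ _ _ _ k b; lra.
Qed.

(* Derivative at [x] along [v] of the position of the mediator of [x_k] and [x_i],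
   measured along the last coordinate and oriented from [C_i] to [C_k]. *)
Definition lin x (v : 'M[R]_(n, m.+1)) i k w : R :=
  (\sum_l (x k l - w 0 l) * v k l - \sum_l (x i l - w 0 l) * v i l) / `|lastd x k i|.

Lemma lin_le x v i k w : DI m.+1 n x -> cube m.+1 w ->
  `|lin x v i k w| <= 2 * m.+1%:R * `|v| / `|lastd x k i|.
Proof.
move=> [cx _] cw; rewrite /lin normrM normfV normr_id ler_wpM2r ?invr_ge0 //.
have H j : `|\sum_l (x j l - w 0 l) * v j l| <= m.+1%:R * `|v|.
  apply: (le_trans (ler_norm_sum _ _ _)).
  apply: sum_le_cst => l.
  rewrite normrM -[leRHS]mul1r ler_pM ?entry_le //.
  by have := cx j l; have := cw l; rewrite mxE ler_norml => /andP[? ?] /andP[? ?]; lra.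
apply: (le_trans (ler_normB _ _)).
by rewrite (_ : 2 * _ * _ = m.+1%:R * `|v| + m.+1%:R * `|v|) ?lerD //; ring.
Qed.

Lemma sqd_expand x y j w : sqd y j w =
  sqd x j w + 2 * \sum_l (x j l - w 0 l) * (y - x) j l + \sum_l (y - x) j l ^+ 2.
Proof.
rewrite /sqd mulr_sumr -!big_split; apply: eq_bigr => l _ /=.
by rewrite !mxE; ring.
Qed.

(** Evaluating [sqd_diff] for [y] at the mediator point of [x], where the distances for [x] tie,
    gives an identity with an exact quadratic remainder. The factor is [lastd y]; replacing it by
    [lastd x] later is one more second-order error. *)
Lemma lin_tau x y i k s : lastd x k i != 0 -> lastd y k i != 0 ->
  let w := rw (upd m (tau x k i s) s) in
  2 * lastd y k i * (tau y k i s - tau x k i s) =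
  2 * (\sum_l (x k l - w 0 l) * (y - x) k l - \sum_l (x i l - w 0 l) * (y - x) i l)
  + (\sum_l (y - x) k l ^+ 2 - \sum_l (y - x) i l ^+ 2).
Proof.
move=> ax ay w; rewrite -sqd_diff // -/w.
have ex : sqd x k w = sqd x i w by exact: sqd_tau.
have := sqd_expand x y k w; have := sqd_expand x y i w; lra.
Qed.

Lemma sumsq_le (v : 'M[R]_(n, m.+1)) j : 0 <= \sum_l v j l ^+ 2 <= m.+1%:R * `|v| ^+ 2.
Proof.
rewrite sumr_ge0 /=; last by move=> l _; exact: sqr_ge0.
apply: sum_le_cst => l.
by rewrite -real_normK ?num_real // !expr2 ler_pM ?entry_le.
Qed.

End Cells.

(** * Boundary layers on a slice *)

Section CellSlices.
Context {R : realType} {m n e : nat} (idx : 'I_n -> 'rV[int]_e).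
Local Notation mu := (@lebesgue_measure R).
Local Notation "'Rint' phi" := (Rintegral mu setT phi) (at level 10, phi at level 8).
Implicit Types (x y : 'M[R]_(n, m.+1)) (w : 'rV[R]_m.+1) (s : nat -> R).

Definition adj x i k w : R :=
  \1_(closure (vcell idx x k) `&` closure (vcell idx x i)) w.

Lemma measurable_slice (F : 'rV[R]_m.+1 -> R) s : mrow F ->
  measurable_fun setT (fun t : R => F (rw (upd m t s))).
Proof.
move=> mF; apply: (mF _ _ (fun t : R => rw (upd m t s))) => l.
rewrite (_ : (fun t : R => _) = (fun t => upd m t s l)); last by apply/funext => t; rewrite mxE.
by rewrite /upd; case: eqP.
Qed.

Lemma vcell_slice y i k s t : inside y i k (rw (upd m t s)) -> t != tau y k i s ->
  0 < lastd y k i ->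
  \1_(vcell idx y i) (rw (upd m t s)) = (t < tau y k i s)%R%:R :> R /\
  \1_(vcell idx y k) (rw (upd m t s)) = (tau y k i s < t)%R%:R :> R.
Proof.
move=> Hin tt a0; set w := rw _.
have D : sqd y k w - sqd y i w = 2 * lastd y k i * (tau y k i s - t).
  by apply: sqd_diff; exact: lt0r_neq0.
have [h|h|h] := ltgtP t (tau y k i s); last by rewrite h eqxx in tt.
  have ik : sqd y i w < sqd y k w.
    by rewrite -subr_gt0 D !mulr_gt0 // subr_gt0.
  rewrite (indic_true _ _ _ (inside_vcell _ _ _ _ _ Hin ik)) indic_false //.
  by move=> /(vcell_le _ _ _ _ i); rewrite leNgt ik.
have ki : sqd y k w < sqd y i w.
  by rewrite -subr_lt0 D pmulr_rlt0 ?mulr_gt0 // subr_lt0.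
rewrite (indic_true _ _ _ (inside_vcell _ _ _ _ _ (insideC _ _ _ _ Hin) ki)) indic_false //.
by move=> /(vcell_le _ _ _ _ k); rewrite leNgt ki.
Qed.

Lemma lastd_lip x y i k : `|lastd y k i - lastd x k i| <= 2 * `|y - x|.
Proof.
have h1 := entry_le _ _ (y - x) k ord_max; have h2 := entry_le _ _ (y - x) i ord_max.
move: h1 h2; rewrite !mxE /lastd; set h := `|y - x|; rewrite !ler_norml; lra.
Qed.

Lemma near_small x (c : R) : 0 < c -> \forall y \near x, `|y - x| <= c.
Proof.
move=> c0; apply: filterS (nbhsx_ballx x c c0) => y.
by rewrite -ball_normE /ball_ /= distrC => /ltW.
Qed.

Section Pair.
Variables (x : 'M[R]_(n, m.+1)) (i k : 'I_n) (g : 'rV[R]_m.+1 -> R) (Mg : R).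
Hypotheses (Dx : DI m.+1 n x) (ki : k != i) (cg : continuous g).
Hypothesis bg : forall w, cube m.+1 w -> `|g w| <= Mg.

Lemma Mg_ge0 : 0 <= Mg.
Proof.
apply: le_trans (bg 0 _) => // l; by rewrite mxE lexx ler01.
Qed.

Lemma mrow_swapg y : mrow (fun w => swap idx x y i k w * g w).
Proof. by apply: mrowM; [exact: mrow_swap|exact: mrow_continuous]. Qed.

Lemma swapg_le y w : `|swap idx x y i k w * g w| <= Mg.
Proof.
have [cw|ncw] := pselect (cube m.+1 w).
  by rewrite normrM -[leRHS]mul1r ler_pM // ?swap_le1 // bg.
by rewrite swap_cube // mul0r normr0 Mg_ge0.
Qed.

Lemma slice_supp y s t : `|y - x| <= 1 -> swap idx x y i k (rw (upd m t s)) != 0 ->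
  cube m.+1 (rw (upd m t s)) /\
  `|tau x k i s - t| <= 3 * m.+1%:R * `|y - x| / `|lastd x k i|.
Proof.
move=> y1 sw; have a0 := DI_lastd _ _ _ Dx ki.
have [cw] := swap_supp _ _ _ _ _ _ (Dx.1 i) (Dx.1 k) y1 sw.
rewrite sqd_diff // normrM normrM ger0_norm // => H; split => //.
rewrite ler_pdivlMr ?normr_gt0 //.
by rewrite -(ler_pM2l (_ : 0 < 2)) //; apply: le_trans (le_trans _ H) _; rewrite ?mulrA // mulrAC; lra.
Qed.

(** After division by [|y - x|] the bound depends neither on [s] nor on [y]: this is the domination
    needed for the limit in [s]. *)
Lemma slice_bound y s : `|y - x| <= 1 ->
  `|Rint (fun t => swap idx x y i k (rw (upd m t s)) * g (rw (upd m t s)))| <=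
  Mg * (6 * m.+1%:R * `|y - x| / `|lastd x k i|).
Proof.
move=> y1; set c := 3 * m.+1%:R * `|y - x| / `|lastd x k i|.
have c0 : 0 <= c by rewrite !mulr_ge0 // invr_ge0.
have -> : 6 * m.+1%:R * `|y - x| / `|lastd x k i| = (tau x k i s + c) - (tau x k i s - c).
  by rewrite /c; ring.
apply: le_Rint_itv; first by lra.
  exact: (measurable_slice (fun w => swap idx x y i k w * g w) s (mrow_swapg y)).
move=> t; rewrite indicE; have [z|nz] := eqVneq (swap idx x y i k (rw (upd m t s))) 0.
  by rewrite z mul0r normr0 mulr_ge0 // Mg_ge0.
have [cw] := slice_supp _ _ _ y1 nz; rewrite -/c ler_norml => H.
rewrite mem_set ?mulr1 ?swapg_le //= in_itv /=; apply/andP; split; lra.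
Qed.

Lemma slice_inside s : 0 < lastd x k i ->
  inside x i k (rw (upd m (tau x k i s) s)) ->
  forall ep, 0 < ep -> \forall y \near x,
  `|Rint (fun t => swap idx x y i k (rw (upd m t s)) * g (rw (upd m t s)))
    - g (rw (upd m (tau x k i s) s)) * lin x (y - x) i k (rw (upd m (tau x k i s) s))|
  <= ep * `|y - x|.
Proof.
set a := lastd x k i; set t0 := tau x k i s; set w0 := rw (upd m t0 s) => a0 Hin ep ep0.
pose d : R := m.+1%:R; have d0 : 0 < d by rewrite ltr0n.
(* [C1 * h] will bound the displacement [ty - t0], and [C2 * h ^+ 2 / a] its linearization error,
   where [h] is the norm of [y - x]; [ep1] is chosen so that [ep1 * C1] is half of [ep]. *)
pose C1 := 6 * d / a; have C10 : 0 < C1 by rewrite divr_gt0 // mulr_gt0.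
pose C2 := d + 2 * C1; have C20 : 0 < C2 by rewrite addr_gt0 // mulr_gt0.
pose ep1 := ep / (2 * C1); have ep10 : 0 < ep1 by rewrite divr_gt0 // mulr_gt0.
have cw0 : cube m.+1 w0 by move=> l; case: Hin => /(_ l) /andP[/ltW -> /ltW ->].
have cW : rw (upd m t s) @[t --> t0] --> w0 by apply: cvg_rw; exact: cvg_id.
(* One radius is taken jointly for [y] and [t], since both vary at once in what follows. *)
have [dl [dl0 Hdl]] : exists dl : R, 0 < dl /\ forall y t, `|y - x| < dl -> `|t0 - t| < dl ->
    inside y i k (rw (upd m t s)) /\ `|g (rw (upd m t s)) - g w0| <= ep1.
  have n1 : \forall p \near (x, t0), inside p.1 i k (rw (upd m p.2 s)).
    apply: (@near_inside _ _ _ _ (nbhs (x, t0)) _ fst (fun p => rw (upd m p.2 s)) x w0 i k) => //.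
      exact: cvg_fst.
    by apply: cvg_rw; exact: cvg_snd.
  have n2 : \forall p \near (x, t0), `|g (rw (upd m p.2 s)) - g w0| <= ep1.
    have c2 : g (rw (upd m p.2 s)) @[p --> (x, t0)] --> g w0.
      apply: (@continuous_cvg _ _ _ (nbhs (x, t0)) _ (fun p => rw (upd m p.2 s)) g w0).
        exact: cg.
      by apply: cvg_rw; exact: cvg_snd.
    move/cvgrPdist_le : c2 => /(_ ep1 ep10); apply: filterS => p.
    by rewrite distrC.
  have /nbhs_ballP[dl dl0 Hd] : nbhs (x, t0) [set p | inside p.1 i k (rw (upd m p.2 s)) /\
      `|g (rw (upd m p.2 s)) - g w0| <= ep1].
    exact: filterI n1 n2.
  exists dl; split => // y t hy ht; apply: (Hd (y, t)); split => //=.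
  by rewrite -ball_normE /ball_ /= distrC.
(* The four bounds serve, in order, the Lipschitz estimate [sqd_lip], the inequality [a / 2 <= ay],
   the inclusion of [y] and of the moving slice in the radius [dl], and the absorption of the
   quadratic error into [ep / 2 * h]. *)
pose h0 := Num.min (Num.min 1 (a / 4)) (Num.min (dl / (2 * (C1 + 1))) (ep * a / (2 * (`|g w0| + 1) * C2))).
have C11 : 0 < C1 + 1 by lra.
have g1 : 0 < `|g w0| + 1 by rewrite ltr_wpDl.
have h00 : 0 < h0.
  by rewrite !lt_min ltr01 !divr_gt0 ?mulr_gt0.
apply: filterS (near_small x _ h00) => y; set h := `|y - x|; rewrite /h0 !le_min.
move=> /andP[/andP[h1 h2] /andP[h3 h4]].
have h_ge0 : 0 <= h by exact: normr_ge0.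
have C1h : C1 * h < dl.
  move: h3; rewrite ler_pdivlMr ?mulr_gt0 // => h3.
  have [->|hp] := eqVneq h 0; first by rewrite mulr0.
  have hp' : 0 < h by rewrite lt_def hp.
  have : 0 < h * C1 by rewrite mulr_gt0.
  lra.
have hdl : h < dl.
  move: h3; rewrite ler_pdivlMr ?mulr_gt0 // => h3.
  have : 0 <= h * C1 by rewrite mulr_ge0 // ltW.
  by move: dl0 h_ge0; lra.
set ay := lastd y k i; set ty := tau y k i s.
have aya : `|ay - a| <= 2 * h by exact: lastd_lip.
have ay2 : a / 2 <= ay by move: aya; rewrite ler_norml; lra.
have ay0 : 0 < ay by apply: lt_le_trans ay2; rewrite divr_gt0.
(* [2 * ay * (ty - t0)] is the difference of squared distances for [y] at [w0]; it vanishes for [x],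
   so it is at most [6 * d * h], and [2 * ay] is at least [a]. *)
have Dty : `|ty - t0| <= C1 * h.
  have := sqd_lip _ _ _ _ (Dx.1 k) cw0 h1; have := sqd_lip _ _ _ _ (Dx.1 i) cw0 h1.
  have e0 : sqd x k w0 = sqd x i w0 by apply: sqd_tau; exact: lt0r_neq0.
  have := @sqd_diff _ _ _ y k i s t0 (lt0r_neq0 ay0); rewrite -/w0 -/ay -/ty -/h -/d => E H1 H2.
  have H3 : `|2 * ay * (ty - t0)| <= 6 * d * h.
    by rewrite -E; move: H1 H2; rewrite !ler_norml; lra.
  rewrite /C1 mulrAC ler_pdivlMr //.
  move: H3; rewrite normrM gtr0_norm ?mulr_gt0 // => H3; apply: le_trans H3.
  by rewrite mulrC ler_wpM2r //; lra.
have insy t : `|t0 - t| < dl -> inside y i k (rw (upd m t s)) by move=> ht; case: (Hdl y t hdl ht).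
have insx t : `|t0 - t| < dl -> inside x i k (rw (upd m t s)).
  by move=> ht; case: (Hdl x t _ ht) => //; rewrite subrr normr0.
have far t : ~~ (t0 <= t <= ty) -> ~~ (ty <= t <= t0) ->
    `|t0 - t| < dl -> swap idx x y i k (rw (upd m t s)) = 0.
  move=> n1 n2 ht.
  have tt0 : t != t0.
    apply/eqP => tE; move: n1 n2; rewrite tE !lexx ?andbT /= -!ltNge => lt1 lt2.
    by have := lt_trans lt1 lt2; rewrite ltxx.
  have tty : t != ty.
    apply/eqP => tE; move: n1 n2; rewrite tE !lexx ?andbT /= -!ltNge => lt1 lt2.
    by have := lt_trans lt1 lt2; rewrite ltxx.
  rewrite /swap; have [-> ->] := vcell_slice y i k s t (insy t ht) tty ay0.
  have [-> ->] := vcell_slice x i k s t (insx t ht) tt0 a0.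
  rewrite -/t0 -/ty; move: n1 n2; rewrite !negb_and -!ltNge.
  by case: (ltgtP t t0) tt0; case: (ltgtP t ty) tty; rewrite ?eqxx //= ?(mul0r, mulr0, mul1r, subrr).
(* Beyond [dl] the cells are not known to be half-lines; there the support estimate applies, because
   [3 * d * h / a] is at most [C1 * h < dl]. *)
have far2 t : ~~ (`|t0 - t| < dl) -> swap idx x y i k (rw (upd m t s)) = 0.
  rewrite -leNgt => ht; apply/eqP; apply: contraLR ht => /(slice_supp _ _ _ h1)[_].
  rewrite -/t0 -/a -/d -/h (gtr0_norm a0) -ltNge => H; apply: le_lt_trans H _.
  apply: le_lt_trans C1h; rewrite /C1 mulrAC ler_wpM2r ?invr_ge0 ?(ltW a0) //.
  by rewrite ler_wpM2r ?invr_ge0 ?(ltW a0) // ler_wpM2r ?(ltW d0) // ler_nat.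
have btw t : (t0 < t < ty) || (ty < t < t0) -> `|t0 - t| < dl.
  move=> H; apply: le_lt_trans C1h; apply: le_trans Dty.
  by rewrite !ler_normr; case/orP: H => /andP[? ?]; apply/orP; [left|right]; rewrite ler_norml; lra.
have RB := @Rint_between R (fun t => swap idx x y i k (rw (upd m t s)) * g (rw (upd m t s)))
  (fun t => g (rw (upd m t s))) t0 ty Mg (g w0) ep1
  (measurable_slice (fun w => swap idx x y i k w * g w) s (mrow_swapg y))
  (fun t => swapg_le y _).
have {}RB : `|Rint (fun t => swap idx x y i k (rw (upd m t s)) * g (rw (upd m t s)))
   - (ty - t0) * g w0| <= ep1 * `|ty - t0|.
  apply: RB; last 2 first.
  - exact: ltW.
  - move=> t n1 n2; have [ht|/far2 ->] := boolP (`|t0 - t| < dl); last by rewrite mul0r.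
    by rewrite far // mul0r.
  - move=> t tt0 tty; congr (_ * _).
    have [ht|ht] := boolP (`|t0 - t| < dl); last first.
      rewrite far2 //; have : ~~ ((t0 < t < ty) || (ty < t < t0)) by apply: contra ht; exact: btw.
      by rewrite negb_or => /andP[/negbTE -> /negbTE ->]; rewrite subrr.
    rewrite /swap; have [-> ->] := vcell_slice y i k s t (insy t ht) tty ay0.
    have [-> ->] := vcell_slice x i k s t (insx t ht) tt0 a0.
    rewrite -/t0 -/ty.
    by case: (ltgtP t t0) tt0; case: (ltgtP t ty) tty; rewrite ?eqxx //= ?(mul0r, mulr0, mul1r, subrr).
  - by move=> t /btw ht; case: (Hdl x t _ ht) => //; rewrite subrr normr0.
set L := lin _ _ _ _ _.
(* The two summands of [C2] are the quadratic terms of [lin_tau] and the product of [ay - a], at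
   most [2 * h], with [ty - t0], at most [C1 * h]. *)
have HL : `|(ty - t0) - L| <= C2 * h ^+ 2 / a.
  rewrite /L /lin -/a (gtr0_norm a0).
  have := lin_tau x y i k s (lt0r_neq0 a0) (lt0r_neq0 ay0).
  rewrite /= -/t0 -/ty -/w0 -/ay.
  have := sumsq_le (y - x) k; have := sumsq_le (y - x) i; rewrite -/h -/d.
  set Qk := \sum_l (y - x) k l ^+ 2; set Qi := \sum_l (y - x) i l ^+ 2.
  set Lk := \sum_l _ - \sum_l _.
  move=> Qi1 Qk1 E.
  have -> : ty - t0 - Lk / a = ((Qk - Qi) / 2 - (ay - a) * (ty - t0)) / a.
    have -> : Lk = ay * (ty - t0) - (Qk - Qi) / 2 by lra.
    by field; exact: lt0r_neq0.
  rewrite normrM (ger0_norm (_ : 0 <= a^-1)) ?invr_ge0 ?(ltW a0) //.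
  rewrite ler_wpM2r ?invr_ge0 ?(ltW a0) //.
  apply: (le_trans (ler_normB _ _)); have -> : C2 * h ^+ 2 = d * h ^+ 2 + 2 * C1 * h ^+ 2 by rewrite /C2; ring.
  apply: lerD.
    by case/andP: Qi1 => ? ?; case/andP: Qk1 => ? ?; rewrite ler_norml; lra.
  by rewrite normrM (_ : 2 * C1 * h ^+ 2 = (2 * h) * (C1 * h)) ?ler_pM //; ring.
have -> : Rint (fun t => swap idx x y i k (rw (upd m t s)) * g (rw (upd m t s))) - g w0 * L =
  (Rint (fun t => swap idx x y i k (rw (upd m t s)) * g (rw (upd m t s))) - (ty - t0) * g w0)
  + g w0 * ((ty - t0) - L) by ring.
apply: (le_trans (ler_normD _ _)).
rewrite (_ : ep * h = ep1 * (C1 * h) + ep / 2 * h); last by rewrite /ep1; field; exact: lt0r_neq0.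
apply: lerD; first by apply: (le_trans RB); rewrite ler_wpM2l // ltW.
rewrite normrM; apply: (@le_trans _ _ ((`|g w0| + 1) * (C2 * h ^+ 2 / a))).
  by rewrite ler_pM // lerDl.
move: h4; rewrite ler_pdivlMr ?mulr_gt0 // => h4.
rewrite (_ : _ * _ = (h * (2 * (`|g w0| + 1) * C2)) * (h / (2 * a))); last by field; exact: lt0r_neq0.
rewrite (_ : ep / 2 * h = ep * a * (h / (2 * a))); last by field; exact: lt0r_neq0.
by rewrite ler_wpM2r // divr_ge0 // mulr_ge0 // ltW.
Qed.

End Pair.
End CellSlices.

(** * Limits of integrals over cells *)

Lemma cvg_zero_sub (R : realType) (V : normedModType R) (x : V) (f : V -> R) (l : R) :
  f y @[y --> x] --> l -> f y - l @[y --> x] --> 0.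
Proof. by move=> cf; rewrite -(subrr l); apply: cvgB => //; exact: cvg_cst. Qed.

Section CellLimits.
Context {R : realType} {m n e : nat} (idx : 'I_n -> 'rV[int]_e).
Local Notation mu := (@lebesgue_measure R).
Local Notation "'Rint' phi" := (Rintegral mu setT phi) (at level 10, phi at level 8).
Implicit Types (x y : 'M[R]_(n, m.+1)) (w : 'rV[R]_m.+1) (s : nat -> R).

Lemma good_bound p M M' (g : (nat -> R) -> R) : good p M g ->
  (forall s, `|g s| <= M') -> good p M' g.
Proof. by case. Qed.

Lemma mrow_adj x i k : mrow (adj idx x i k).
Proof.
apply: mrow_indic; apply: msrow_closed; apply: closedI; exact: closed_closure.
Qed.

Lemma adj_cube x i k w : ~ cube m.+1 w -> adj idx x i k w = 0.
Proof.
move=> nc; rewrite /adj indic_false // => -[_ ci]; apply: nc => l; apply/negPn/negP => h.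
apply: (outside_closure idx x i w) ci; left; exists l.
by move: h; rewrite negb_and -!ltNge => /orP.
Qed.

Lemma adj01 x i k w : `|adj idx x i k w| <= 1.
Proof. rewrite /adj; have [->|->] := @indic01 R _ (closure (vcell idx x k) `&` closure (vcell idx x i)) w; by rewrite ?normr0 ?normr1. Qed.

Lemma adjC x i k w : adj idx x i k w = adj idx x k i w.
Proof. by rewrite /adj setIC. Qed.

Lemma adj_inside x i k s : lastd x k i != 0 ->
  inside x i k (rw (upd m (tau x k i s) s)) ->
  adj idx x i k (rw (upd m (tau x k i s) s)) = 1.
Proof.
move=> a0 Hin; apply: indic_true; split; last exact: inside_closure.
rewrite -tauC; apply: inside_closure; first by rewrite lastdC oppr_eq0.
by rewrite tauC; exact: insideC.
Qed.

Lemma adj_outside x i k w : outside x i w -> adj idx x i k w = 0.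
Proof. by move=> ow; apply: indic_false => -[_]; exact: outside_closure. Qed.

Lemma measurable_tau x k i d (S : measurableType d) (s : S -> nat -> R) :
  (forall l, measurable_fun setT (s ^~ l)) ->
  measurable_fun setT (fun z => tau x k i (s z)).
Proof.
move=> ms; apply: measurable_funM => //; apply: measurable_funB => //.
by apply: measurable_sum => l; apply: measurable_funM.
Qed.

Lemma good_tau x k i M (F : 'rV[R]_m.+1 -> R) : goodrow M F ->
  good m M (fun s => F (rw (upd m (tau x k i s) s))).
Proof.
move=> [mF bF zF]; split.
- move=> d S s ms; apply: (mF _ _ (fun z => rw (upd m (tau x k i (s z)) (s z)))) => l.
  rewrite (_ : (fun z => _) = (fun z => upd m (tau x k i (s z)) (s z) l)); last by apply/funext => z; rewrite mxE.
  by apply: measurable_upd => //; exact: measurable_tau.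
- by [].
- move=> s nb; apply: zF => c; apply: nb => l lm.
  have := c (widen_ord (leqnSn m) (Ordinal lm)); by rewrite rw_upd_lt.
Qed.

Lemma goodrow_adj x i k M (G : 'rV[R]_m.+1 -> R) : mrow G ->
  (forall w, cube m.+1 w -> `|G w| <= M) -> 0 <= M ->
  goodrow M (fun w => adj idx x i k w * G w).
Proof.
move=> mG bG M0; split.
- by apply: mrowM => //; exact: mrow_adj.
- move=> w; have [cw|nc] := pselect (cube m.+1 w).
    by rewrite normrM -[leRHS]mul1r ler_pM ?adj01 ?bG.
  by rewrite adj_cube // mul0r normr0.
- by move=> w nc; rewrite adj_cube // mul0r.
Qed.

Lemma goodrow_cell y i M (G : 'rV[R]_m.+1 -> R) : mrow G ->
  (forall w, cube m.+1 w -> `|G w| <= M) -> 0 <= M ->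
  goodrow M (fun w => \1_(vcell idx y i) w * G w).
Proof.
move=> mG bG M0; split.
- by apply: mrowM => //; apply: mrow_indic; exact: msrow_vcell.
- move=> w; have [->|h] := @indic01 R _ (vcell idx y i) w; first by rewrite mul0r normr0.
  rewrite h mul1r; apply: bG; apply: (vcell_cube idx y i).
  by apply: contrapT => /(@indic_false R _ (vcell idx y i)) h'; move: h; rewrite h' => /eqP; rewrite eq_sym oner_eq0.
- by move=> w nc; rewrite indic_false ?mul0r // => /vcell_cube.
Qed.

Lemma cvg_lin {T : Type} {F : set_system T} {FF : Filter F} (u : T -> 'rV[R]_m.+1) w x v i k :
  u @ F --> w -> lin x v i k (u t) @[t --> F] --> lin x v i k w.
Proof.
move=> cu; apply: cvgMl; apply: cvgB; apply: cvg_sumr => l _; apply: cvgMl;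
  by apply: cvgB; [exact: cvg_cst|exact: cvg_coord].
Qed.

Lemma continuous_lin x v i k : continuous (lin x v i k).
Proof. by move=> w; apply: (@cvg_lin _ (nbhs w) _ id); exact: cvg_id. Qed.

Lemma lin_swap x v i k w : lin x v k i w = - lin x v i k w.
Proof. by rewrite /lin lastdC normrN -mulNr opprB. Qed.

Lemma swapC x y i k w : swap idx x y k i w = - swap idx x y i k w.
Proof. by rewrite /swap opprB. Qed.

Section Pair.
Variables (x : 'M[R]_(n, m.+1)) (i k : 'I_n) (g : 'rV[R]_m.+1 -> R) (Mg : R).
Hypotheses (Dx : DI m.+1 n x) (ki : k != i) (cg : continuous g).
Hypothesis bg : forall w, cube m.+1 w -> `|g w| <= Mg.

Lemma goodrow_swapg y : goodrow Mg (fun w => swap idx x y i k w * g w).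
Proof.
split; [exact: mrow_swapg|exact: swapg_le|].
by move=> w nc; rewrite swap_cube // mul0r.
Qed.

Lemma good_swapg y : good m.+1 Mg (fun s => swap idx x y i k (rw s) * g (rw s)).
Proof. exact: (good_goodrow _ _ (goodrow_swapg y)). Qed.

Let w0 s := rw (upd m (tau x k i s) s) : 'rV[R]_m.+1.

Lemma slice_limit s : dichotomy x i k (w0 s) ->
  forall ep, 0 < ep -> \forall y \near x,
  `|Rint (fun t => swap idx x y i k (rw (upd m t s)) * g (rw (upd m t s)))
    - adj idx x i k (w0 s) * (g (w0 s) * lin x (y - x) i k (w0 s))|
  <= ep * `|y - x|.
Proof.
move=> H ep ep0; have a0 := DI_lastd _ _ _ Dx ki.
case: H => [Hin|[oi ok]].
  rewrite adj_inside //; have [ap|an|] := ltgtP 0 (lastd x k i); last first.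
  - by move=> az; rewrite -az eqxx in a0.
  (* A negative [lastd] is reduced to the positive case by exchanging [i] and [k]: both [swap] and
     [lin] change sign. *)
  - have ik : i != k by rewrite eq_sym.
    have Hin' : inside x k i (rw (upd m (tau x i k s) s)) by rewrite tauC; exact: insideC.
    have ap : 0 < lastd x i k by rewrite lastdC oppr_gt0.
    apply: filterS (slice_inside idx x k i g Mg Dx ik cg bg s ap Hin' ep ep0) => y.
    rewrite tauC -/(w0 s) lin_swap mulrN opprK.
    rewrite (_ : (fun t => swap idx x y k i _ * _) =
      (fun t => -1 * (swap idx x y i k (rw (upd m t s)) * g (rw (upd m t s))))); last first.
      by apply/funext => t; rewrite swapC mulN1r mulNr.
    rewrite RintegralZl //; last first.
      apply: (bsupp_integrable Mg); split.
      + exact: (measurable_slice (fun w => swap idx x y i k w * g w) s (mrow_swapg idx x i k g cg y)).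
      + by move=> t; exact: swapg_le.
      + move=> t; exact: (good_upd0 _ _ _ _ _ (good_swapg y)).
    move=> hyp; apply: le_trans hyp; rewrite -normrN le_eqVlt; apply/orP; left; apply/eqP.
    by congr (`| _ |); ring.
  - by apply: filterS (slice_inside idx x i k g Mg Dx ki cg bg s ap Hin ep ep0) => y; rewrite mul1r.
rewrite adj_outside //.
(* A nonzero transfer puts the point in the cell of [i] for [x] or for [y]. Near the mediator point
   all points are outside both cells, and [slice_supp] confines the slice to that neighbourhood. *)
have n1 : \forall p \near (x, tau x k i s), outside p.1 i (rw (upd m p.2 s)).
  apply: (@near_outside _ _ _ _ (nbhs (x, tau x k i s)) _ fst (fun p => rw (upd m p.2 s)) x (w0 s) i) => //.
    exact: cvg_fst.
  by apply: cvg_rw; exact: cvg_snd.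
have /nbhs_ballP[dl dl0 Hd] := n1.
have dlp : 0 < dl by exact: dl0.
have Hdl y t : `|y - x| < dl -> `|tau x k i s - t| < dl -> outside y i (rw (upd m t s)).
  move=> hy ht; apply: (Hd (y, t)); split => //=.
  by rewrite -ball_normE /ball_ /= distrC.
pose C := 3 * m.+1%:R / `|lastd x k i|.
have C0 : 0 <= C by rewrite !mulr_ge0 // invr_ge0.
have C10 : 0 < C + 1 by rewrite ltr_wpDl.
have c0 : 0 < Num.min 1 (dl / (2 * (C + 1))) by rewrite lt_min ltr01 divr_gt0 // mulr_gt0.
apply: filterS (near_small x _ c0) => y; rewrite le_min => /andP[h1].
rewrite ler_pdivlMr ?mulr_gt0 // => h2.
have hC : 0 <= `|y - x| * C by rewrite mulr_ge0.
have Ch : C * `|y - x| < dl by have := normr_ge0 (y - x); lra.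
have hdl : `|y - x| < dl by have := normr_ge0 (y - x); lra.
rewrite (_ : (fun t => _) = fun=> 0); last first.
  apply/funext => t; apply/eqP; rewrite mulf_eq0; apply/orP; left.
  apply/negPn/negP => nz; have [cw ht] := slice_supp idx x i k Dx ki y s t h1 nz.
  have ht' : `|tau x k i s - t| < dl by apply: le_lt_trans ht _; rewrite mulrAC.
  have oy := Hdl y t hdl ht'.
  have ox : outside x i (rw (upd m t s)) by apply: Hdl ht'; rewrite subrr normr0.
  by case: (swap_neq0 _ _ _ _ _ _ nz) => -[]; [move/(outside_vcell _ _ _ _ oy)|move=> _ /(outside_vcell _ _ _ _ ox)].
by rewrite /Rintegral integral0 mul0r subrr normr0 mulr_ge0 // ltW.
Qed.

Lemma pair_limit :
  (Rd_int (fun w => swap idx x y i k w * g w)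
   - iint m (fun s => adj idx x i k (w0 s) * (g (w0 s) * lin x (y - x) i k (w0 s))))
  / `|y - x| @[y --> x] --> 0.
Proof.
have a0 := DI_lastd _ _ _ Dx ki.
have Mg0 := Mg_ge0 g Mg bg.
pose A y s := Rint (fun t => swap idx x y i k (rw (upd m t s)) * g (rw (upd m t s))).
pose B y s := adj idx x i k (w0 s) * (g (w0 s) * lin x (y - x) i k (w0 s)).
have gA y : good m Mg (A y) by exact: (good_Rint _ _ _ (good_swapg y)).
have gB y : good m (Mg * (2 * m.+1%:R * `|y - x| / `|lastd x k i|)) (B y).
  apply: (good_tau x k i _ (fun w => adj idx x i k w * (g w * lin x (y - x) i k w))).
  have c0 : 0 <= 2 * m.+1%:R * `|y - x| / `|lastd x k i| by rewrite !mulr_ge0 // invr_ge0.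
  apply: goodrow_adj; last by rewrite mulr_ge0.
    by apply: mrowM; apply: mrow_continuous => //; exact: continuous_lin.
  by move=> w cw; rewrite normrM ler_pM // ?bg // lin_le.
have E y : (Rd_int (fun w => swap idx x y i k w * g w) - iint m (B y)) / `|y - x| =
   iint m (fun s => `|y - x|^-1 * (A y s - B y s)).
  have gAB := goodD _ _ _ _ _ (gA y) (goodZ _ _ _ (-1) (gB y)).
  have {}gAB : good m (Mg + `|-1| * (Mg * (2 * m.+1%:R * `|y - x| / `|lastd x k i|))) (fun s => A y s - B y s).
    by move: gAB; congr good; apply/funext => s; rewrite mulN1r.
  rewrite (iintZ _ _ _ _ gAB) (iintB _ _ _ _ _ (gA y) (gB y)) mulrC; congr (_ * (_ - _)).
  by rewrite -(iint_last _ _ _ (good_swapg y)).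
rewrite (_ : (fun y => _) = (fun y => iint m (fun s => `|y - x|^-1 * (A y s - B y s)))); last first.
  by apply/funext => y; rewrite -E.
(* The 8 is 6 from [slice_bound] plus 2 from [lin_le]. *)
apply: (@iint_cvg_at _ _ x m (Mg * (8 * m.+1%:R / `|lastd x k i|))); last first.
  apply: ae_mono (ae_dichotomy x i k Dx ki) => s _ ds.
  have := quot_cvg0 _ x _ (slice_limit s ds).
  by under eq_fun do rewrite mulrC.
apply: filterS (near_small x 1 ltr01) => y y1.
have gAB := goodZ _ _ _ (`|y - x|^-1) (goodD _ _ _ _ _ (gA y) (goodZ _ _ _ (-1) (gB y))).
rewrite (_ : (fun s => _) = (fun s => `|y - x|^-1 * (A y s + -1 * B y s))); last first.
  by apply/funext => s; rewrite mulN1r.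
apply: (good_bound _ _ _ _ gAB) => s; rewrite mulN1r.
have := slice_bound idx x i k g Mg Dx ki cg bg y s y1; rewrite -/(A y s) => H1.
have H2 : `|B y s| <= Mg * (2 * m.+1%:R * `|y - x| / `|lastd x k i|) by case: (gB y).
rewrite normrM normfV normr_id.
have [->|h] := eqVneq `|y - x| 0.
  by rewrite invr0 mul0r mulr_ge0 // mulr_ge0 // ?invr_ge0 // mulr_ge0.
have hp : 0 < `|y - x| by rewrite lt_def h normr_ge0.
rewrite mulrC ler_pdivrMr //; apply: (le_trans (ler_normB _ _)).
apply: (le_trans (lerD H1 H2)); rewrite le_eqVlt; apply/orP; left; apply/eqP; ring.
Qed.

(** The factor [adj] is discontinuous, but along the moving mediator point it is eventually
    constant: 1 in the inside case and 0 in the outside case of the dichotomy. Only the convergence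
    of [G] along that point remains. *)
Lemma med_cvg (G : 'M[R]_(n, m.+1) -> 'rV[R]_m.+1 -> R) (M : R) :
  (forall y, continuous (G y)) ->
  (forall (u : 'M[R]_(n, m.+1) -> 'rV[R]_m.+1) w, u @ x --> w -> G y (u y) @[y --> x] --> G x w) ->
  (\forall y \near x, forall w, cube m.+1 w -> `|G y w| <= M) ->
  iint m (fun s => adj idx y i k (rw (upd m (tau y k i s) s)) * G y (rw (upd m (tau y k i s) s)))
   @[y --> x] -->
  iint m (fun s => adj idx x i k (rw (upd m (tau x k i s) s)) * G x (rw (upd m (tau x k i s) s))).
Proof.
move=> cG jG bG.
have a0 := DI_lastd _ _ _ Dx ki.
pose A y s := adj idx y i k (rw (upd m (tau y k i s) s)) * G y (rw (upd m (tau y k i s) s)).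
have bx := nbhs_singleton bG.
have M0 : 0 <= M.
  by apply: le_trans (bx 0 _) => // l; rewrite mxE lexx ler01.
have gA y : (forall w, cube m.+1 w -> `|G y w| <= M) -> good m M (A y).
  move=> by_; apply: (good_tau y k i _ (fun w => adj idx y i k w * G y w)).
  by apply: goodrow_adj => //; exact: mrow_continuous.
apply: (@near_cvgD _ _ _ _ (fun y => iint m (fun s => A y s - A x s))); last first.
  apply: filterS bG => y by_.
  by rewrite (iintB _ _ _ _ _ (gA y by_) (gA x bx)) subrK.
apply: (@iint_cvg_at _ _ x m (M + `|-1| * M)).
  apply: filterS bG => y by_.
  have := goodD _ _ _ _ _ (gA y by_) (goodZ _ _ _ (-1) (gA x bx)).
  by congr good; apply/funext => s; rewrite mulN1r.
apply: ae_mono (ae_dichotomy x i k Dx ki) => s _ ds.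
have ctau : tau y k i s @[y --> x] --> tau x k i s.
  by apply: (@cvg_tau _ _ _ _ (nbhs x) _ id) => //; exact: cvg_id.
have cw : rw (upd m (tau y k i s) s) @[y --> x] --> (rw (upd m (tau x k i s) s) : 'rV[R]_m.+1).
  exact: (@cvg_rw R m _ (nbhs x) _ (fun y => tau y k i s) s _ ctau).
have cg' := jG _ _ cw.
have lastn : \forall y \near x, lastd y k i != 0.
  have c0 : 0 < `|lastd x k i| / 3 by rewrite divr_gt0 ?normr_gt0.
  apply: filterS (near_small x _ c0) => y hy; have := lastd_lip x y i k.
  have : 0 < `|lastd x k i| by rewrite normr_gt0.
  move=> h0 h1; apply/eqP => z; move: h1; rewrite z sub0r normrN; lra.
case: ds => [Hin|[oi ok]].
  have nin : \forall y \near x, inside y i k (rw (upd m (tau y k i s) s)).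
    by apply: (@near_inside _ _ _ _ (nbhs x) _ id _ x _ i k _ cw Hin); exact: cvg_id.
  have E : \forall y \near x, A y s - A x s = G y (rw (upd m (tau y k i s) s)) - G x (rw (upd m (tau x k i s) s)).
    by apply: filterS2 lastn nin => y ay iy; rewrite /A !adj_inside // !mul1r.
  apply: (@near_cvgD R 'M[R]_(n, m.+1) x _ _ _ (@cvg_zero_sub R 'M[R]_(n, m.+1) x (fun y => G y (rw (upd m (tau y k i s) s))) _ cg')).
  by apply: filterS E => y ->; rewrite addr0.
have nout : \forall y \near x, outside y i (rw (upd m (tau y k i s) s)).
  by apply: (@near_outside _ _ _ _ (nbhs x) _ id _ x _ i _ cw oi); exact: cvg_id.
apply: (@near_cvg_cst R 'M[R]_(n, m.+1)).
by apply: filterS nout => y oy; rewrite /A !adj_outside // !mul0r subrr.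
Qed.

End Pair.

Definition tiefree x w := forall i k, i != k -> sqd x i w != sqd x k w.

(** The difference of two squared distances is affine in the point, with a nonzero coefficient on
    the last coordinate. Assuming no more than that makes the lemma available for [y] near [x] as
    well. *)
Lemma ae_tiefree x : (forall i k, i != k -> lastd x i k != 0) ->
  ae m.+1 (fun s => tiefree x (rw s)).
Proof.
move=> H; apply: ae_forall => i; apply: ae_forall => k; apply: ae_imp => ik.
have : ae m.+1 (fun s => aff m.+1 (2 * csq x i k) (fun l => - (2 * (x i (inord l) - x k (inord l)))) s != 0).
  apply: ae_aff; right; exists m; split => //.
  rewrite oppr_eq0 mulf_neq0 ?pnatr_eq0 // (_ : inord m = ord_max); first exact: H.
  by apply: val_inj; rewrite /= inordK.
apply: ae_mono => s _; apply: contra => /eqP E; apply/eqP.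
rewrite -(subrr (sqd x k (rw s))) -{1}E /aff /csq /sqd mulr_sumr -big_split -sumrB.
by apply: eq_bigr => l _ /=; rewrite !mxE inord_val; field.
Qed.

(** Off ties, membership and non-membership are both decided by strict inequalities. Points on the
    boundary of the cube need no care, as the cube does not move with [y]. *)
Lemma cell_near x w k : tiefree x w ->
  \forall y \near x, \1_(vcell idx y k) w = \1_(vcell idx x k) w :> R.
Proof.
move=> tf; have [cw|nc] := pselect (cube m.+1 w); last first.
  by apply: (@nearW _ (nbhs x)) => y; rewrite !indic_false // => /vcell_cube.
have cs j : sqd y j w @[y --> x] --> sqd x j w.
  by apply: (@cvg_sqd _ _ _ _ (nbhs x) _ id (fun=> w)); [exact: cvg_id|exact: cvg_cst].
have [all|nall] := pselect (forall j, j != k -> sqd x k w < sqd x j w).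
  have : \forall y \near x, forall j, j != k -> sqd y k w < sqd y j w.
    apply: (@filter_forall _ _ _ (nbhs x)) => j; have [jk|jk] := boolP (j != k); last by apply: (@nearW _ (nbhs x)).
    have c : sqd y j w - sqd y k w @[y --> x] --> sqd x j w - sqd x k w by exact: (cvgB (cs j) (cs k)).
    have h : 0 < sqd x j w - sqd x k w by rewrite subr_gt0 all.
    by have := @near_gt0 R 'M[R]_(n, m.+1) x _ _ c h; apply: filterS => y + _; rewrite subr_gt0.
  apply: filterS => y H; rewrite !indic_true //; exact: vcell_lt.
have [j wj] : exists j, sqd x j w < sqd x k w.
  apply: contrapT => nj; apply: nall => j jk; rewrite lt_def tf //=.
  by rewrite leNgt; apply/negP => h; apply: nj; exists j.
have c : sqd y k w - sqd y j w @[y --> x] --> sqd x k w - sqd x j w by exact: (cvgB (cs k) (cs j)).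
have h : 0 < sqd x k w - sqd x j w by rewrite subr_gt0.
have := @near_gt0 R 'M[R]_(n, m.+1) x _ _ c h; apply: filterS => y.
rewrite subr_gt0 => yj; rewrite !indic_false //.
  by move=> /(vcell_le _ _ _ _ j); rewrite leNgt wj.
by move=> /(vcell_le _ _ _ _ j); rewrite leNgt yj.
Qed.

Lemma vol_cvg0 x (H : 'M[R]_(n, m.+1) -> 'rV[R]_m.+1 -> R) (M : R) : DI m.+1 n x ->
  (\forall y \near x, goodrow M (H y)) ->
  (forall w, cube m.+1 w -> tiefree x w -> H y w @[y --> x] --> 0) ->
  Rd_int (H y) @[y --> x] --> 0.
Proof.
move=> Dx gH cH; apply: (@iint_cvg_at _ _ x m.+1 M (fun y s => H y (rw s))).
  by apply: filterS gH => y gy; exact: (good_goodrow _ _ gy).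
have : ae m.+1 (fun s => tiefree x (rw s)).
  by apply: ae_tiefree => i k ik; exact: DI_lastd.
apply: ae_mono => s bs ts; apply: cH => // l; rewrite mxE; exact: bs.
Qed.

Lemma sum_cells y w (i0 : 'I_n) : cube m.+1 w -> tiefree y w ->
  \sum_i \1_(vcell idx y i) w = 1 :> R.
Proof.
move=> cw tf; pose p := [arg min_(i < i0) sqd y i w]%O.
have pmin j : sqd y p w <= sqd y j w.
  by rewrite /p; case: arg_minP => // i _; apply.
have pl j : j != p -> sqd y p w < sqd y j w by move=> jp; rewrite lt_def tf // pmin.
rewrite (bigD1 p) //= indic_true ?big1 ?addr0 //; last exact: vcell_lt.
by move=> j jp; apply: indic_false => /(vcell_le _ _ _ _ p); rewrite leNgt pl.
Qed.

End CellLimits.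

(** * Differentials and iterated integrals of row vectors *)

Section Frechet.
Context {R : realType}.

Lemma frechet_diff (V : normedModType R) (f : V -> R) (df : {linear V -> R}) (x : V) :
  continuous df ->
  (f y - f x - df (y - x)) / `|y - x| @[y --> x] --> 0 ->
  differentiable f x /\ 'd f x = df :> (V -> R).
Proof.
move=> cdf H.
have E : f \o shift x = cst (f x) + df +o_ 0 id.
  apply/eqaddoP => ep ep0.
  have /cvgr0Pnorm_le /(_ ep ep0) := H.
  move=> /nbhs_ballP[e e0 He]; apply/nbhs_ballP; exists e => // h.
  rewrite -ball_normE /ball_ /= sub0r normrN => hb.
  have := He (h + x); rewrite -ball_normE /ball_ /= opprD addrCA subrr addr0 normrN => /(_ hb).
  rewrite addrK normrM normfV normr_id => Hh.
  rewrite !fctE /= opprD addrA.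
  have [h0|hn] := eqVneq `|h| 0.
    move/eqP: h0; rewrite normr_eq0 => /eqP ->.
    by rewrite add0r linear0 subr0 subrr !normr0 mulr0.
  by move: Hh; rewrite ler_pdivrMr // lt_def hn normr_ge0.
have dE := diff_unique cdf E.
split => //; apply/diff_locallyP; rewrite dE; split => //.
Qed.

(** The pairing of a displacement with an array of partial derivatives, used with [Vgrad] as the
    candidate differential. *)
Definition lincomb {p q} (c : 'I_p -> 'I_q -> R) (v : 'M[R]_(p, q)) : R :=
  \sum_i \sum_l v i l * c i l.

Lemma lincomb_is_linear p q (c : 'I_p -> 'I_q -> R) : linear (lincomb c : 'M[R]_(p, q) -> R).
Proof.
move=> a u v; rewrite /lincomb scaler_sumr -big_split; apply: eq_bigr => i _ /=.
rewrite scaler_sumr -big_split; apply: eq_bigr => l _ /=.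
by rewrite !mxE mulrDl -mulrA.
Qed.

HB.instance Definition _ p q (c : 'I_p -> 'I_q -> R) :=
  GRing.isLinear.Build R 'M[R]_(p, q) R _ (lincomb c) (lincomb_is_linear p q c).

Lemma cvg_lincomb p q (c : 'I_p -> 'I_q -> R) {T : Type} {F : set_system T} {FF : Filter F}
  (u : T -> 'M[R]_(p, q)) v : u @ F --> v -> lincomb c (u t) @[t --> F] --> lincomb c v.
Proof.
move=> cu; apply: cvg_sumr => i _; apply: cvg_sumr => l _.
by apply: cvgMl; exact: cvg_coord.
Qed.

Lemma continuous_lincomb p q (c : 'I_p -> 'I_q -> R) : continuous (lincomb c : 'M[R]_(p, q) -> R).
Proof. by move=> v; apply: (@cvg_lincomb _ _ _ _ (nbhs v) _ id); exact: cvg_id. Qed.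

Lemma lincomb_delta p q (c : 'I_p -> 'I_q -> R) i l :
  lincomb c (delta_mx i l) = c i l.
Proof.
rewrite /lincomb (bigD1 i) //= (bigD1 l) //= mxE !eqxx mul1r big1 ?addr0; last first.
  by move=> l' ll; rewrite mxE eqxx (negbTE ll) mul0r.
rewrite big1 ?addr0 // => i' ii; rewrite big1 // => l' _.
by rewrite mxE (negbTE ii) mul0r.
Qed.

Lemma lincomb_differentiable p q (f : 'M[R]_(p, q) -> R) (c : 'I_p -> 'I_q -> R) x :
  (f y - f x - lincomb c (y - x)) / `|y - x| @[y --> x] --> 0 ->
  differentiable f x /\ 'd f x = lincomb c :> ('M[R]_(p, q) -> R).
Proof. by move=> H; apply: (frechet_diff _ _ (lincomb c)) H; exact: continuous_lincomb. Qed.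

End Frechet.

(** * Linearity of the integral over row vectors *)

Section RowIntegral.
Context {R : realType} {d : nat}.
Implicit Types (F G : 'rV[R]_d -> R).

Lemma goodrowZ M c G : goodrow M G -> goodrow (`|c| * M) (fun w => c * G w).
Proof.
move=> [mG bG zG]; split.
- by move=> d' S p mp; apply: measurable_funM => //; exact: mG.
- by move=> w; rewrite normrM ler_wpM2l.
- by move=> w nc; rewrite zG // mulr0.
Qed.

Lemma goodrowD M1 M2 F G : goodrow M1 F -> goodrow M2 G -> goodrow (M1 + M2) (fun w => F w + G w).
Proof.
move=> [mF bF zF] [mG bG zG]; split.
- by move=> d' S p mp; apply: measurable_funD; [exact: mF|exact: mG].
- by move=> w; rewrite (le_trans (ler_normD _ _)) // lerD.
- by move=> w nc; rewrite zF // zG // addr0.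
Qed.

Lemma goodrowB M1 M2 F G : goodrow M1 F -> goodrow M2 G -> goodrow (M1 + M2) (fun w => F w - G w).
Proof.
move=> gF gG; have := goodrowD _ _ _ _ gF (goodrowZ _ (-1) _ gG).
by rewrite normrN1 mul1r; congr goodrow; apply/funext => w; rewrite mulN1r.
Qed.

Lemma goodrow_sum (I : Type) (r : seq I) (P : pred I) (M : I -> R) (G : I -> 'rV[R]_d -> R) :
  (forall i, goodrow (M i) (G i)) ->
  goodrow (\sum_(i <- r | P i) M i) (fun w => \sum_(i <- r | P i) G i w).
Proof.
move=> H; elim: r => [|i r IH].
  rewrite big_nil (_ : (fun w => _) = fun=> 0); last by apply/funext => w; rewrite big_nil.
  by split => // [d' S p mp|w]; [exact: measurable_cst|rewrite normr0].
rewrite big_cons (_ : (fun w => _) = (fun w => if P i then G i w + \sum_(j <- r | P j) G j w else \sum_(j <- r | P j) G j w)); last first.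
  by apply/funext => w; rewrite big_cons.
by case: (P i) => //; exact: goodrowD.
Qed.

Lemma goodrow_le M M' G : (forall w, `|G w| <= M') -> goodrow M G -> goodrow M' G.
Proof. by move=> H []. Qed.

Lemma Rd_intZ M c G : goodrow M G -> Rd_int (fun w => c * G w) = c * Rd_int G.
Proof. by move=> gG; rewrite /Rd_int (iintZ _ _ _ _ (good_goodrow _ _ gG)). Qed.

Lemma Rd_intB M1 M2 F G : goodrow M1 F -> goodrow M2 G ->
  Rd_int (fun w => F w - G w) = Rd_int F - Rd_int G.
Proof. by move=> gF gG; rewrite /Rd_int (iintB _ _ _ _ _ (good_goodrow _ _ gF) (good_goodrow _ _ gG)). Qed.

Lemma Rd_int_sum (I : Type) (r : seq I) (P : pred I) (M : I -> R) (G : I -> 'rV[R]_d -> R) :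
  (forall i, goodrow (M i) (G i)) ->
  Rd_int (fun w => \sum_(i <- r | P i) G i w) = \sum_(i <- r | P i) Rd_int (G i).
Proof.
by move=> H; rewrite /Rd_int (iint_sum _ _ _ _ _ _ (fun i => good_goodrow _ _ (H i))).
Qed.

End RowIntegral.

(** * Continuous extension of the density off the cube *)

Section Extension.
Context {R : realType} {d : nat}.
Implicit Types (w : 'rV[R]_d) (f : 'rV[R]_d -> R).

(** Projecting onto the cube turns a density continuous on the cube only into one that is continuous
    and bounded everywhere, with the same values where the integrands live. *)
Definition clampr (t : R) : R := Num.min 1 (Num.max 0 t).
Definition clamp w : 'rV[R]_d := \row_l clampr (w 0 l).

Lemma clamp_cube w : cube d (clamp w).
Proof.
by move=> l; rewrite mxE /clampr le_min ler01 le_max lexx /= ge_min lexx.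
Qed.

Lemma clamp_id w : cube d w -> clamp w = w.
Proof.
move=> cw; apply/rowP => l; have /andP[w0 w1] := cw l; rewrite mxE /clampr.
by rewrite (max_idPr w0) (min_idPr w1).
Qed.

Lemma clampr_lip (s t : R) : `|clampr s - clampr t| <= `|s - t|.
Proof.
have h1 := ler_norm (s - t); have h2 := ler_norm (t - s); rewrite distrC in h2.
rewrite /clampr /Num.min /Num.max ler_norml.
case: (ltP 0 s) => h3; case: (ltP 0 t) => h4; case: (ltP 1 s) => h5; case: (ltP 1 t) => h6;
  rewrite ?ltr10; apply/andP; split; lra.
Qed.

Lemma clamp_continuous : continuous clamp.
Proof.
move=> w; apply/(@cvgrPdist_le _ _ _ (nbhs w) (nbhs_filter w)) => ep ep0.
apply: filterS (nbhsx_ballx w ep ep0) => v; rewrite -ball_normE /ball_ /= => /ltW.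
apply: le_trans.
rewrite [X in X <= _](_ : _ = mx_norm (clamp w - clamp v)) // mx_normrE.
apply/bigmax_leP; split => // -[i l] _ /=; rewrite ord1 !mxE.
apply: (le_trans (clampr_lip _ _)).
by have := entry_le _ _ (w - v) 0 l; rewrite !mxE.
Qed.

Lemma cube_compact : compact (cube d : set 'rV[R]_d).
Proof.
rewrite (_ : cube d = [set v : 'rV[R]_d | forall i, `[0, 1]%classic (v 0 i)]).
  by apply: (@rV_compact R d (fun=> `[0, 1]%classic)) => i; exact: segment_compact.
by apply/seteqP; split => v /= H i; have := H i; rewrite /= in_itv.
Qed.

Lemma within_clamp f : {within cube d, continuous f} -> continuous (f \o clamp).
Proof.
move=> cf w U nU.
have H : (within (cube d) (nbhs (clamp w))) (f @^-1` U).
  by rewrite nbhs_subspace_in; [exact: cf|exact: clamp_cube].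
have H2 := clamp_continuous w _ H.
by apply: (@filterS _ (nbhs w) _ _ _ _ H2) => v; apply; exact: clamp_cube.
Qed.

Lemma within_bounded f : {within cube d, continuous f} ->
  exists M, 0 <= M /\ forall w, `|f (clamp w)| <= M.
Proof.
move=> cf; have /compact_bounded := continuous_compact cf cube_compact.
move=> [M [_ HM]]; exists (`|M| + 1); split; first by rewrite addr_ge0.
move=> w; apply: HM; last by exists (clamp w) => //; exact: clamp_cube.
by rewrite ltr_pwDr // ler_norm.
Qed.

End Extension.

(** * The Voronoi potential *)

Section Potential.
Context {R : realType} {m n e : nat} (idx : 'I_n -> 'rV[int]_e).
Variables (Lam : 'rV[int]_e -> R) (f F : 'rV[R]_m.+1 -> R) (Mf : R).
Hypotheses (L1 : forall i j, `|Lam (idx i - idx j)| <= 1)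
  (Lsym : forall i j, Lam (idx i - idx j) = Lam (idx j - idx i))
  (cF : continuous F) (Mf0 : 0 <= Mf) (bF : forall w, `|F w| <= Mf)
  (fF : forall w, cube m.+1 w -> f w = F w).
Implicit Types (x y : 'M[R]_(n, m.+1)) (w : 'rV[R]_m.+1) (s : nat -> R).

Definition hpot y i w : R :=
  2^-1 * (\sum_j Lam (idx i - idx j) * sqd y j w) * F w.

Definition dbound y : R := m.+1%:R * (`|y| + 1) ^+ 2.

Lemma dbound_ge0 y : 0 <= dbound y.
Proof. by rewrite mulr_ge0 // exprn_ge0 // addr_ge0. Qed.

Lemma dist_le y j l w : cube m.+1 w -> `|y j l - w 0 l| <= `|y| + 1.
Proof.
move=> cw; have /andP[w0 w1] := cw l; apply: (le_trans (ler_normB _ _)).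
by rewrite lerD ?entry_le // ger0_norm.
Qed.

Lemma sqd_le y j w : cube m.+1 w -> `|sqd y j w| <= dbound y.
Proof.
move=> cw; rewrite ger0_norm ?sqd_ge0 //; apply: sum_le_cst => l.
by rewrite -real_normK ?num_real // !expr2 ler_pM ?dist_le.
Qed.

(** The surface integrand of [Vgrad] multiplied by the area factor, after the Euclidean norms have
    cancelled. *)
Definition gmed y i k j l w : R :=
  sqd y j w * ((y i l - w 0 l) * F w) / `|lastd y k i|.

Section Limits.
Context {T : Type} {G : set_system T} {FG : Filter G}.
Variables (u : T -> 'M[R]_(n, m.+1)) (v : T -> 'rV[R]_m.+1).

Lemma cvgcM (c a : R) (g : T -> R) : g @ G --> a -> c * g t @[t --> G] --> c * a.
Proof. by move=> cg; apply: cvgMr. Qed.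

Lemma cvg_F w : v @ G --> w -> F (v t) @[t --> G] --> F w.
Proof. by move=> cv; apply: (@continuous_cvg _ _ _ G FG v F w) => //; exact: cF. Qed.

Lemma cvg_hpot y i w : v @ G --> w -> hpot y i (v t) @[t --> G] --> hpot y i w.
Proof.
move=> cv; apply: cvgM; last exact: cvg_F.
apply: cvgMr; apply: cvg_sumr => j _; apply: cvgMr.
by apply: (cvg_sqd (fun=> y)) => //; exact: cvg_cst.
Qed.

Lemma cvg_coordF x w i l : u @ G --> x -> v @ G --> w ->
  (u t i l - v t 0 l) * F (v t) @[t --> G] --> (x i l - w 0 l) * F w.
Proof.
move=> cu cv; apply: cvgM; last exact: cvg_F.
by apply: cvgB; exact: cvg_coord.
Qed.

Lemma cvg_gmed x w i k j l : lastd x k i != 0 -> u @ G --> x -> v @ G --> w ->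
  gmed (u t) i k j l (v t) @[t --> G] --> gmed x i k j l w.
Proof.
move=> a0 cu cv; apply: cvgM.
  by apply: cvgM; [exact: cvg_sqd|exact: cvg_coordF].
apply: cvgV; first by rewrite normr_eq0.
by apply: cvg_norm; apply: cvgB; exact: cvg_coord.
Qed.

End Limits.

Lemma continuous_hpot y i : continuous (hpot y i).
Proof. by move=> w; apply: (@cvg_hpot _ (nbhs w) _ id); exact: cvg_id. Qed.

Lemma hpot_le y i w : cube m.+1 w -> `|hpot y i w| <= 2^-1 * (n%:R * dbound y) * Mf.
Proof.
move=> cw; rewrite /hpot !normrM ler_pM // ger0_norm ?invr_ge0 // ler_wpM2l ?invr_ge0 //.
apply: (le_trans (ler_norm_sum _ _ _)); apply: sum_le_cst => j.
by rewrite normrM -[leRHS]mul1r ler_pM ?sqd_le.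
Qed.

Lemma cellF y i a w : \1_(vcell idx y i) w * (a * f w) = \1_(vcell idx y i) w * (a * F w).
Proof.
have [cw|nc] := pselect (cube m.+1 w); first by rewrite fF.
by rewrite indic_false ?mul0r // => /vcell_cube.
Qed.

Lemma continuous_coordF y i l : continuous (fun w => (y i l - w 0 l) * F w).
Proof.
by move=> w; apply: (@cvg_coordF _ (nbhs w) _ (fun=> y) id); [exact: cvg_cst|exact: cvg_id].
Qed.

Lemma continuous_sqdF y j : continuous (fun w => sqd y j w * F w).
Proof. by move=> w; apply: (@cvgM _ _ (nbhs w)); [exact: continuous_sqd|exact: cF]. Qed.

Lemma continuous_gmed y i k j l : continuous (gmed y i k j l).
Proof.
move=> w; apply: (@cvgM _ _ (nbhs w)); last exact: cvg_cst.
by apply: (@cvgM _ _ (nbhs w)); [exact: continuous_sqd|exact: continuous_coordF].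
Qed.

Lemma goodrow_sqdF y i j :
  goodrow (dbound y * Mf) (fun w => \1_(vcell idx y i) w * (sqd y j w * F w)).
Proof.
apply: goodrow_cell; last by rewrite mulr_ge0 ?dbound_ge0.
  by apply: mrow_continuous; exact: continuous_sqdF.
by move=> w cw; rewrite normrM ler_pM ?sqd_le.
Qed.

Lemma goodrow_hpot x y i :
  goodrow (2^-1 * (n%:R * dbound x) * Mf) (fun w => \1_(vcell idx y i) w * hpot x i w).
Proof.
apply: goodrow_cell => [|w|]; first by apply: mrow_continuous; exact: continuous_hpot.
  exact: hpot_le.
by rewrite !mulr_ge0 ?invr_ge0 ?dbound_ge0.
Qed.

Lemma VpotE y : Vpot idx Lam f y =
  \sum_i Rd_int (fun w => \1_(vcell idx y i) w * hpot y i w).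
Proof.
rewrite /Vpot mulr_sumr; apply: eq_bigr => i _.
rewrite (_ : (fun w => _ * hpot y i w) = (fun w => \sum_j (2^-1 * Lam (idx i - idx j)) *
   (\1_(vcell idx y i) w * (sqd y j w * F w)))); last first.
  apply/funext => w; rewrite /hpot mulr_sumr mulr_suml mulr_sumr.
  by apply: eq_bigr => j _; ring.
rewrite (Rd_int_sum _ _ _ _ _ (fun j => goodrowZ _ (2^-1 * Lam (idx i - idx j)) _ (goodrow_sqdF y i j))).
rewrite mulr_sumr; apply: eq_bigr => j _.
rewrite (Rd_intZ _ _ _ (goodrow_sqdF y i j)) -mulrA; congr (_ * (_ * Rd_int _)).
by apply/funext => w; rewrite cellF enorm_sqd.
Qed.

Lemma enorm_lastd y k i : lastd y k i != 0 -> enorm (row k y - row i y) != 0.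
Proof.
move=> a0; rewrite gt_eqF // /enorm sqrtr_gt0 /edot big_ord_recr /=.
rewrite ltr_wpDl //; first by apply: sumr_ge0 => l _; rewrite -expr2 sqr_ge0.
by rewrite !mxE -expr2 lt_def sqrf_eq0 a0 sqr_ge0.
Qed.

Lemma enormC (u v : 'rV[R]_m.+1) : enorm (u - v) = enorm (v - u).
Proof.
by rewrite /enorm /edot; congr Num.sqrt; apply: eq_bigr => l _; rewrite !mxE; ring.
Qed.

Lemma VgradE y i l : (forall k, k != i -> lastd y k i != 0) ->
  Vgrad idx Lam f y i l =
  \sum_k Lam (idx i - idx k) * Rd_int (fun w => \1_(vcell idx y k) w * ((y i l - w 0 l) * F w))
  + 2^-1 * \sum_j \sum_(k | k != i) (Lam (idx k - idx j) - Lam (idx i - idx j)) *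
    iint m (fun s => adj idx y i k (rw (upd m (tau y k i s) s)) *
      gmed y i k j l (rw (upd m (tau y k i s) s))).
Proof.
move=> H; rewrite /Vgrad; congr (_ + _ * _).
  apply: eq_bigr => k _; congr (_ * Rd_int _); apply/funext => w; exact: cellF.
apply: eq_bigr => j _; apply: eq_bigr => k ki; rewrite med_intE; congr (_ * iint m _).
apply/funext => s; set w := rw _; rewrite -/(adj idx y i k w).
have [cw|nc] := pselect (cube m.+1 w); last by rewrite adj_cube // !mul0r.
rewrite fF // enorm_sqd /gmed [enorm (row i y - _)]enormC.
have a0 := H k ki; have e0 := enorm_lastd _ _ _ a0.
by rewrite !mxE; field; rewrite e0 normr_eq0 a0.
Qed.

Lemma near_lastd x : DI m.+1 n x ->
  \forall y \near x, forall i k, k != i -> lastd y k i != 0.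
Proof.
move=> Dx; apply: (@filter_forall _ _ _ (nbhs x)) => i; apply: (@filter_forall _ _ _ (nbhs x)) => k.
have [ki|ki] := boolP (k != i); last by apply: (@nearW _ (nbhs x)).
have a0 : 0 < `|lastd x k i| by rewrite normr_gt0; exact: DI_lastd.
have c0 : 0 < `|lastd x k i| / 3 by rewrite divr_gt0.
apply: filterS (near_small x _ c0) => y hy _; have := lastd_lip x y i k.
by move=> h1; apply/eqP => z; move: h1; rewrite z sub0r normrN; lra.
Qed.

Lemma near_norm x : \forall y \near x, `|y| <= `|x| + 1.
Proof.
apply: filterS (near_small x 1 ltr01) => y hy.
rewrite -[y](subrK x); apply: (le_trans (ler_normD _ _)).
by rewrite addrC lerD2l.
Qed.

Lemma cvg_vgrad_vol x i l k : DI m.+1 n x ->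
  Rd_int (fun w => \1_(vcell idx y k) w * ((y i l - w 0 l) * F w)) @[y --> x] -->
  Rd_int (fun w => \1_(vcell idx x k) w * ((x i l - w 0 l) * F w)).
Proof.
move=> Dx; pose H y w := \1_(vcell idx y k) w * ((y i l - w 0 l) * F w).
have gH y : goodrow ((`|y| + 1) * Mf) (H y).
  apply: goodrow_cell; last by rewrite mulr_ge0 // addr_ge0.
    by apply: mrow_continuous; exact: continuous_coordF.
  by move=> w cw; rewrite normrM ler_pM ?dist_le.
apply: (@near_cvgD R 'M[R]_(n, m.+1) x _ (fun y => Rd_int (fun w => H y w - H x w))); last first.
  by apply: (@nearW _ (nbhs x)) => y; rewrite (Rd_intB _ _ _ _ (gH y) (gH x)) subrK.
have V0 := @vol_cvg0 R m n x (fun y w => H y w - H x w) ((`|x| + 1 + 1) * Mf + (`|x| + 1) * Mf) Dx.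
apply: V0.
  apply: filterS (near_norm x) => y yn.
  apply: goodrow_le (goodrowB _ _ _ _ (gH y) (gH x)) => w.
  have [_ b1 _] := gH y; have [_ b2 _] := gH x.
  apply: (le_trans (ler_normB _ _)); apply: lerD (b2 w); apply: (le_trans (b1 w)).
  by rewrite ler_wpM2r // lerD2r.
move=> w cw tf.
have c : (y i l - w 0 l) * F w @[y --> x] --> (x i l - w 0 l) * F w.
  by apply: (@cvg_coordF _ (nbhs x) _ id (fun=> w)); [exact: cvg_id|exact: cvg_cst].
have c1 := @cvg_zero_sub R 'M[R]_(n, m.+1) x _ _ c.
have c2 : \1_(vcell idx x k) w * ((y i l - w 0 l) * F w - (x i l - w 0 l) * F w)
    @[y --> x] --> (0 : R).
  by rewrite -[X in _ --> X](mulr0 (\1_(vcell idx x k) w)); apply: (@cvgcM _ (nbhs x)).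
apply: (@near_cvgD R 'M[R]_(n, m.+1) x _ _ _ c2).
apply: filterS (cell_near idx x w k tf) => y E; rewrite /H E; ring.
Qed.

Lemma cvg_vgrad_surf x i l j k : DI m.+1 n x -> k != i ->
  iint m (fun s => adj idx y i k (rw (upd m (tau y k i s) s)) *
      gmed y i k j l (rw (upd m (tau y k i s) s))) @[y --> x] -->
  iint m (fun s => adj idx x i k (rw (upd m (tau x k i s) s)) *
      gmed x i k j l (rw (upd m (tau x k i s) s))).
Proof.
move=> Dx ki; have a0 := DI_lastd _ _ _ Dx ki.
(* The factors bound the squared distance, since [|y| + 1] is at most [2 * (|x| + 1)]; then the
   coordinate difference times [F]; then the inverse of [lastd y], which keeps at least half the
   size of [lastd x]. *)
apply: (@med_cvg _ _ _ _ idx x i k Dx ki (fun y => gmed y i k j l)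
  (dbound x * 4 * ((`|x| + 2) * Mf) * (2 / `|lastd x k i|))).
- by move=> y; exact: continuous_gmed.
- by move=> u w cu; apply: (@cvg_gmed _ (nbhs x) _ id u) => //; exact: cvg_id.
have n0 : 0 < `|lastd x k i| by rewrite normr_gt0.
have c0 : 0 < `|lastd x k i| / 4 by rewrite divr_gt0.
apply: filterS2 (near_norm x) (near_small x _ c0) => y y1 y2 w cw.
have ly := lastd_lip x y i k.
have ay : `|lastd x k i| / 2 <= `|lastd y k i|.
  have := ler_normB (lastd y k i) (lastd y k i - lastd x k i).
  by rewrite opprB addrCA subrr addr0; lra.
rewrite /gmed normrM normrM normrM normfV normr_id.
have ay0 : 0 < `|lastd y k i| by apply: lt_le_trans ay; rewrite divr_gt0.
apply: ler_pM; [by rewrite !mulr_ge0|by rewrite invr_ge0| |].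
  apply: ler_pM; [exact: normr_ge0|by rewrite mulr_ge0| |].
    apply: (le_trans (sqd_le _ _ _ cw)); rewrite /dbound -mulrA ler_wpM2l //.
    have x0 := normr_ge0 x; have y0 := normr_ge0 y.
    apply: (@le_trans _ _ ((`|x| + 2) ^+ 2)).
      by rewrite !expr2 ler_pM ?addr_ge0 //; lra.
    rewrite !expr2; nra.
  by apply: ler_pM => //; apply: (le_trans (dist_le _ _ _ _ cw)); lra.
rewrite -[2 / _]invf_div lef_pV2 ?posrE //; by rewrite divr_gt0.
Qed.

Lemma cvg_Vgrad x i l : DI m.+1 n x ->
  Vgrad idx Lam f y i l @[y --> x] --> Vgrad idx Lam f x i l.
Proof.
move=> Dx; rewrite VgradE; last by move=> k; exact: DI_lastd.
pose U y := \sum_k Lam (idx i - idx k) * Rd_int (fun w => \1_(vcell idx y k) w * ((y i l - w 0 l) * F w))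
  + 2^-1 * \sum_j \sum_(k | k != i) (Lam (idx k - idx j) - Lam (idx i - idx j)) *
    iint m (fun s => adj idx y i k (rw (upd m (tau y k i s) s)) *
      gmed y i k j l (rw (upd m (tau y k i s) s))).
have cU : U y @[y --> x] --> U x.
  apply: (@cvgD _ _ _ (nbhs x)).
    apply: (@cvg_sumr _ _ (nbhs x)) => k _; apply: (@cvgcM _ (nbhs x)); exact: (cvg_vgrad_vol x i l k Dx).
  apply: (@cvgcM _ (nbhs x)); apply: (@cvg_sumr _ _ (nbhs x)) => j _; apply: (@cvg_sumr _ _ (nbhs x)) => k ki.
  by apply: (@cvgcM _ (nbhs x)); exact: cvg_vgrad_surf.
have c0 := @cvg_zero_sub R 'M[R]_(n, m.+1) x U _ cU.
apply: (@near_cvgD R 'M[R]_(n, m.+1) x _ _ _ c0).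
apply: filterS (near_lastd x Dx) => y ly; rewrite subrK VgradE // => k; exact: ly.
Qed.

(** A bound that is a function of [G]: the lemmas on finite sums expect a family of bounds, and this
    one needs no choice. *)
Definition cmax (G : 'rV[R]_m.+1 -> R) : R := sup [set `|G w| | w in cube m.+1].

Lemma le_cmax G w : continuous G -> cube m.+1 w -> `|G w| <= cmax G.
Proof.
move=> cG cw; apply: sup_ubound; last by exists w.
have wG : {within cube m.+1, continuous G} by apply: continuous_subspaceT.
have := compact_bounded (continuous_compact wG (@cube_compact R m.+1)).
move=> [M [_ HM]]; exists (`|M| + 1) => _ [v cv <-]; apply: HM; last by exists v.
by rewrite ltr_pwDr // ler_norm.
Qed.

Lemma cmax_ge0 G : continuous G -> 0 <= cmax G.
Proof.
move=> cG; apply: (@le_trans _ _ `|G 0|) => //; apply: le_cmax => // l.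
by rewrite mxE lexx ler01.
Qed.

Lemma goodrow_cellc y i G : continuous G ->
  goodrow (cmax G) (fun w => \1_(vcell idx y i) w * G w).
Proof.
move=> cG; apply: goodrow_cell; [exact: mrow_continuous|move=> w cw; exact: le_cmax|exact: cmax_ge0].
Qed.

Lemma good_adjc x i k G : continuous G ->
  good m (cmax G) (fun s => adj idx x i k (rw (upd m (tau x k i s) s)) * G (rw (upd m (tau x k i s) s))).
Proof.
move=> cG; apply: (good_tau x k i _ (fun w => adj idx x i k w * G w)).
apply: goodrow_adj; [exact: mrow_continuous|move=> w cw; exact: le_cmax|exact: cmax_ge0].
Qed.

(** Half the derivative of the squared distance to [x_i] along [v]; the 2 cancels the 1/2 of the
    potential. *)
Definition disp x (v : 'M[R]_(n, m.+1)) i w : R := \sum_l (x i l - w 0 l) * v i l.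

Lemma cvg_disp x v i {T : Type} {G : set_system T} {FG : Filter G} (u : T -> 'rV[R]_m.+1) w :
  u @ G --> w -> disp x v i (u t) @[t --> G] --> disp x v i w.
Proof.
move=> cu; apply: cvg_sumr => l _; apply: cvgMl.
by apply: cvgB; [exact: cvg_cst|exact: cvg_coord].
Qed.

Lemma disp_le x v i w : DI m.+1 n x -> cube m.+1 w -> `|disp x v i w| <= m.+1%:R * `|v|.
Proof.
move=> [cx _] cw; apply: (le_trans (ler_norm_sum _ _ _)); apply: sum_le_cst => l.
rewrite normrM -[leRHS]mul1r ler_pM ?entry_le //.
by have := cx i l; have := cw l; rewrite mxE ler_norml => /andP[? ?] /andP[? ?]; lra.
Qed.

(** The derivative of [hpot] at [x] along [v], the point [w] being fixed. *)
Definition ell x v k w : R := (\sum_i Lam (idx k - idx i) * disp x v i w) * F w.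

Lemma continuous_ell x v k : continuous (ell x v k).
Proof.
move=> w; apply: (@cvgM _ _ (nbhs w)); last exact: cF.
apply: (@cvg_sumr _ _ (nbhs w)) => i _; apply: (@cvgcM _ (nbhs w)).
by apply: (@cvg_disp _ _ _ _ (nbhs w) _ id); exact: cvg_id.
Qed.

Lemma hpot_expand x y i w : hpot y i w - hpot x i w - ell x (y - x) i w =
  2^-1 * (\sum_j Lam (idx i - idx j) * \sum_l (y - x) j l ^+ 2) * F w.
Proof.
rewrite /hpot /ell -mulrBl -mulrBl; congr (_ * _); rewrite -mulrBr -sumrB.
rewrite [X in _ - X](_ : _ = 2^-1 * \sum_j Lam (idx i - idx j) * (2 * disp x (y - x) j w)); last first.
  by rewrite mulr_sumr; apply: eq_bigr => j _; field.
rewrite -mulrBr -sumrB; congr (_ * _); apply: eq_bigr => j _.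
by rewrite (sqd_expand x y j w) /disp; ring.
Qed.

Lemma sumL_le (a : 'I_n -> R) (i : 'I_n) (c : R) : (forall j, `|a j| <= c) ->
  `|\sum_j Lam (idx i - idx j) * a j| <= n%:R * c.
Proof.
move=> H; apply: (le_trans (ler_norm_sum _ _ _)); apply: sum_le_cst => j.
by rewrite normrM -[leRHS]mul1r ler_pM.
Qed.

Lemma quad_le x y i w :
  `|2^-1 * (\sum_j Lam (idx i - idx j) * \sum_l (y - x) j l ^+ 2) * F w| <=
  2^-1 * (n%:R * (m.+1%:R * `|y - x| ^+ 2)) * Mf.
Proof.
rewrite normrM ler_pM // normrM ger0_norm ?invr_ge0 // ler_wpM2l ?invr_ge0 //.
by apply: sumL_le => j; have /andP[h0 h1] := sumsq_le (y - x) j; rewrite ger0_norm.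
Qed.

Lemma ell_le x v k w : DI m.+1 n x -> cube m.+1 w ->
  `|ell x v k w| <= n%:R * (m.+1%:R * `|v|) * Mf.
Proof.
move=> Dx cw; rewrite normrM ler_pM //.
by apply: sumL_le => j; exact: disp_le.
Qed.

Lemma vol_limit x i : DI m.+1 n x ->
  (Rd_int (fun w => \1_(vcell idx y i) w * hpot y i w)
   - Rd_int (fun w => \1_(vcell idx y i) w * hpot x i w)
   - Rd_int (fun w => \1_(vcell idx x i) w * ell x (y - x) i w)) / `|y - x| @[y --> x] --> 0.
Proof.
move=> Dx.
pose H y w := \1_(vcell idx y i) w * hpot y i w - \1_(vcell idx y i) w * hpot x i w
   - \1_(vcell idx x i) w * ell x (y - x) i w.
have g1 y := goodrowB _ _ _ _ (goodrow_hpot y y i) (goodrow_hpot x y i).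
have g2 y := goodrow_cellc x i _ (continuous_ell x (y - x) i).
have gH y := goodrowB _ _ _ _ (g1 y) (g2 y).
have E y : (Rd_int (fun w => \1_(vcell idx y i) w * hpot y i w)
   - Rd_int (fun w => \1_(vcell idx y i) w * hpot x i w)
   - Rd_int (fun w => \1_(vcell idx x i) w * ell x (y - x) i w)) / `|y - x|
   = Rd_int (fun w => `|y - x|^-1 * H y w).
  rewrite (Rd_intZ _ _ _ (gH y)) (Rd_intB _ _ _ _ (g1 y) (g2 y)).
  by rewrite (Rd_intB _ _ _ _ (goodrow_hpot y y i) (goodrow_hpot x y i)) mulrC.
rewrite (_ : (fun y => _) = (fun y => Rd_int (fun w => `|y - x|^-1 * H y w))); last first.
  by apply/funext => y; exact: E.
pose K : R := 2^-1 * (n%:R * m.+1%:R) * Mf.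
have K0 : 0 <= K by rewrite !mulr_ge0 // invr_ge0.
(* [K] controls the quadratic remainder of [hpot]. The second summand pays for replacing the cell
   for [y] by the cell for [x] in the linear part: an error of first order, but one that vanishes
   for [y] near [x] at every point without ties. *)
pose C : R := K + 2 * (n%:R * m.+1%:R * Mf).
have small y w : cube m.+1 w -> `|y - x| <= 1 -> `|H y w| <= C * `|y - x|.
  move=> cw y1; have := quad_le x y i w; rewrite -hpot_expand => Hq.
  have Hl := ell_le x (y - x) i w Dx cw.
  have h0 := normr_ge0 (y - x).
  have Hq' : `|hpot y i w - hpot x i w - ell x (y - x) i w| <= K * `|y - x|.
    apply: (le_trans Hq); rewrite (_ : _ * Mf = K * `|y - x| * `|y - x|); last by rewrite /K; ring.
    by rewrite -[leRHS]mulr1 ler_wpM2l // mulr_ge0.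
  have Hl' : `|ell x (y - x) i w| <= n%:R * m.+1%:R * Mf * `|y - x|.
    by apply: (le_trans Hl); rewrite le_eqVlt; apply/orP; left; apply/eqP; ring.
  have -> : H y w = \1_(vcell idx y i) w * (hpot y i w - hpot x i w - ell x (y - x) i w)
     + (\1_(vcell idx y i) w - \1_(vcell idx x i) w) * ell x (y - x) i w by rewrite /H; ring.
  apply: (le_trans (ler_normD _ _)); rewrite /C [leRHS]mulrDl.
  have [b1 b2] : `|\1_(vcell idx y i) w : R| <= 1 /\ `|\1_(vcell idx y i) w - \1_(vcell idx x i) w : R| <= 2.
    have [->|->] := @indic01 R _ (vcell idx y i) w; have [->|->] := @indic01 R _ (vcell idx x i) w;
    by split; rewrite ?(subr0, sub0r, subrr, normrN, normr0, normr1) // ler1n.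
  apply: lerD; first by rewrite normrM -[leRHS]mul1r ler_pM.
  by rewrite normrM -mulrA ler_pM.
apply: (@vol_cvg0 R m n x (fun y w => `|y - x|^-1 * H y w) C Dx).
  apply: filterS (near_small x 1 ltr01) => y y1.
  apply: goodrow_le (goodrowZ _ (`|y - x|^-1) _ (gH y)) => w.
  have C0 : 0 <= C by rewrite addr_ge0 // !mulr_ge0.
  have [cw|nc] := pselect (cube m.+1 w); last first.
    by have [_ _ z] := gH y; rewrite z // mulr0 normr0.
  rewrite normrM normfV normr_id.
  have [->|h] := eqVneq `|y - x| 0; first by rewrite invr0 mul0r.
  by rewrite mulrC ler_pdivrMr ?small // lt_def h normr_ge0.
move=> w cw tf.
have := @quot_cvg0 R 'M[R]_(n, m.+1) x (H ^~ w).
rewrite (_ : (fun y => _) = (fun y => `|y - x|^-1 * H y w)); last by apply/funext => y; rewrite mulrC.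
apply => ep ep0.
have c0 : 0 < ep / (K + 1) by rewrite divr_gt0 // ltr_wpDl.
apply: filterS2 (cell_near idx x w i tf) (near_small x _ c0) => y Ey.
rewrite ler_pdivlMr ?ltr_wpDl // => hy.
have -> : H y w = \1_(vcell idx x i) w * (hpot y i w - hpot x i w - ell x (y - x) i w).
  by rewrite /H Ey; ring.
rewrite hpot_expand normrM.
have b1 : `|\1_(vcell idx x i) w : R| <= 1.
  by have [->|->] := @indic01 R _ (vcell idx x i) w; rewrite ?normr0 ?normr1.
apply: (le_trans (ler_pM (normr_ge0 _) (normr_ge0 _) b1 (quad_le x y i w))).
rewrite mul1r (_ : _ * Mf = (`|y - x| * K) * `|y - x|); last by rewrite /K; ring.
rewrite ler_wpM2r //; apply: le_trans hy; rewrite ler_wpM2l // lerDl //.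
Qed.

Lemma sum_sum_mul (a b : 'I_n -> R) : \sum_i \sum_k a i * b k = (\sum_i a i) * (\sum_k b k).
Proof. by rewrite big_distrlr. Qed.

Lemma continuous_hdiff x i k : continuous (fun w => hpot x i w - hpot x k w).
Proof. by move=> w; exact: (continuousB (continuous_hpot x i w) (continuous_hpot x k w)). Qed.

(** With [u] and [z] the cell indicators for [y] and [x], both summing to 1, the double sum of
    [(u_i z_k - u_k z_i)(g_i - g_k)] expands to twice the sum of [(u_i - z_i) g_i]. *)
Lemma swap_sum x y w : cube m.+1 w -> tiefree x w -> tiefree y w ->
  \sum_i (\1_(vcell idx y i) w * hpot x i w - \1_(vcell idx x i) w * hpot x i w) =
  2^-1 * \sum_i \sum_(k | k != i) swap idx x y i k w * (hpot x i w - hpot x k w).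
Proof.
move=> cw tx ty.
(* [sum_cells] minimizes over the indices and needs one to start from; without indices both sides
   are empty sums. *)
have [n0|/card_gt0P[i0 _]] := posnP #|'I_n|.
  by rewrite !big1 ?mulr0 // => i _; move: (fintype0 i n0).
pose u i : R := \1_(vcell idx y i) w; pose z i : R := \1_(vcell idx x i) w.
have su : \sum_i u i = 1 by apply: (sum_cells idx y w i0).
have sz : \sum_i z i = 1 by apply: (sum_cells idx x w i0).
pose g i := hpot x i w.
have -> : \sum_i \sum_(k | k != i) swap idx x y i k w * (hpot x i w - hpot x k w) =
   \sum_i \sum_k (((u i * g i) * z k + z i * (u k * g k)) - (u i * (z k * g k) + (z i * g i) * u k)).
  apply: eq_bigr => i _; rewrite [RHS](bigD1 i) //=.
  rewrite [X in _ = X + _](_ : _ = 0) ?add0r; last by ring.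
  by apply: eq_bigr => k _; rewrite /swap /u /z /g; ring.
have -> : \sum_i \sum_k (((u i * g i) * z k + z i * (u k * g k)) - (u i * (z k * g k) + (z i * g i) * u k)) =
  (\sum_i \sum_k (u i * g i) * z k + \sum_i \sum_k z i * (u k * g k)) -
  (\sum_i \sum_k u i * (z k * g k) + \sum_i \sum_k (z i * g i) * u k).
  rewrite -!big_split /= -sumrB; apply: eq_bigr => i _.
  by rewrite -!big_split /= -sumrB.
by rewrite !sum_sum_mul su sz sumrB /u /z /g; field.
Qed.

Lemma swap_integral x y :
  (forall i k, k != i -> lastd x k i != 0) -> (forall i k, k != i -> lastd y k i != 0) ->
  \sum_i (Rd_int (fun w => \1_(vcell idx y i) w * hpot x i w)
          - Rd_int (fun w => \1_(vcell idx x i) w * hpot x i w)) =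
  2^-1 * \sum_i \sum_(k | k != i)
    Rd_int (fun w => swap idx x y i k w * (hpot x i w - hpot x k w)).
Proof.
move=> lx ly.
have bc i k w := le_cmax _ w (continuous_hdiff x i k).
have gs i k := goodrow_swapg idx x i k _ _ (continuous_hdiff x i k) (bc i k) y.
have gsum i := goodrow_sum _ (index_enum 'I_n) (fun k => k != i) _ _ (gs i).
have gss := goodrow_sum _ (index_enum 'I_n) xpredT _ _ gsum.
have gd i := goodrowB _ _ _ _ (goodrow_hpot x y i) (goodrow_hpot x x i).
have -> : \sum_i \sum_(k | k != i)
    Rd_int (fun w => swap idx x y i k w * (hpot x i w - hpot x k w)) =
  Rd_int (fun w => \sum_i \sum_(k | k != i) swap idx x y i k w * (hpot x i w - hpot x k w)).
  rewrite (Rd_int_sum _ _ _ _ _ gsum); apply: eq_bigr => i _.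
  by rewrite (Rd_int_sum _ _ _ _ _ (gs i)).
rewrite -(Rd_intZ _ _ _ gss).
under eq_bigr do rewrite -(Rd_intB _ _ _ _ (goodrow_hpot x y _) (goodrow_hpot x x _)).
rewrite -(Rd_int_sum _ _ _ _ _ gd).
have gdd := goodrow_sum _ (index_enum 'I_n) xpredT _ _ gd.
apply: (eq_ae_iint _ _ _ _ _ (good_goodrow _ _ gdd) (good_goodrow _ _ (goodrowZ _ _ _ gss))).
have tx : ae m.+1 (fun s => tiefree x (rw s)).
  by apply: ae_tiefree => i k ik; apply: lx.
have ty : ae m.+1 (fun s => tiefree y (rw s)).
  by apply: ae_tiefree => i k ik; apply: ly.
apply: ae_mono (ae_and _ _ _ tx ty) => s bs [ts1 ts2]; apply: swap_sum => //.
by move=> l; rewrite mxE; exact: bs.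
Qed.

Lemma vol_expand x v k :
  Rd_int (fun w => \1_(vcell idx x k) w * ell x v k w) =
  \sum_i \sum_l (Lam (idx k - idx i) * v i l) *
    Rd_int (fun w => \1_(vcell idx x k) w * ((x i l - w 0 l) * F w)).
Proof.
have g0 i l := goodrowZ _ (Lam (idx k - idx i) * v i l) _ (goodrow_cellc x k _ (continuous_coordF x i l)).
have g1 i := goodrow_sum _ (index_enum 'I_m.+1) xpredT _ _ (g0 i).
rewrite (_ : (fun w => _) = (fun w => \sum_i \sum_l (Lam (idx k - idx i) * v i l) *
   (\1_(vcell idx x k) w * ((x i l - w 0 l) * F w)))); last first.
  apply/funext => w; rewrite /ell mulr_suml mulr_sumr; apply: eq_bigr => i _.
  by rewrite /disp mulr_sumr mulr_suml mulr_sumr; apply: eq_bigr => l _; ring.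
rewrite (Rd_int_sum _ _ _ _ _ g1); apply: eq_bigr => i _.
rewrite (Rd_int_sum _ _ _ _ _ (g0 i)); apply: eq_bigr => l _.
by rewrite (Rd_intZ _ _ _ (goodrow_cellc x k _ (continuous_coordF x i l))).
Qed.

(** The part of the transfer between [i] and [k] that is due to the motion of [x_i] alone. *)
Definition flux x v i k w : R :=
  (hpot x k w - hpot x i w) * disp x v i w / `|lastd x k i|.

Lemma continuous_flux x v i k : continuous (flux x v i k).
Proof.
move=> w; apply: (@cvgM _ _ (nbhs w)); last exact: cvg_cst.
apply: (@cvgM _ _ (nbhs w)); first exact: continuous_hdiff.
by apply: (@cvg_disp _ _ _ _ (nbhs w) _ id); exact: cvg_id.
Qed.

Lemma surf_expand x v i k :
  iint m (fun s => adj idx x i k (rw (upd m (tau x k i s) s)) *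
    flux x v i k (rw (upd m (tau x k i s) s))) =
  \sum_j \sum_l (2^-1 * (Lam (idx k - idx j) - Lam (idx i - idx j)) * v i l) *
    iint m (fun s => adj idx x i k (rw (upd m (tau x k i s) s)) *
      gmed x i k j l (rw (upd m (tau x k i s) s))).
Proof.
pose c j l := 2^-1 * (Lam (idx k - idx j) - Lam (idx i - idx j)) * v i l.
have g0 j l := goodZ _ _ _ (c j l) (good_adjc x i k _ (continuous_gmed x i k j l)).
have g1 j := good_sum _ _ (index_enum 'I_m.+1) xpredT _ _ (g0 j).
rewrite (_ : (fun s => _) = (fun s => \sum_j \sum_l c j l *
   (adj idx x i k (rw (upd m (tau x k i s) s)) * gmed x i k j l (rw (upd m (tau x k i s) s))))); last first.
  apply/funext => s; set w := rw _.
  rewrite /flux.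
  have -> : hpot x k w - hpot x i w =
      \sum_j 2^-1 * (Lam (idx k - idx j) - Lam (idx i - idx j)) * (sqd x j w * F w).
    rewrite /hpot -mulrBl -mulrBr -sumrB mulr_sumr mulr_suml.
    by apply: eq_bigr => j _; ring.
  rewrite mulr_suml mulr_suml mulr_sumr; apply: eq_bigr => j _.
  rewrite /disp mulr_sumr mulr_suml mulr_sumr; apply: eq_bigr => l _.
  by rewrite /c /gmed; ring.
rewrite (iint_sum _ _ _ _ _ _ g1); apply: eq_bigr => j _.
rewrite (iint_sum _ _ _ _ _ _ (g0 j)); apply: eq_bigr => l _.
by rewrite (iintZ _ _ _ _ (good_adjc x i k _ (continuous_gmed x i k j l))).
Qed.

Lemma flux_sym x v i k :
  iint m (fun s => adj idx x i k (rw (upd m (tau x k i s) s)) *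
    flux x v i k (rw (upd m (tau x k i s) s))) +
  iint m (fun s => adj idx x k i (rw (upd m (tau x i k s) s)) *
    flux x v k i (rw (upd m (tau x i k s) s))) =
  iint m (fun s => adj idx x i k (rw (upd m (tau x k i s) s)) *
    ((hpot x i (rw (upd m (tau x k i s) s)) - hpot x k (rw (upd m (tau x k i s) s)))
     * lin x v i k (rw (upd m (tau x k i s) s)))).
Proof.
have g1 := good_adjc x i k _ (continuous_flux x v i k).
have g2 := good_adjc x k i _ (continuous_flux x v k i).
rewrite -(iintD _ _ _ _ _ g1 g2); congr iint; apply/funext => s.
rewrite tauC adjC /flux /lin /disp lastdC normrN; ring.
Qed.

(** The gradient sorts contributions by the generator that moves, the increment of the potential by
    pairs of cells. By [flux_sym] each pair term is the sum of its two fluxes, and over ordered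
    pairs every flux then occurs twice, against the factor 1/2. *)
Lemma lincomb_vgrad x v : DI m.+1 n x ->
  lincomb (Vgrad idx Lam f x) v =
  \sum_i Rd_int (fun w => \1_(vcell idx x i) w * ell x v i w) +
  2^-1 * \sum_i \sum_(k | k != i)
   iint m (fun s => adj idx x i k (rw (upd m (tau x k i s) s)) *
    ((hpot x i (rw (upd m (tau x k i s) s)) - hpot x k (rw (upd m (tau x k i s) s)))
     * lin x v i k (rw (upd m (tau x k i s) s)))).
Proof.
move=> Dx; pose t i k := iint m (fun s => adj idx x i k (rw (upd m (tau x k i s) s)) *
    flux x v i k (rw (upd m (tau x k i s) s))).
have -> : 2^-1 * \sum_i \sum_(k | k != i)
   iint m (fun s => adj idx x i k (rw (upd m (tau x k i s) s)) *
    ((hpot x i (rw (upd m (tau x k i s) s)) - hpot x k (rw (upd m (tau x k i s) s)))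
     * lin x v i k (rw (upd m (tau x k i s) s)))) = \sum_i \sum_(k | k != i) t i k.
  have st : \sum_i \sum_(k | k != i) t k i = \sum_i \sum_(k | k != i) t i k.
    rewrite (exchange_big_dep xpredT) //=; apply: eq_bigr => i _.
    by apply: eq_bigl => k; rewrite eq_sym.
  rewrite (_ : \sum_i \sum_(k | k != i) iint _ _ = \sum_i \sum_(k | k != i) t i k + \sum_i \sum_(k | k != i) t k i).
    by rewrite st; field.
  rewrite -big_split; apply: eq_bigr => i _; rewrite -big_split; apply: eq_bigr => k _ /=.
  by rewrite flux_sym.
rewrite /lincomb.
under eq_bigr => i _.
  under eq_bigr => l _.
    rewrite VgradE; last by move=> k; exact: DI_lastd.
    rewrite mulrDr; over.
  rewrite big_split; over.
rewrite big_split /=; congr (_ + _).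
  under [RHS]eq_bigr do rewrite vol_expand.
  rewrite [RHS]exchange_big /=; apply: eq_bigr => i _.
  rewrite [RHS]exchange_big /=; apply: eq_bigr => l _.
  by rewrite mulr_sumr; apply: eq_bigr => k _; rewrite Lsym; ring.
apply: eq_bigr => i _; rewrite /t.
under [RHS]eq_bigr do rewrite surf_expand.
rewrite [RHS]exchange_big /=.
under [RHS]eq_bigr do rewrite exchange_big /=.
rewrite [RHS]exchange_big /=; apply: eq_bigr => l _.
rewrite mulrA mulr_sumr; apply: eq_bigr => j _.
by rewrite mulr_sumr; apply: eq_bigr => k _; ring.
Qed.

Lemma Vpot_limit x : DI m.+1 n x ->
  (Vpot idx Lam f y - Vpot idx Lam f x - lincomb (Vgrad idx Lam f x) (y - x)) / `|y - x|
    @[y --> x] --> 0.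
Proof.
move=> Dx.
pose A i y := (Rd_int (fun w => \1_(vcell idx y i) w * hpot y i w)
   - Rd_int (fun w => \1_(vcell idx y i) w * hpot x i w)
   - Rd_int (fun w => \1_(vcell idx x i) w * ell x (y - x) i w)) / `|y - x|.
pose B i k y := (Rd_int (fun w => swap idx x y i k w * (hpot x i w - hpot x k w))
   - iint m (fun s => adj idx x i k (rw (upd m (tau x k i s) s)) *
    ((hpot x i (rw (upd m (tau x k i s) s)) - hpot x k (rw (upd m (tau x k i s) s)))
     * lin x (y - x) i k (rw (upd m (tau x k i s) s))))) / `|y - x|.
have c : \sum_i A i y + 2^-1 * \sum_i \sum_(k | k != i) B i k y @[y --> x] -->
   \sum_(i < n) (0 : R) + 2^-1 * \sum_(i < n) \sum_(k < n | k != i) (0 : R).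
  apply: (@cvgD _ _ _ (nbhs x)).
    by apply: (@cvg_sumr _ _ (nbhs x)) => i _; exact: vol_limit.
  apply: (@cvgcM _ (nbhs x)); apply: (@cvg_sumr _ _ (nbhs x)) => i _.
  apply: (@cvg_sumr _ _ (nbhs x)) => k ki.
  apply: (pair_limit idx x i k _ (cmax (fun w => hpot x i w - hpot x k w)) Dx ki (continuous_hdiff x i k)).
  by move=> w cw; exact: le_cmax _ _ (continuous_hdiff x i k) cw.
rewrite [X in _ + _ * X]big1 ?mulr0 ?big1 ?addr0 // in c; last by move=> i _; rewrite big1.
apply: (@near_cvgD R 'M[R]_(n, m.+1) x _ _ _ c).
apply: filterS (near_lastd x Dx) => y ly; rewrite addr0.
have lx i k : k != i -> lastd x k i != 0 by exact: DI_lastd.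
(* This identity is exact, so the remainder is the sum of the volume errors [A] and half the
   transfer errors [B], with nothing left over. *)
have := swap_integral x y lx ly; rewrite sumrB => sw.
rewrite !VpotE lincomb_vgrad // /A /B.
rewrite -mulr_suml !sumrB.
rewrite [X in _ = _ + _ * X](_ : _ = (\sum_i \sum_(k | k != i)
    Rd_int (fun w => swap idx x y i k w * (hpot x i w - hpot x k w)) -
  \sum_i \sum_(k | k != i) iint m (fun s => adj idx x i k (rw (upd m (tau x k i s) s)) *
    ((hpot x i (rw (upd m (tau x k i s) s)) - hpot x k (rw (upd m (tau x k i s) s)))
     * lin x (y - x) i k (rw (upd m (tau x k i s) s))))) / `|y - x|); last first.
  by rewrite -sumrB mulr_suml; apply: eq_bigr => i _; rewrite -sumrB mulr_suml.
by rewrite [in RHS]mulrA [2^-1 * (_ - _)]mulrBr -sw -mulrDl; congr (_ / _); ring.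
Qed.

Lemma continuous_dVpot v x : DI m.+1 n x ->
  lincomb (Vgrad idx Lam f y) v @[y --> x] --> lincomb (Vgrad idx Lam f x) v.
Proof.
move=> Dx; apply: (@cvg_sumr _ _ (nbhs x)) => i _; apply: (@cvg_sumr _ _ (nbhs x)) => l _.
by apply: (@cvgcM _ (nbhs x)); exact: cvg_Vgrad.
Qed.

End Potential.

Theorem theorem1 (R : realType) (d e n : nat) (hd : (1 <= d)%N)
  (he : (1 <= e <= d)%N)
  (idx : 'I_n -> 'rV[int]_e) (hidx : injective idx)
  (Lam : 'rV[int]_e -> R)
  (hLam01 : forall i j : 'I_n, 0 <= Lam (idx i - idx j) <= 1)
  (hLamsym : forall i j : 'I_n, Lam (- (idx i - idx j)) = Lam (idx i - idx j))
  (hLam0 : Lam 0 = 1)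
  (f : 'rV[R]_d -> R) (hf : {within cube d, continuous f}) :
  C1_on (Vpot idx Lam f) (DI d n) /\
  forall x : 'M[R]_(n, d), DI d n x ->
    forall (i : 'I_n) (l : 'I_d),
      'D_(delta_mx i l) (Vpot idx Lam f) x = Vgrad idx Lam f x i l.
Proof.
(* Since [d] is positive there is a last coordinate, along which the mediators are graphs. *)
case: d hd he f hf => // m _ _ f hf.
have [Mf [Mf0 bF]] := within_bounded f hf.
have cF := within_clamp f hf.
have fF w : cube m.+1 w -> f w = (f \o clamp) w by move=> cw; rewrite /= clamp_id.
have L1 i j : `|Lam (idx i - idx j)| <= 1.
  by have /andP[h0 h1] := hLam01 i j; rewrite ger0_norm.
have Lsym i j : Lam (idx i - idx j) = Lam (idx j - idx i) by rewrite -hLamsym opprB.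
have D x : DI m.+1 n x -> differentiable (Vpot idx Lam f) x /\
    'd (Vpot idx Lam f) x = lincomb (Vgrad idx Lam f x) :> ('M[R]_(n, m.+1) -> R).
  move=> Dx; apply: lincomb_differentiable.
  exact: (Vpot_limit idx Lam f (f \o clamp) Mf L1 Lsym cF Mf0 bF fF x Dx).
split; last first.
  move=> x Dx i l; have [dV dE] := D x Dx.
  by rewrite deriveE // dE lincomb_delta.
split=> [x /D[]//|v].
(* The differential is known to be [lincomb] of the gradient on [DI] only, so continuity is
   transferred within that subspace; the gradient itself converges along all matrices near a point
   of [DI]. *)
apply: (@subspace_eq_continuous _ _ _ (fun x => lincomb (Vgrad idx Lam f x) v)).
  by move=> x /set_mem Dx; have [_ E] := D x Dx; exact: (esym (congr1 (fun h => h v) E)).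
apply: continuous_in_subspaceT => x; rewrite inE => Dx.
exact: (continuous_dVpot idx Lam f (f \o clamp) Mf cF Mf0 bF fF v x Dx).
Qed.
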